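(* Let $f\colon V_0\to\mathbb{R}$ be smooth and $\Gamma=\Gamma_f$. Let $\psi\in C^\infty(\mathbb{H})$ satisfy $YY\psi=0$, let $V_\psi=(Y\psi)X-(X\psi)Y+\psi Z$, and let $\phi_t\colon\mathbb{H}\to\mathbb{H}$, $t\in[-\epsilon,\epsilon]$, be the flow of $V_\psi$. Let $f_t$ be the function with $\Gamma_{f_t}=\Gamma_t=\phi_t(\Gamma)$. Let $\bar\phi_t\colon V_0\to V_0$, $\bar\phi_t(v)=\Pi(\phi_t(v))$, and let $W$ be the vector field on $V_0$ generating the $\bar\phi_t$, i.e. $W(v)=\Pi_*(V_\psi(v))=(Y\psi(v),0,\psi(v))$. Let $w_1=x\circ W$ and $w_2=(x\circ W)\cdot f+z\circ W$, so that $W=w_1\nabla_f+w_2\partial_z$. Let $U\subset V_0$ be a bounded open subset. Then there are $\epsilon_0>0$ and $C>0$, depending only on $U$, $\psi$ and $\|f\|_{L_\infty(U)}$, such that $$|E_{\bar\phi_t(U)}(f_t)-E_U(f)-(A_1+A_2)t|\le C\,(E_U(f)+\mu(U))\,t^2\qquad\text{for all }t\in[-\epsilon_0,\epsilon_0],$$ where $$A_1=\int_Uw_1\cdot\nabla_f^2f\cdot\nabla_ff+\tfrac12(\nabla_ff)^2\bigl(\partial_xw_1-\partial_z[fw_1]\bigr)\,d\mu,\qquad A_2=\int_U-\nabla_f^2w_2\cdot\nabla_ff+\tfrac12(\nabla_ff)^2\cdot\partial_zw_2\,d\mu.$$ If $\operatorname{supp}W$ is compactly contained in $U$, then $A_1=0$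 and $$A_2=\int_U\bigl(w_2\cdot\partial_zf+\nabla_fw_2\bigr)\cdot\nabla_f^2f\,d\mu=\int_Uw_2\cdot\bigl(2\partial_zf\cdot\nabla_f^2f-\nabla_f^3f\bigr)\,d\mu.$$
   Context: Heisenberg group: $\mathbb{H}=\mathbb{R}^3$ with $(x,y,z)\cdot(x',y',z')=(x+x',y+y',z+z'+\frac{xy'-yx'}{2})$; left-invariant fields $X=(1,0,-\frac y2)$, $Y=(0,1,\frac x2)$, $Z=(0,0,1)$; $Y^t=(0,t,0)$. $V_0=\{y=0\}$ is the $xz$-plane with Lebesgue measure $\mu$; $\Pi\colon\mathbb{H}\to V_0$, $\Pi(x,y,z)=(x,0,z-\frac{xy}2)$. Intrinsic graph: $\Gamma_f=\{v\cdot Y^{f(v)}:v\in V_0\}$. $\nabla_f$ is the vector field/operator $\partial_x-f\partial_z$ on $V_0$, and $\nabla_f^k$ its iterates. $E_U(f)=\frac12\int_U(\nabla_ff)^2\,d\mu$. For a vector field $W$ on $V_0$, $x\circ W$ and $z\circ W$ denote its $\partial_x$- and $\partial_z$-components. $V_\psi$ is the contact vector field with potential $\psi$; the condition $YY\psi=0$ ensures that $\phi_t$ maps cosets of $\langle Y\rangle=\{Y^s:s\in\mathbb R\}$ to cosets of $\langle Y\rangle$, hence intrinsic graphs to intrinsic graphs. It is assumed that the flow $\phi_t$ exists on $\mathbb{H}$ for $t\in[-\epsilon,\epsilon]$. Square brackets indicate the function a differential operator acts on; a dot is multiplication. *)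

(* Defs.v *)
From mathcomp Require Import all_boot all_order all_algebra.
From mathcomp Require Import all_classical all_reals all_analysis.
From mathcomp Require Import ring.

Set Implicit Arguments.
Unset Strict Implicit.
Unset Printing Implicit Defensive.

Import Order.TTheory GRing.Theory Num.Theory.
Import numFieldNormedType.Exports.

Local Open Scope classical_set_scope.
Local Open Scope ring_scope.

(* A point (x, y, z) of the Heisenberg group is p with coordinates
   x = p.1.1, y = p.1.2, z = p.2. *)
Notation heis R := (R * R * R)%type.

(* V_0 = {y = 0}: the pair (x, z) stands for the point (x, 0, z). *)
Notation plane R := (R * R)%type.

Section Smooth.
Context {R : realType} {V : normedModType R}.

(* C^n by recursion on n; on a finite-dimensional V, testing all directional
   derivatives is the same as testing the partial ones. *)
Fixpoint Cn (n : nat) (f : V -> R) : Prop :=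
  if n is k.+1 then
    (forall p, differentiable f p) /\ (forall v, Cn k ('D_v f))
  else continuous f.

Definition smooth (f : V -> R) : Prop := forall n, Cn n f.

(* The vector field A acting on functions as a derivation. *)
Definition vf_act (A : V -> V) (g : V -> R) : V -> R := fun p => 'D_(A p) g p.

(* phi is the flow of A for times in [-e, e]; at the endpoints t = -e, e the
   one-sided derivative is obtained from continuity of A and of the curve. *)
Definition is_flow (A : V -> V) (e : R) (phi : R -> V -> V) : Prop :=
  forall p, [/\ phi 0 p = p,
    {within `[- e, e], continuous (phi ^~ p)} &
    forall t, - e < t < e -> is_derive t 1 (phi ^~ p) (A (phi t p))].

End Smooth.

Section Heisenberg.
Context {R : realType}.
Implicit Types (p : heis R) (v : plane R).

Definition heis_mul p q : heis R :=
  (p.1.1 + q.1.1, p.1.2 + q.1.2,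
   p.2 + q.2 + (p.1.1 * q.1.2 - p.1.2 * q.1.1) / 2).

Definition fieldX p : heis R := (1, 0, - (p.1.2 / 2)).
Definition fieldY p : heis R := (0, 1, p.1.1 / 2).
Definition fieldZ p : heis R := (0, 0, 1).

Definition powY (t : R) : heis R := (0, t, 0).

Definition of_plane v : heis R := (v.1, 0, v.2).

Definition heis_proj p : plane R := (p.1.1, p.2 - p.1.1 * p.1.2 / 2).

Definition intrinsic_graph (f : plane R -> R) : set (heis R) :=
  range (fun v => heis_mul (of_plane v) (powY (f v))).

Definition contact_field (psi : heis R -> R) p : heis R :=
  vf_act fieldY psi p *: fieldX p - vf_act fieldX psi p *: fieldY p
  + psi p *: fieldZ p.

Definition phibar (phi : R -> heis R -> heis R) (t : R) v : plane R :=
  heis_proj (phi t (of_plane v)).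

(* The field on V_0 generating phibar: the push-forward of the contact field
   under heis_proj; see planeWE for its coordinates. *)
Definition planeW (psi : heis R -> R) v : plane R :=
  'd heis_proj (of_plane v) (contact_field psi (of_plane v)).

Definition dx (g : plane R -> R) : plane R -> R := 'D_((1, 0) : plane R) g.
Definition dz (g : plane R -> R) : plane R -> R := 'D_((0, 1) : plane R) g.

Definition nabla (f g : plane R -> R) : plane R -> R :=
  fun v => dx g v - f v * dz g v.

Definition w1 (psi : heis R -> R) v : R := (planeW psi v).1.
Definition w2 (psi : heis R -> R) (f : plane R -> R) v : R :=
  (planeW psi v).1 * f v + (planeW psi v).2.

(* measurableTypeR R is R itself, with its Borel sets. *)
Definition mu_plane : {measure set (plane (measurableTypeR R)) -> \bar R} :=
  (@lebesgue_measure R \x @lebesgue_measure R)%E.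

Definition norm_oo (U : set (plane R)) (f : plane R -> R) : \bar R :=
  ('N[mu_plane]_(+oo)[EFin \o (f \_ U)])%E.

Definition energy (U : set (plane R)) (f : plane R -> R) : \bar R :=
  ((2^-1)%:E * \int[mu_plane]_(v in U) ((nabla f f v) ^+ 2)%:E)%E.

Definition A1 (U : set (plane R)) (psi : heis R -> R) (f : plane R -> R)
    : \bar R :=
  (\int[mu_plane]_(v in U)
    (w1 psi v * iter 2 (nabla f) f v * nabla f f v
     + 2^-1 * (nabla f f v) ^+ 2
       * (dx (w1 psi) v - dz (fun u => f u * w1 psi u) v))%:E)%E.

Definition A2 (U : set (plane R)) (psi : heis R -> R) (f : plane R -> R)
    : \bar R :=
  (\int[mu_plane]_(v in U)
    (- iter 2 (nabla f) (w2 psi f) v * nabla f f v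
     + 2^-1 * (nabla f f v) ^+ 2 * dz (w2 psi f) v)%:E)%E.

Definition compactly_supported_in (U : set (plane R)) (A : plane R -> plane R) :=
  compact (closure [set v | A v != 0]) /\ closure [set v | A v != 0] `<=` U.

Let is_diff_fst (U V : normedModType R) (x : U * V) : is_diff x fst fst.
Proof.
have cF : continuous (fst : U * V -> U) by move=> y; exact: cvg_fst.
by apply: DiffDef; [exact: linear_differentiable|exact: diff_lin].
Qed.

Let is_diff_snd (U V : normedModType R) (x : U * V) : is_diff x snd snd.
Proof.
have cF : continuous (snd : U * V -> V) by move=> y; exact: cvg_snd.
by apply: DiffDef; [exact: linear_differentiable|exact: diff_lin].
Qed.

Lemma planeWE (psi : heis R -> R) v :
  planeW psi v = (vf_act fieldY psi (of_plane v), psi (of_plane v)).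
Proof.
rewrite /planeW; set p := of_plane v; set u := contact_field psi p.
pose fx := (fst : R * R -> R) \o (fst : R * R * R -> R * R).
pose fy := (snd : R * R -> R) \o (fst : R * R * R -> R * R).
pose fz := (snd : R * R * R -> R).
have dx_ : is_diff p fx fx by apply: is_diff_comp.
have dy_ : is_diff p fy fy by apply: is_diff_comp.
have dz_ : is_diff p fz fz by exact: is_diff_snd.
have pE : heis_proj = (fun q => (fx q, (fz - (2^-1 : R) *: (fx * fy)) q)).
  by apply/funext => q; congr pair; rewrite /= mulrC.
have dp := is_diff_pair dx_ (is_diffB dz_ (is_diffZ 2^-1 (is_diffM dx_ dy_))).
rewrite pE diff_val /u /contact_field /=.
set a := vf_act fieldY psi p; set b := vf_act fieldX psi p; set c := psi p.
have uE : a *: fieldX p - b *: fieldY p + c *: fieldZ p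
    = (a, - b, c - b * (v.1 / 2)).
  by congr (_, _, _); rewrite /= /GRing.scale /= ?mulr1 ?mulr0 ?mul0r ?oppr0
    ?mulr0 ?addr0 ?subr0 ?sub0r // addrC.
rewrite uE; congr pair.
change (c - b * (v.1 / 2) - 2^-1 * (v.1 * - b + 0 * a) = c).
by field.
Qed.

End Heisenberg.

(* Main.v *)
From HB Require Import structures.
Require Import Defs.
From mathcomp Require Import all_boot all_order all_algebra.
From mathcomp Require Import all_classical all_reals all_analysis.
From mathcomp Require Import measurable_realfun ess_sup_inf.
From mathcomp Require Import ring lra.

Set Implicit Arguments.
Unset Strict Implicit.
Unset Printing Implicit Defensive.

Import Order.TTheory GRing.Theory Num.Theory.
Import numFieldNormedType.Exports.

Local Open Scope classical_set_scope.
Local Open Scope ring_scope.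

(** Write a point of the group as v . Y^y with v in V_0. Since YY psi = 0, psi is
    affine in y, so the contact field becomes triangular: the planar flow phibar is
    autonomous and y satisfies a Riccati equation. The flow Phi in these coordinates
    is differentiable with an explicit first order expansion in t, and it preserves
    the planes dz + y dx = 0; applied to the tangent vector ((1, -f), nabla_f f) of
    the graph this gives nabla_{f_t} f_t (phibar v) as a quotient, hence
    (nabla_{f_t} f_t)^2 (phibar v) = g^2 + 2 t g g1 + O(t^2 (1 + g^2)) with
    g = nabla_f f. The image under phibar of a small square lies in a parallelogram
    of area (1 + t div W + O(t^2 + r)) times that of the square, which bounds
    integrals over phibar(U) from above, and from below after exchanging phibar with
    its inverse. The resulting coefficient of t is the sum of the integrands of A1
    and A2. When W has compact support in U, the integrands of A1 and of the
    differences between the three forms of A2 are divergences. *)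

(** * Derivatives and time-rescaled integral curves *)

(** Two demands shape the estimates. The constants may depend on [f] only through its bound on [U],
    so no derivative of [f] may enter them. Hence the graph is followed through a single tangent
    vector, whose last coordinate [g = nabla f f] is the only derivative of [f] to appear; [g] is
    unbounded, so every error is weighted by 1 + g^2, whose integral is 2 E_U(f) + mu(U). Lipschitz
    constants of auxiliary functions do depend on further derivatives of [f], but in the change of
    variables they multiply the side of the mollifying square and disappear in the limit. Moreover
    nothing is assumed on how the flow depends on its starting point, nor on the regularity of
    [f_t]. Differentiability of the flow is derived from bounds on the field, its derivative and its
    Taylor remainder on one ball, and each estimate that moves points gives up part of the radius.
    Differentiability of [f_t] at image points follows by writing [f_t] through the flow and its
    inverse. Measurability of the density of [f_t] is never established: it is only compared with
    weights built from [f], by monotonicity of integrals of nonnegative functions. *)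

Section DerivePair.
Context {R : realType} {U V W : normedModType R}.

Lemma is_derive_cvg (f : U -> V) a v df : is_derive a v f df ->
  (fun h : R => h^-1 *: (f (h *: v + a) - f a)) @ 0^' --> df.
Proof. by case=> fav <-; exact: fav. Qed.

Lemma cvg_is_derive (f : U -> V) a v df :
  (fun h : R => h^-1 *: (f (h *: v + a) - f a)) @ 0^' --> df ->
  is_derive a v f df.
Proof. by move=> fdf; apply: DeriveDef; [apply/cvg_ex; exists df|exact: cvg_lim]. Qed.

End DerivePair.

Section DerivePair.
Context {R : realType} {U V W : normedModType R}.

Lemma is_derive_fst (f : U -> V * W) a v df :
  is_derive a v f df -> is_derive a v (fst \o f) df.1.
Proof.
move=> /is_derive_cvg h; apply: cvg_is_derive.
exact: (cvg_comp _ _ h (@cvg_fst _ _ _ _ _)).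
Qed.

Lemma is_derive_snd (f : U -> V * W) a v df :
  is_derive a v f df -> is_derive a v (snd \o f) df.2.
Proof.
move=> /is_derive_cvg h; apply: cvg_is_derive.
exact: (cvg_comp _ _ h (@cvg_snd _ _ _ _ _)).
Qed.

Lemma is_derive_pair (f : U -> V) (g : U -> W) a v df dg :
  is_derive a v f df -> is_derive a v g dg ->
  is_derive a v (fun x => (f x, g x)) (df, dg).
Proof.
move=> /is_derive_cvg hf /is_derive_cvg hg; apply: cvg_is_derive.
exact: (cvg_pair hf hg).
Qed.

Lemma is_diff_fst (x : V * W) : is_diff x fst fst.
Proof.
have cF : continuous (fst : V * W -> V) by move=> y; exact: cvg_fst.
by apply: DiffDef; [exact: linear_differentiable|exact: diff_lin].
Qed.

Lemma is_diff_snd (x : V * W) : is_diff x snd snd.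
Proof.
have cF : continuous (snd : V * W -> W) by move=> y; exact: cvg_snd.
by apply: DiffDef; [exact: linear_differentiable|exact: diff_lin].
Qed.

End DerivePair.

Section DiffEps.
Context {R : realType} {V W : normedModType R}.

Lemma is_diff_near (f : V -> W) (x : V) (df : {linear V -> W}) :
  continuous df ->
  (forall e : R, 0 < e -> \forall h \near 0, `|f (h + x) - f x - df h| <= e * `|h|) ->
  is_diff x f df.
Proof.
move=> cdf fdf.
have fE : f \o shift x = cst (f x) + df +o_ 0 id.
  apply/eqaddoP => e e0; near=> h.
  rewrite (_ : _ h = f (h + x) - f x - df h); last by rewrite /= !fctE opprD addrA.
  by near: h; exact: fdf.
have dE := diff_unique cdf fE.
by apply: DiffDef => //; apply/diff_locallyP; rewrite dE.
Unshelve. all: by end_near. Qed.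

Lemma differentiable_near (f : V -> W) (x : V) : differentiable f x ->
  forall e : R, 0 < e -> \forall h \near 0, `|f (h + x) - f x - 'd f x h| <= e * `|h|.
Proof.
move=> /diff_locallyP[_ /eqaddoP fE] e e0; near=> h.
rewrite (_ : _ - _ - _ = (f \o shift x - (cst (f x) + 'd f x)) h); last first.
  by rewrite /= !fctE opprD addrA.
by near: h; exact: fE.
Unshelve. all: by end_near. Qed.

End DiffEps.

Section LimitDistance.
Context {R : realType} {W : normedModType R}.

Lemma cvg_dist_le_lim (T : Type) (F : set_system T) {FF : ProperFilter F}
    (g : T -> W) (l y : W) (c : R) :
  g @ F --> l -> (\forall x \near F, `|g x - y| <= c) -> `|l - y| <= c.
Proof.
move=> /cvgr_dist_le gl gc; apply/ler_addgt0Pr => e e0.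
have [x [h1 h2]] := filter_ex (filterI (gl e e0) gc).
rewrite -(subrK (g x) l) -addrA (le_trans (ler_normD _ _))// [leRHS]addrC.
by rewrite lerD.
Qed.

End LimitDistance.

Section QuasilinearDifferentiable.
Context {R : realType} {V : normedModType R} {W : completeNormedModType R}.

(* The increments of f at x are linear up to a quadratic error carrying the
   same power of the scalars as the linear terms; this forces the difference
   quotients to Ypsi0 Cauchy. *)
Lemma quasilinear_differentiable (f : V -> W) (x : V) (r B K : R) :
  0 < r -> 0 <= K ->
  (forall u, `|u| <= r -> `|f (u + x) - f x| <= B * `|u|) ->
  (forall (a b : R) u1 u2, `|u1| <= r -> `|u2| <= r -> `|a *: u1 + b *: u2| <= r ->
    `|f (a *: u1 + b *: u2 + x) - f x - a *: (f (u1 + x) - f x)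
       - b *: (f (u2 + x) - f x)|
    <= K * (`|a *: u1 + b *: u2| ^+ 2 + `|a| * `|u1| ^+ 2 + `|b| * `|u2| ^+ 2)) ->
  differentiable f x.
Proof.
move=> r0 K0 fB fK.
pose q u (a : R) := a^-1 *: (f (a *: u + x) - f x).
(* The hypothesis for the vectors [b *: u], [0] and the scalars [a / b], [0] compares the quotients
   at two scales. Both quadratic terms are at most |a| |b| |u|^2, so dividing by |a| leaves the
   factor |b|. *)
have qq u (a b : R) : a != 0 -> `|a| <= `|b| -> `|b *: u| <= r ->
    `|q u a - q u b| <= 2 * K * `|b| * `|u| ^+ 2.
  move=> a0 ab bur; have b0 : b != 0.
    by apply: contraNneq a0 => b0; move: ab; rewrite b0 normr0 normr_le0.
  have aE : (a / b) *: (b *: u) + 0 *: 0 = a *: u.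
    by rewrite scaler0 addr0 scalerA divfK.
  have := fK (a / b) 0 (b *: u) 0 bur; rewrite aE normr0 => /(_ (ltW r0)).
  have au : `|a *: u| <= `|b *: u| by rewrite !normrZ ler_wpM2r.
  move=> /(_ (le_trans au bur)).
  rewrite normr0 scale0r subr0 mul0r addr0 => h.
  have -> : q u a - q u b =
      a^-1 *: (f (a *: u + x) - f x - (a / b) *: (f (b *: u + x) - f x)).
    by rewrite scalerBr scalerA mulrA mulVf// mul1r.
  rewrite normrZ normfV ler_pdivrMl ?normr_gt0//.
  apply: (le_trans h); rewrite (normrZ a) (normrZ b) normrM normfV.
  have b0' : 0 < `|b| by rewrite normr_gt0.
  rewrite !exprMn.
  have -> : `|a| / `|b| * (`|b| ^+ 2 * `|u| ^+ 2) = `|a| * `|b| * `|u| ^+ 2.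
    by rewrite expr2; field; rewrite gt_eqF.
  have : `|a| ^+ 2 * `|u| ^+ 2 <= `|a| * `|b| * `|u| ^+ 2.
    by rewrite ler_wpM2r ?exprn_ge0// expr2 ler_wpM2l.
  move=> /(lerD (lexx (`|a| * `|b| * `|u| ^+ 2))).
  by rewrite addrC => /(ler_wpM2l K0); lra.
have small u : \forall b \near 0^', `|b *: u| <= r :> R.
  near=> b; rewrite normrZ.
  have : `|b| <= r / (`|u| + 1).
    near: b; apply: dnbhs0_le; rewrite divr_gt0// ltr_wpDl.
  rewrite ler_pdivlMr ?ltr_wpDl// => /(le_trans _); apply.
  by rewrite ler_wpM2l// lerDl.
have dq u : derivable f x u.
  apply: cauchy_cvg; apply: cauchy_exP => e e0.
  pose k := 2 * K * `|u| ^+ 2 + 1.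
  have k0 : 0 < k by rewrite ltr_wpDl// !mulr_ge0// exprn_ge0.
  have [b [bne0 [bu Ypsi0]]] : exists b : R, b != 0 /\ `|b *: u| <= r /\ `|b| < e / k.
    apply: (@filter_ex _ 0^') ; near=> b; split; first by near: b; exact: nbhs_dnbhs_neq.
    split; first by near: b; exact: small.
    by near: b; apply: dnbhs0_lt; rewrite divr_gt0.
  exists (q u b).
  suff : \forall a \near 0^', ball (q u b) e (q u a) by [].
  near=> a.
  rewrite -ball_normE/= distrC.
  apply: le_lt_trans (qq _ _ b _ _ bu) _.
  - by near: a; exact: nbhs_dnbhs_neq.
  - by near: a; apply: dnbhs0_le; rewrite normr_gt0.
  - move: Ypsi0; rewrite ltr_pdivlMr// /k => Ypsi0.
    apply: le_lt_trans Ypsi0; rewrite mulrDr mulr1.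
    by rewrite ler_wpDr// [leRHS]mulrC mulrAC.
have dq' u : q u a @[a --> 0^'] --> 'D_u f x by exact: dq.
(* Scale 1 is compared with scale [a], and [a] tends to 0. *)
have qD u : `|u| <= r -> `|f (u + x) - f x - 'D_u f x| <= 2 * K * `|u| ^+ 2.
  move=> ur; rewrite distrC; apply: (cvg_dist_le_lim (dq' u)).
  near=> a.
  have := qq u a 1; rewrite normr1 scale1r mulr1 {2}/q invr1 !scale1r; apply => //.
  - by near: a; exact: nbhs_dnbhs_neq.
  - by near: a; apply: dnbhs0_le.
(* At scale [h] the failure of linearity is of order h^2, hence of order h in the quotients. *)
have Dlin : linear (fun u => 'D_u f x).
  move=> a u v; apply/eqP; rewrite -subr_eq0 -normr_le0; apply/ler_addgt0Pr => e e0.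
  rewrite add0r -[X in `|X|]subr0.
  have lim_comb : q (a *: u + v) h - (a *: q u h + q v h) @[h --> 0^'] -->
      'D_(a *: u + v) f x - (a *: 'D_u f x + 'D_v f x).
    by apply: cvgB; [exact: dq'|apply: cvgD; [apply: cvgZr; exact: dq'|exact: dq']].
  apply: (cvg_dist_le_lim lim_comb).
  pose C := K * (`|a *: u + v| ^+ 2 + `|a| * `|u| ^+ 2 + `|v| ^+ 2).
  have C0 : 0 <= C by rewrite mulr_ge0// !addr_ge0// ?mulr_ge0// exprn_ge0.
  near=> h; rewrite subr0.
  have h0 : h != 0 by near: h; exact: nbhs_dnbhs_neq.
  have hE : a *: (h *: u) + 1 *: (h *: v) = h *: (a *: u + v).
    by rewrite scale1r scalerDr !scalerA mulrC.
  have := fK a 1 (h *: u) (h *: v); rewrite hE.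
  have -> : `|h *: u| <= r by near: h; exact: small.
  have -> : `|h *: v| <= r by near: h; exact: small.
  have -> : `|h *: (a *: u + v)| <= r by near: h; exact: small.
  move=> /(_ isT isT isT) fh.
  have -> : q (a *: u + v) h - (a *: q u h + q v h) = h^-1 *:
     (f (h *: (a *: u + v) + x) - f x - a *: (f (h *: u + x) - f x) - 1 *: (f (h *: v + x) - f x)).
    by rewrite /q scale1r opprD addrA [in RHS]scalerBr [in RHS]scalerBr !scalerA [a * _]mulrC.
  rewrite normrZ normfV ler_pdivrMl ?normr_gt0//; apply: (le_trans fh).
  rewrite (normrZ h u) (normrZ h v) (normrZ h (_ + _)) normr1 !exprMn.
  have -> : K * (`|h| ^+ 2 * `|a *: u + v| ^+ 2 + `|a| * (`|h| ^+ 2 * `|u| ^+ 2)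
      + 1 * (`|h| ^+ 2 * `|v| ^+ 2)) = `|h| * (`|h| * C).
    by rewrite /C; ring.
  rewrite ler_wpM2l//.
  have hC : `|h| <= e / (C + 1) by near: h; apply: dnbhs0_le; rewrite divr_gt0// ltr_wpDl.
  apply: (@le_trans _ _ (e / (C + 1) * C)); first by rewrite ler_wpM2r.
  by rewrite mulrAC ler_pdivrMr ?ltr_wpDl// ler_wpM2l ?(ltW e0)// lerDl.
pose DM := GRing.isLinear.Build _ _ _ _ _ Dlin.
pose D : {linear V -> W} := HB.pack (fun u => 'D_u f x) DM.
(* [V] need not be finite-dimensional, so continuity of the linear map [D] has to be extracted from
   the bound [fB]. *)
have cD : continuous D.
  apply/bounded_linear_continuous/ex_bound.
  exists (`|B| * r + 2 * K * r ^+ 2); near=> u.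
  have ur : `|u| <= r by near: u; apply: nbhs0_le.
  have h1 := qD u ur; have h2 := fB u ur.
  have h3 : `|D u| <= `|f (u + x) - f x - 'D_u f x| + `|f (u + x) - f x|.
    by rewrite distrC -{1}(subrK (f (u + x) - f x) (D u)) ler_normD.
  have h4 : B * `|u| <= `|B| * r.
    by apply: le_trans (ler_wpM2r _ (ler_norm B)) _ => //; rewrite ler_wpM2l.
  have h5 : 2 * K * `|u| ^+ 2 <= 2 * K * r ^+ 2.
    by rewrite ler_wpM2l ?mulr_ge0// ler_pXn2r ?nnegrE// ltW.
  by rewrite /=; lra.
suff : is_diff x f D by case.
apply: is_diff_near => // e e0.
near=> u.
have ur : `|u| <= r by near: u; apply: nbhs0_le.
apply: le_trans (qD _ ur) _; rewrite expr2 mulrA ler_wpM2r//.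
have : `|u| <= e / (2 * K + 1) by near: u; apply: nbhs0_le; rewrite divr_gt0// ltr_wpDl// mulr_ge0.
rewrite ler_pdivlMr ?ltr_wpDl// ?mulr_ge0// => /(le_trans _); apply.
by rewrite mulrC ler_wpM2l// lerDl.
Unshelve. all: by end_near. Qed.

End QuasilinearDifferentiable.

Section MeanValueInequality.
Context {R : realType}.

(** A property of the target space, so that it passes from [R] to products coordinate by coordinate:
    the norm of a pair is the maximum of the two norms. *)
Definition mean_value_ineq (V : normedModType R) :=
  forall (c dc : R -> V) (a b M : R), a <= b ->
  (forall x : R, a < x < b -> is_derive x 1 c (dc x)) ->
  {within `[a, b], continuous c} ->
  (forall x : R, a < x < b -> `|dc x| <= M) -> `|c b - c a| <= M * (b - a).

Lemma mean_value_ineq_real : mean_value_ineq R.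
Proof.
move=> c dc a b M; rewrite le_eqVlt => /orP[/eqP <-|ab] cdc cc dcM.
  by rewrite !subrr normr0 mulr0.
have [x xab ->] := MVT ab (fun x xab => cdc x xab) cc.
rewrite normrM [X in _ * X]ger0_norm; last by rewrite subr_ge0 ltW.
by apply: ler_wpM2r; [rewrite subr_ge0 ltW|apply: dcM].
Qed.

Lemma mean_value_ineq_pair (V W : normedModType R) :
  mean_value_ineq V -> mean_value_ineq W -> mean_value_ineq (V * W)%type.
Proof.
move=> hV hW c dc a b M ab cdc cc dcM.
rewrite prod_normE/= ge_max; apply/andP; split.
- apply: (hV (fst \o c) (fst \o dc)) => //.
  + by move=> x /cdc /is_derive_fst.
  + by move=> x; apply: (cvg_comp _ _ (cc x)); exact: cvg_fst.
  + by move=> x /dcM; rewrite prod_normE ge_max => /andP[].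
- apply: (hW (snd \o c) (snd \o dc)) => //.
  + by move=> x /cdc /is_derive_snd.
  + by move=> x; apply: (cvg_comp _ _ (cc x)); exact: cvg_snd.
  + by move=> x /dcM; rewrite prod_normE ge_max => /andP[].
Qed.

End MeanValueInequality.

(** [T] is the minimum of the compact set of times in [0, 1] at which [g] is at least [a]. *)
Lemma first_exit (R : realType) (g : R -> R) (a s : R) : {within `[0, 1], continuous g} ->
  0 <= s <= 1 -> a <= g s ->
  exists2 T, 0 <= T <= 1 & a <= g T /\ forall x : R, 0 <= x < T -> g x < a.
Proof.
move=> cg s01 ags.
have /continuous_closedP/(_ [set x | a <= x]) cA0 := cg.
have /closed_subspaceP[B cB BE] := cA0 (@closed_ge _ a).
have BP x : 0 <= x <= 1 -> B x <-> a <= g x.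
  move=> x01; have := congr1 (fun A => A x) BE.
  rewrite /setI/= in_itv/= x01 => -[e]; split=> h.
  - by have [] : a <= g x /\ true by rewrite -e.
  - by have [] : B x /\ true by rewrite e.
have cA : compact (`[0, 1] `&` B).
  exact: compact_closedI (@segment_compact _ _ _) _.
have [||T + Tmin] := @compact_EVT_min _ _ (id : R -> R) (`[0, 1]%classic `&` B) _ cA _.
- by exists s; split; [rewrite /= in_itv|apply/BP].
- by apply: continuous_subspaceT => x; exact: cvg_id.
rewrite inE => -[/=]; rewrite in_itv/= => T01 BT.
exists T => //; split; first exact/BP.
move=> x /andP[x0 xT]; rewrite ltNge; apply/negP => agx.
have x01 : 0 <= x <= 1.
  by rewrite x0/= (le_trans (ltW xT))//; case/andP: T01.
have /Tmin : x \in `[0, 1] `&` B by rewrite inE; split=> /=; [rewrite in_itv|apply/BP].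
by rewrite leNgt xT.
Qed.

Section UnitIntervalCurves.
Context {R : realType} {V : normedModType R}.
Hypothesis mviV : mean_value_ineq V.
Implicit Types (E e : R -> V).

Lemma mean_value_ineq01 E e (K s : R) : 0 <= s <= 1 ->
  {within `[0, 1], continuous E} ->
  (forall x : R, 0 < x < 1 -> is_derive x 1 E (e x)) ->
  (forall x : R, 0 < x < s -> `|e x| <= K) -> `|E s - E 0| <= K * s.
Proof.
move=> /andP[s0 s1] cE dE eK; rewrite -[s in leRHS]subr0.
apply: (mviV (dc := e)) => //.
- by move=> x /andP[x0 xs]; apply: dE; rewrite x0 (lt_le_trans xs).
- apply: continuous_subspaceW cE => x/=; rewrite !in_itv/= => /andP[-> /le_trans].
  exact.
Qed.

Lemma gronwall01 E e (l k : R) : 0 <= l <= 2^-1 -> 0 <= k ->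
  {within `[0, 1], continuous E} ->
  (forall x : R, 0 < x < 1 -> is_derive x 1 E (e x)) ->
  (forall x : R, 0 < x < 1 -> `|e x| <= l * `|E x| + k) ->
  forall s : R, 0 <= s <= 1 -> `|E s| <= 2 * (`|E 0| + k).
Proof.
move=> /andP[l0 l2] k0 cE dE eE s s01.
have cnE : {within `[0, 1], continuous (fun x => `|E x|)}.
  by move=> x; apply: (cvg_comp _ _ (cE x)); exact: norm_continuous.
have [c + cmax] := EVT_max ler01 cnE; rewrite in_itv/= => c01.
have c0 : 0 <= c <= 1 by [].
have : `|E c - E 0| <= (l * `|E c| + k) * c.
  apply: (mean_value_ineq01 c0 cE dE) => x /andP[x0 xc].
  have x1 : x < 1 by apply: lt_le_trans xc _; case/andP: c0.
  apply: le_trans (eE _ _) _; first by rewrite x0.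
  by rewrite lerD2r ler_wpM2l// cmax// in_itv/= !ltW.
have : `|E c| <= `|E c - E 0| + `|E 0|.
  by rewrite -{1}(subrK (E 0) (E c)) ler_normD.
have : `|E s| <= `|E c| by apply: cmax; rewrite in_itv.
case/andP: c0 => c0 c1.
have x0 := normr_ge0 (E c); set x := `|E c| in x0 *.
have : (l * x + k) * c <= l * x + k.
  by rewrite ler_piMr// addr_ge0// mulr_ge0.
have : l * x <= 2^-1 * x by rewrite ler_wpM2r.
lra.
Qed.

End UnitIntervalCurves.

Section VectorField.
Context {R : realType} {V : normedModType R}.
Hypothesis mviV : mean_value_ineq V.

(** All that the flow estimates use of the field, on one ball: [M] bounds its size, [L] its first
    order and [N] its second order behaviour. [DF] is tied to [F] only by the Taylor bound. *)
Record C11_on_ball (F : V -> V) (DF : V -> V -> V) (rad M L N : R) : Prop := C11OnBall {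
  C11_M_ge0 : 0 <= M;
  C11_L_ge0 : 0 <= L;
  C11_N_ge0 : 0 <= N;
  C11_bound : forall p, `|p| <= rad -> `|F p| <= M;
  C11_lip : forall p q, `|p| <= rad -> `|q| <= rad -> `|F p - F q| <= L * `|p - q|;
  C11_lin : forall p (a : R) u v, DF p (a *: u + v) = a *: DF p u + DF p v;
  C11_Dbound : forall p u, `|p| <= rad -> `|DF p u| <= L * `|u|;
  C11_Dlip : forall p q u, `|p| <= rad -> `|q| <= rad ->
    `|DF p u - DF q u| <= N * `|p - q| * `|u|;
  C11_taylor : forall p q, `|p| <= rad -> `|q| <= rad ->
    `|F p - F q - DF q (p - q)| <= N * `|p - q| ^+ 2 }.

(* Time is rescaled to [0, 1], so that the sign of t does not matter. *)
Definition solution (F : V -> V) (t : R) (c : R -> V) :=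
  {within `[0, 1], continuous c} /\
  forall s : R, 0 < s < 1 -> is_derive s 1 c (t *: F (c s)).

Variables (F : V -> V) (DF : V -> V -> V) (rad M L N t : R).
Hypothesis C11 : C11_on_ball F DF rad M L N.
Hypothesis tM : `|t| * M < 1.
Hypothesis tL : `|t| * L <= 2^-1.

Let M0 := C11_M_ge0 C11.
Let L0 := C11_L_ge0 C11.
Let N0 := C11_N_ge0 C11.

(** Up to the first time at norm [rad] the speed is at most |t| M < 1, which is too slow to cross
    the margin between [rad - 1] and [rad]. *)
Lemma solution_stays c : solution F t c -> `|c 0| <= rad - 1 ->
  forall s : R, 0 <= s <= 1 -> `|c s| <= rad.
Proof.
move=> [cc dc] c0 s s01; rewrite leNgt; apply/negP => rs.
have cnE : {within `[0, 1], continuous (fun x => `|c x|)}.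
  by move=> x; apply: (cvg_comp _ _ (cc x)); exact: norm_continuous.
have [T T01 [rT Tmin]] := first_exit cnE s01 (ltW rs).
have : `|c T - c 0| <= `|t| * M * T.
  apply: (mean_value_ineq01 mviV T01 cc dc) => x /andP[x0 xT].
  rewrite normrZ ler_wpM2l// (C11_bound C11)// ltW// Tmin// xT andbT; exact: ltW.
have : `|c T| <= `|c T - c 0| + `|c 0|.
  by rewrite -{1}(subrK (c 0) (c T)) ler_normD.
case/andP: T01 => T0 T1.
have : `|t| * M * T <= `|t| * M by rewrite ler_piMr// mulr_ge0.
move: tM; lra.
Qed.

Lemma solution_moves c : solution F t c -> `|c 0| <= rad - 1 ->
  forall s : R, 0 <= s <= 1 -> `|c s - c 0| <= `|t| * M.
Proof.
move=> sc c0 s s01; have [cc dc] := sc.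
have : `|c s - c 0| <= `|t| * M * s.
  apply: (mean_value_ineq01 mviV s01 cc dc) => x /andP[x0 xT].
  rewrite normrZ ler_wpM2l// (C11_bound C11)// (solution_stays sc)// ltW//=.
  by rewrite (le_trans (ltW xT))//; case/andP: s01.
move=> /le_trans; apply; case/andP: s01 => s0 s1.
by rewrite ler_piMr// mulr_ge0.
Qed.

Lemma solution_dist c d : solution F t c -> solution F t d ->
  `|c 0| <= rad - 1 -> `|d 0| <= rad - 1 ->
  forall s : R, 0 <= s <= 1 -> `|c s - d s| <= 2 * `|c 0 - d 0|.
Proof.
move=> sc sd c0 d0 s s01; have [cc dc] := sc; have [cd dd] := sd.
rewrite -[X in 2 * X]addr0.
apply: (@gronwall01 _ _ mviV (fun x => c x - d x)
  (fun x => t *: F (c x) - t *: F (d x)) (`|t| * L)) => //.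
- by rewrite mulr_ge0.
- by move=> x; apply: cvgB; [exact: cc|exact: cd].
- by move=> x x01; apply: is_deriveB; [exact: dc|exact: dd].
- move=> x /andP[x0 x1]; rewrite addr0 -scalerBr normrZ -mulrA ler_wpM2l//.
  by apply: (C11_lip C11); apply: solution_stays => //; rewrite !ltW.
Qed.

(** The derivative of [c - d - s t DF (d 0) u] in [s] splits into the Taylor remainder of [F], the
    drift of [DF] along [d], and [DF (d 0)] applied to the change of [c - d] since time 0. They
    produce the constants 4 N, 2 N M and 2 L^2 in this order, after |c - d| is bounded by 2 |u|. *)
Lemma solution_linearized c d : solution F t c -> solution F t d ->
  `|c 0| <= rad - 1 -> `|d 0| <= rad - 1 ->
  forall u, u = c 0 - d 0 ->
  `|c 1 - d 1 - u - t *: DF (d 0) u|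
    <= (4 * N + 2 * N * M + 2 * L ^+ 2) * `|t| * (`|t| + `|u|) * `|u|.
Proof.
move=> sc sd c0 d0 u uE; have [cc dc] := sc; have [cd dd] := sd.
have t0 := normr_ge0 t; have u0 := normr_ge0 u.
have rad0 (p : V) : `|p| <= rad - 1 -> `|p| <= rad by move/le_trans; apply; lra.
have s1 : 0 <= (1 : R) <= 1 by rewrite ler01 lexx.
pose w := DF (d 0) u.
have cE : {within `[0, 1], continuous (fun x => c x - d x)}.
  by move=> x; apply: cvgB; [exact: cc|exact: cd].
have dE (x : R) : 0 < x < 1 ->
    is_derive x 1 (fun x => c x - d x) (t *: F (c x) - t *: F (d x)).
  by move=> x01; apply: is_deriveB; [exact: dc|exact: dd].
have Dist (x : R) : 0 < x < 1 -> `|c x - d x - u| <= `|t| * L * (2 * `|u|).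
  move=> /andP[x0 x1]; have x01 : 0 <= x <= 1 by rewrite !ltW.
  apply: (@le_trans _ _ (`|t| * L * (2 * `|u|) * x)); last first.
    by rewrite ler_piMr ?(ltW x1)// !mulr_ge0.
  rewrite uE; apply: (mean_value_ineq01 mviV (E := fun x => c x - d x) x01 cE dE).
  move=> y /andP[y0 yx]; have y01 : 0 <= y <= 1.
    by rewrite (ltW y0)/= ltW// (lt_trans yx).
  rewrite -scalerBr normrZ -mulrA ler_wpM2l//.
  apply: le_trans (C11_lip C11 _ _) _; try by apply: solution_stays.
  by rewrite -uE ler_wpM2l// uE; apply: solution_dist.
rewrite (_ : _ - _ - _ - _ = (c 1 - d 1 - 1 *: (t *: w)) - (c 0 - d 0 - 0 *: (t *: w))); last first.
  by rewrite scale1r scale0r subr0 -uE addrAC.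
rewrite -[leRHS]mulr1.
apply: (mean_value_ineq01 mviV (E := fun x => c x - d x - x *: (t *: w))
  (e := fun x => t *: F (c x) - t *: F (d x) - t *: w) s1).
- move=> x; apply: cvgB; first exact: cE.
  have ct : continuous (fun z : R => z *: (t *: w)) by move=> z; exact: scalel_continuous.
  have ctw : {within `[0, 1], continuous (fun z : R => z *: (t *: w))}.
    exact: continuous_subspaceT.
  exact: ctw.
- move=> x x01; apply: is_deriveB; first exact: dE.
  rewrite -[X in is_derive _ _ _ X]scale1r.
  have -> : *:%R^~ (t *: w) = ( *:%R^~ (t *: w)) \o id by [].
  by apply: DeriveDef; [apply: diff_derivable|rewrite deriveE// diff_val].
- move=> x x01; have x01' : 0 <= x <= 1 by case/andP: x01 => *; rewrite !ltW.
  have cx := solution_stays sc c0 x01'; have dx := solution_stays sd d0 x01'.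
  have cdx := solution_dist sc sd c0 d0 x01'.
  rewrite -!scalerBr normrZ.
  have -> : F (c x) - F (d x) - w = (F (c x) - F (d x) - DF (d x) (c x - d x))
      + (DF (d x) (c x - d x) - DF (d 0) (c x - d x)) + DF (d 0) (c x - d x - u).
    have -> : DF (d 0) (c x - d x - u) = DF (d 0) (c x - d x) - w.
      rewrite (_ : c x - d x - u = (-1) *: u + (c x - d x)); last first.
        by rewrite scaleN1r addrC.
      by rewrite (C11_lin C11) scaleN1r addrC.
    by rewrite !addrA !subrK.
  have h1 := C11_taylor C11 cx dx.
  have h2 := C11_Dlip C11 (c x - d x) dx (rad0 _ d0).
  have h3 := C11_Dbound C11 (c x - d x - u) (rad0 _ d0).
  rewrite -uE in cdx; have h4 := Dist _ x01.
  have h5 := solution_moves sd d0 x01'.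
  set A := F (c x) - _ - _ in h1 *; set B := DF (d x) _ - _ in h2 *.
  set D := DF (d 0) (c x - d x - u) in h3 *.
  have h6 := ler_normD (A + B) D; have h7 := ler_normD A B.
  have h8 : `|c x - d x| ^+ 2 <= (2 * `|u|) ^+ 2.
    by rewrite ler_pXn2r// nnegrE// mulr_ge0.
  have h9 : N * `|d x - d 0| * `|c x - d x| <= N * (`|t| * M) * (2 * `|u|).
    apply: ler_pM => //; first by rewrite mulr_ge0.
    by rewrite ler_wpM2l.
  have h10 : L * `|c x - d x - u| <= L * (`|t| * L * (2 * `|u|)) by rewrite ler_wpM2l.
  have h11 : N * `|c x - d x| ^+ 2 <= N * (2 * `|u|) ^+ 2 by rewrite ler_wpM2l.
  rewrite [leRHS](_ : _ = `|t| *
    ((4 * N + 2 * N * M + 2 * L ^+ 2) * (`|t| + `|u|) * `|u|)); last by ring.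
  rewrite ler_wpM2l//.
  have : 0 <= 4 * N * `|t| * `|u| by rewrite !mulr_ge0.
  have : 0 <= 2 * N * M * `|u| * `|u| by rewrite !mulr_ge0.
  have : 0 <= 2 * L ^+ 2 * `|u| * `|u| by rewrite !mulr_ge0.
  lra.
Qed.

(** The combination of the four curves vanishes at time 0 and solves a linear equation along [c]
    whose source consists of three Taylor remainders; [gronwall01] concludes. The bound has exactly
    the form required by [quasilinear_differentiable]. *)
Lemma solution_quasilinear c c1 c2 c3 (a b : R) :
  solution F t c -> solution F t c1 -> solution F t c2 -> solution F t c3 ->
  `|c 0| <= rad - 1 -> `|c1 0| <= rad - 1 -> `|c2 0| <= rad - 1 -> `|c3 0| <= rad - 1 ->
  forall u1 u2 u3, u1 = c1 0 - c 0 -> u2 = c2 0 - c 0 -> u3 = c3 0 - c 0 ->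
  u3 = a *: u1 + b *: u2 ->
  `|c3 1 - c 1 - a *: (c1 1 - c 1) - b *: (c2 1 - c 1)| <=
    8 * `|t| * N * (`|u3| ^+ 2 + `|a| * `|u1| ^+ 2 + `|b| * `|u2| ^+ 2).
Proof.
move=> sc s1 s2 s3 c0 c10 c20 c30 u1 u2 u3 u1D u2D u3D u3E.
have [cc dc] := sc; have [cc1 dc1] := s1; have [cc2 dc2] := s2; have [cc3 dc3] := s3.
pose E x := c3 x - c x - a *: (c1 x - c x) - b *: (c2 x - c x).
pose K := `|t| * (4 * N * (`|u3| ^+ 2 + `|a| * `|u1| ^+ 2 + `|b| * `|u2| ^+ 2)).
have E0 : E 0 = 0.
  by rewrite /E -u3D u3E -u1D -u2D [X in X - _ - _]addrC addrK subrr.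
have K0 : 0 <= K by rewrite !mulr_ge0// !addr_ge0// ?mulr_ge0// ?exprn_ge0.
suff : `|E 1| <= 2 * (`|E 0| + K).
  by rewrite E0 normr0 add0r => /le_trans; apply; rewrite /K; lra.
have s01 : 0 <= (1 : R) <= 1 by rewrite ler01 lexx.
apply: (gronwall01 (l := `|t| * L) mviV _ K0 (E := E) (e := fun x =>
  (t *: F (c3 x) - t *: F (c x)) - a *: (t *: F (c1 x) - t *: F (c x))
  - b *: (t *: F (c2 x) - t *: F (c x)))) => //.
- by rewrite mulr_ge0.
- move=> x; rewrite /E.
  by apply: cvgB; [apply: cvgB|]; [|apply: cvgZr|apply: cvgZr];
    apply: cvgB; (exact: cc || exact: cc1 || exact: cc2 || exact: cc3).
- move=> x x01; have := dc _ x01; have := dc1 _ x01; have := dc2 _ x01; have := dc3 _ x01.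
  by move=> *; apply: is_deriveB.
- move=> x x01; have x01' : 0 <= x <= 1 by case/andP: x01 => *; rewrite !ltW.
  have cx := solution_stays sc c0 x01'.
  have rem d : solution F t d -> `|d 0| <= rad - 1 ->
      `|F (d x) - F (c x) - DF (c x) (d x - c x)| <= 4 * N * `|d 0 - c 0| ^+ 2.
    move=> sd d0; have dx := solution_stays sd d0 x01'.
    apply: le_trans (C11_taylor C11 dx cx) _.
    rewrite [leRHS](_ : _ = N * (2 * `|d 0 - c 0|) ^+ 2); last by ring.
    rewrite ler_wpM2l// ler_pXn2r// ?nnegrE ?mulr_ge0//.
    exact: solution_dist.
  have r1 := rem _ s1 c10; have r2 := rem _ s2 c20; have r3 := rem _ s3 c30.
  set A1 := (_ - _ - _) in r1; set A2 := (_ - _ - _) in r2; set A3 := (_ - _ - _) in r3.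
  have DE : DF (c x) (E x) = DF (c x) (c3 x - c x)
      - a *: DF (c x) (c1 x - c x) - b *: DF (c x) (c2 x - c x).
    rewrite /E (_ : _ - _ - _ = (- b) *: (c2 x - c x) + ((- a) *: (c1 x - c x) + (c3 x - c x))).
      by rewrite !(C11_lin C11) !scaleNr [RHS]addrC; congr (_ + _); rewrite addrC.
    by rewrite !scaleNr [RHS]addrC; congr (_ + _); rewrite addrC.
  have subrACA (y z v w : V) : y - z - (v - w) = y - v - (z - w).
    by rewrite !opprB addrACA [RHS]addrACA [- z - v]addrC.
  have module_identity (X1 X2 X3 d1 d2 d3 : V) :
      t *: X3 - a *: (t *: X1) - b *: (t *: X2) =
      t *: (X3 - d3 - a *: (X1 - d1) - b *: (X2 - d2) + (d3 - a *: d1 - b *: d2)).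
    rewrite ![_ *: (_ - d1)]scalerBr ![_ *: (_ - d2)]scalerBr.
    rewrite [X3 - d3 - _]subrACA [X3 - _ - _ - _]subrACA subrK !scalerBr !scalerA.
    by rewrite ![t * _]mulrC.
  rewrite -!scalerBr (module_identity _ _ _ (DF (c x) (c1 x - c x))
    (DF (c x) (c2 x - c x)) (DF (c x) (c3 x - c x))) -DE -/A1 -/A2 -/A3.
  rewrite normrZ [leRHS](_ : _ = `|t| * (L * `|E x| +
    4 * N * (`|u3| ^+ 2 + `|a| * `|u1| ^+ 2 + `|b| * `|u2| ^+ 2))); last by rewrite /K; ring.
  rewrite ler_wpM2l//.
  have h0 := C11_Dbound C11 (E x) cx.
  have h1 := ler_normD (A3 - a *: A1 - b *: A2) (DF (c x) (E x)).
  have h2 := ler_normB (A3 - a *: A1) (b *: A2).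
  have h3 := ler_normB A3 (a *: A1).
  move: h2 h3; rewrite !normrZ => h2 h3.
  rewrite -u1D in r1; rewrite -u2D in r2; rewrite -u3D in r3.
  have h4 : `|a| * `|A1| <= `|a| * (4 * N * `|u1| ^+ 2) by rewrite ler_wpM2l.
  have h5 : `|b| * `|A2| <= `|b| * (4 * N * `|u2| ^+ 2) by rewrite ler_wpM2l.
  lra.
Qed.

End VectorField.

(** * Smooth functions *)

Section SmoothCalculus.
Context {R : realType} {V : normedModType R}.
Implicit Types (f g : V -> R).

Lemma CnW n f : Cn n.+1 f -> Cn n f.
Proof.
elim: n f => [|n IHn] f [df Df].
  by move=> p; exact: differentiable_continuous.
by split=> // v; apply: IHn; exact: Df.
Qed.

Lemma Cn_cst n (c : R) : Cn n (fun _ : V => c).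
Proof.
elim: n c => [|n IHn] c; first by move=> p; exact: cvg_cst.
split=> [p|v]; first exact: differentiable_cst.
by rewrite (_ : 'D_v _ = fun=> 0) //; apply/funext => p; exact: derive_cst.
Qed.

Lemma CnD n f g : Cn n f -> Cn n g -> Cn n (fun p => f p + g p).
Proof.
elim: n f g => [|n IHn] f g; first by move=> cf cg p; apply: cvgD; [exact: cf|exact: cg].
move=> [df Df] [dg Dg]; split=> [p|v]; first exact: differentiableD.
rewrite (_ : 'D_v _ = fun p => 'D_v f p + 'D_v g p); first exact: (IHn _ _ (Df v) (Dg v)).
by apply/funext => p; apply: deriveD; exact: diff_derivable.
Qed.

Lemma CnM n f g : Cn n f -> Cn n g -> Cn n (fun p => f p * g p).
Proof.
elim: n f g => [|n IHn] f g; first by move=> cf cg p; apply: cvgM; [exact: cf|exact: cg].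
move=> cf cg; have [df Df] := cf; have [dg Dg] := cg.
split=> [p|v]; first exact: differentiableM.
rewrite (_ : 'D_v _ = fun p => f p * 'D_v g p + g p * 'D_v f p).
  by apply: CnD; [exact: (IHn _ _ (CnW cf) (Dg v))|exact: (IHn _ _ (CnW cg) (Df v))].
by apply/funext => p; rewrite [LHS]deriveM//; exact: diff_derivable.
Qed.

Lemma smooth_cst (c : R) : smooth (fun _ : V => c).
Proof. by move=> n; exact: Cn_cst. Qed.

Lemma smoothD f g : smooth f -> smooth g -> smooth (fun p => f p + g p).
Proof. by move=> sf sg n; exact: CnD. Qed.

Lemma smoothM f g : smooth f -> smooth g -> smooth (fun p => f p * g p).
Proof. by move=> sf sg n; exact: CnM. Qed.

Lemma smoothN f : smooth f -> smooth (fun p => - f p).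
Proof.
move=> sf; rewrite (_ : (fun p => _) = fun p => (-1) * f p).
  by apply: smoothM => //; exact: smooth_cst.
by apply/funext => p; rewrite mulN1r.
Qed.

Lemma smoothB f g : smooth f -> smooth g -> smooth (fun p => f p - g p).
Proof. by move=> sf sg; apply: smoothD => //; exact: smoothN. Qed.

Lemma smooth_derive f v : smooth f -> smooth ('D_v f).
Proof. by move=> sf n; have [_ Df] := sf n.+1; exact: Df. Qed.

Lemma smooth_differentiable f p : smooth f -> differentiable f p.
Proof. by move=> /(_ 1%N)[]. Qed.

Lemma smooth_continuous f : smooth f -> continuous f.
Proof. by move=> /(_ 0%N). Qed.

Lemma smooth_derivable f p v : smooth f -> derivable f p v.
Proof. by move=> sf; apply: diff_derivable; exact: smooth_differentiable. Qed.

Lemma deriveDl_smooth f p u v (a : R) : smooth f ->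
  'D_(a *: u + v) f p = a * 'D_u f p + 'D_v f p.
Proof.
by move=> /smooth_differentiable df; rewrite !deriveE// linearP.
Qed.

Lemma derive_comb2 f p u v (a b : R) : smooth f ->
  'D_(a *: u + b *: v) f p = a * 'D_u f p + b * 'D_v f p.
Proof.
move=> sf; rewrite deriveDl_smooth//; congr (_ + _).
by rewrite -[b *: v]addr0 deriveDl_smooth// derive0 addr0.
Qed.

Lemma derive_comb3 f p u v w (a b c : R) : smooth f ->
  'D_(a *: u + b *: v + c *: w) f p = a * 'D_u f p + b * 'D_v f p + c * 'D_w f p.
Proof. by move=> sf; rewrite -addrA deriveDl_smooth// derive_comb2// addrA. Qed.

Lemma is_derive_line (W : normedModType R) (f : V -> W) (q u : V) (s : R) :
  derivable f (s *: u + q) u ->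
  is_derive s 1 (fun x : R => f (x *: u + q)) ('D_u f (s *: u + q)).
Proof.
move=> df.
pose g (h : R) := h^-1 *: ((f \o shift (s *: u + q)) (h *: u) - f (s *: u + q)).
have gE : (fun h : R => h^-1 *: (((fun x : R => f (x *: u + q)) \o shift s) (h *: (1 : R))
    - f (s *: u + q))) = g.
  apply/funext => h; rewrite /g /=.
  by rewrite [h%:A]mulr1 scalerDl addrA.
by apply: DeriveDef; rewrite /derivable /derive gE.
Qed.

Lemma smooth_segment_MVT f (p q : V) : smooth f ->
  exists2 s : R, 0 < s < 1 & f p - f q = 'D_(p - q) f (s *: (p - q) + q).
Proof.
move=> sf; pose g (x : R) := f (x *: (p - q) + q).
have dg (x : R) : is_derive x 1 g ('D_(p - q) f (x *: (p - q) + q)).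
  by apply: is_derive_line; exact: smooth_derivable.
have cg : {within `[0, 1], continuous g}.
  apply: continuous_subspaceT => x; apply: differentiable_continuous.
  by apply/derivable1_diffP; have [] := dg x.
have [s] := MVT ltr01 (fun x _ => dg x) cg.
rewrite in_itv/= => s01; rewrite /g scale1r scale0r add0r subrK subr0 mulr1 => ->.
by exists s.
Qed.

End SmoothCalculus.

Section SmoothLinear.
Context {R : realType} {V W : normedModType R}.
Variable L : {linear V -> W}.
Hypothesis cL : continuous L.

Lemma derive_comp_linear (f : W -> R) v :
  'D_v (f \o L) = 'D_(L v) f \o L.
Proof.
apply/funext => p; rewrite /derive.
suff -> : (fun h : R => h^-1 *: (((f \o L) \o shift p) (h *: v) - (f \o L) p)) =
    (fun h : R => h^-1 *: ((f \o shift (L p)) (h *: L v) - f (L p))) by [].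
by apply/funext => h; rewrite /= linearP.
Qed.

Lemma smooth_comp_linear (f : W -> R) : smooth f -> smooth (f \o L).
Proof.
move=> sf n; elim: n f sf => [|n IHn] f sf.
  by move=> p; apply: continuous_comp; [exact: cL|exact: smooth_continuous].
split=> [p|v].
  apply: differentiable_comp; last exact: smooth_differentiable.
  exact: linear_differentiable.
by rewrite derive_comp_linear; apply: IHn; exact: smooth_derive.
Qed.

End SmoothLinear.

Section SmoothFunctional.
Context {R : realType} {V : normedModType R}.

Lemma smooth_linear (L : {linear V -> R}) : continuous L -> smooth L.
Proof.
move=> cL [|n]; first by [].
split=> [p|v]; first exact: linear_differentiable.
rewrite (_ : 'D_v L = fun=> L v); first exact: Cn_cst.
by apply/funext => p; rewrite deriveE ?diff_lin//; exact: linear_differentiable.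
Qed.

End SmoothFunctional.

Section SmoothBounds.
Context {R : realType}.
Local Notation V := (heis R).

Lemma compact_heis_ball (r : R) : compact [set p : V | `|p| <= r].
Proof.
have -> : [set p : V | `|p| <= r] = `[- r, r] `*` `[- r, r] `*` `[- r, r].
  apply/seteqP; split => -[[x y] z] /=; rewrite !in_itv/= -!ler_norml !prod_normE/= !ge_max.
    by move=> /andP[/andP[-> ->] ->].
  by move=> [[-> ->] ->].
by apply: compact_setX; [apply: compact_setX|]; exact: segment_compact.
Qed.

Lemma continuous_bounded_ball (f : V -> R) (r : R) : continuous f ->
  exists2 K, 0 <= K & forall p, `|p| <= r -> `|f p| <= K.
Proof.
move=> cf; have [r0|r0] := ltP r 0.
  exists 0 => // p pr; have := normr_ge0 p; lra.
have ne : [set p : V | `|p| <= r] !=set0 by exists 0; rewrite /= normr0.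
have cnf : {within [set p : V | `|p| <= r], continuous (fun p => `|f p|)}.
  by apply: continuous_subspaceT => p; apply: cvg_norm; exact: cf.
have [c _ cmax] := compact_EVT_max ne (@compact_heis_ball r) cnf.
by exists `|f c| => // p pr; apply: cmax; rewrite inE.
Qed.

Let e1 : V := (1, 0, 0).
Let e2 : V := (0, 1, 0).
Let e3 : V := (0, 0, 1).

Lemma derive_heisE (f : V -> R) p (u : V) : smooth f ->
  'D_u f p = u.1.1 * 'D_e1 f p + u.1.2 * 'D_e2 f p + u.2 * 'D_e3 f p.
Proof.
move=> sf.
have uE : u = u.1.1 *: e1 + u.1.2 *: e2 + u.2 *: e3.
  by case: u => -[a b] c /=; congr (_, _, _);
    rewrite /= /GRing.scale/= ?mulr1 ?mulr0 ?addr0 ?add0r.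
by rewrite {1}uE; exact: derive_comb3.
Qed.

Lemma heis_coord_le (u : V) : [/\ `|u.1.1| <= `|u|, `|u.1.2| <= `|u| & `|u.2| <= `|u|].
Proof. by rewrite !prod_normE/= !le_max !lexx ?orbT. Qed.

Lemma smooth_derive_bounded (f : V -> R) (r : R) : smooth f ->
  exists2 K, 0 <= K & forall p u, `|p| <= r -> `|'D_u f p| <= K * `|u|.
Proof.
move=> sf.
have cD v : continuous ('D_v f) by apply: smooth_continuous; exact: smooth_derive.
have [K1 K10 B1] := continuous_bounded_ball r (cD e1).
have [K2 K20 B2] := continuous_bounded_ball r (cD e2).
have [K3 K30 B3] := continuous_bounded_ball r (cD e3).
exists (K1 + K2 + K3); first by rewrite !addr_ge0.
move=> p u pr; rewrite (derive_heisE p u sf).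
have [u1 u2 u3] := heis_coord_le u.
apply: le_trans (ler_normD _ _) _; rewrite mulrDl lerD//; last first.
  by rewrite normrM mulrC ler_pM// B3.
apply: le_trans (ler_normD _ _) _; rewrite mulrDl lerD//.
  by rewrite normrM mulrC ler_pM// B1.
by rewrite normrM mulrC ler_pM// B2.
Qed.

Lemma segment_ball (p q : V) (r s : R) : `|p| <= r -> `|q| <= r -> 0 < s < 1 ->
  `|s *: (p - q) + q| <= r.
Proof.
move=> pr qr /andP[s0 s1].
have -> : s *: (p - q) + q = s *: p + (1 - s) *: q.
  by rewrite scalerBr scalerBl scale1r -addrA [- _ + _]addrC.
apply: le_trans (ler_normD _ _) _; rewrite !normrZ (ger0_norm (ltW s0)).
rewrite ger0_norm; last by rewrite subr_ge0 ltW.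
have : s * `|p| <= s * r by rewrite ler_wpM2l ?(ltW s0).
have : (1 - s) * `|q| <= (1 - s) * r by rewrite ler_wpM2l// subr_ge0 ltW.
lra.
Qed.

Lemma smooth_lipschitz (f : V -> R) (r : R) : smooth f ->
  exists2 K, 0 <= K & forall p q, `|p| <= r -> `|q| <= r -> `|f p - f q| <= K * `|p - q|.
Proof.
move=> sf; have [K K0 KB] := smooth_derive_bounded r sf.
exists K => // p q pr qr.
have [s s01 ->] := smooth_segment_MVT p q sf.
by apply: KB; exact: segment_ball.
Qed.

(** Supplies the fields of [C11_on_ball] for one coordinate of a vector field. The second order
    bounds come from Lipschitz bounds on the three partial derivatives, and the Taylor remainder
    from the mean value theorem on the segment. *)
Lemma smooth_C11 (f : V -> R) (r : R) : smooth f ->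
  exists2 K, 0 <= K & forall p q, `|p| <= r -> `|q| <= r ->
    [/\ `|f p| <= K, `|f p - f q| <= K * `|p - q|,
        forall u, `|'D_u f p| <= K * `|u|,
        forall u, `|'D_u f p - 'D_u f q| <= K * `|p - q| * `|u| &
        `|f p - f q - 'D_(p - q) f q| <= K * `|p - q| ^+ 2].
Proof.
move=> sf.
have alg (a b c x y z x' y' z' : R) : a * x + b * y + c * z - (a * x' + b * y' + c * z')
    = a * (x - x') + b * (y - y') + c * (z - z') by ring.
have [K0 K00 B0] := continuous_bounded_ball r (smooth_continuous sf).
have [K1 K10 B1] := smooth_lipschitz r sf.
have [K2 K20 B2] := smooth_derive_bounded r sf.
have [L1 L10 C1] := smooth_lipschitz r (smooth_derive e1 sf).
have [L2 L20 C2] := smooth_lipschitz r (smooth_derive e2 sf).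
have [L3 L30 C3] := smooth_lipschitz r (smooth_derive e3 sf).
pose L := L1 + L2 + L3.
have L0 : 0 <= L by rewrite !addr_ge0.
have BL p q u : `|p| <= r -> `|q| <= r ->
    `|'D_u f p - 'D_u f q| <= L * `|p - q| * `|u|.
  move=> pr qr; rewrite !(derive_heisE _ u sf).
  have [u1 u2 u3] := heis_coord_le u.
  rewrite (_ : _ - _ = u.1.1 * ('D_e1 f p - 'D_e1 f q)
    + u.1.2 * ('D_e2 f p - 'D_e2 f q) + u.2 * ('D_e3 f p - 'D_e3 f q)); last exact: alg.
  have t (a : R) (x k : R) : `|a| <= `|u| -> `|x| <= k * `|p - q| ->
      `|a * x| <= k * `|p - q| * `|u|.
    by move=> au xk; rewrite normrM mulrC ler_pM.
  have t1 := t _ _ _ u1 (C1 p q pr qr).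
  have t2 := t _ _ _ u2 (C2 p q pr qr).
  have t3 := t _ _ _ u3 (C3 p q pr qr).
  rewrite /L !mulrDl.
  apply: le_trans (ler_normD _ _) _; rewrite lerD//.
  by apply: le_trans (ler_normD _ _) _; rewrite lerD.
exists (K0 + K1 + K2 + L); first by rewrite !addr_ge0.
move=> p q pr qr.
have pq0 := normr_ge0 (p - q).
split.
- by apply: le_trans (B0 _ pr) _; lra.
- by apply: le_trans (B1 _ _ pr qr) _; rewrite ler_wpM2r//; lra.
- by move=> u; apply: le_trans (B2 _ _ pr) _; rewrite ler_wpM2r//; lra.
- move=> u; apply: le_trans (BL _ _ _ pr qr) _; rewrite ler_wpM2r// ler_wpM2r//; lra.
- have [s s01 ->] := smooth_segment_MVT p q sf.
  apply: le_trans (BL _ _ _ (segment_ball pr qr s01) qr) _.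
  rewrite addrK normrZ expr2 [leRHS]mulrA ler_wpM2r//.
  case/andP: s01 => s0 s1; rewrite ger0_norm ?(ltW s0)//.
  apply: ler_pM => //; [by rewrite mulr_ge0 ?(ltW s0)|lra|].
  by rewrite ler_piMl// ltW.
Qed.

End SmoothBounds.

Section PlaneSmooth.
Context {R : realType}.
Implicit Types (f g : plane R -> R) (v : plane R).

Lemma continuous_fst (V W : normedModType R) : continuous (fst : V * W -> V).
Proof. by move=> p; exact: cvg_fst. Qed.

Lemma continuous_snd (V W : normedModType R) : continuous (snd : V * W -> W).
Proof. by move=> p; exact: cvg_snd. Qed.

Lemma smooth_fst : smooth (fst : plane R -> R).
Proof. exact: (smooth_linear (@continuous_fst _ _)). Qed.

Lemma smooth_snd : smooth (snd : plane R -> R).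
Proof. exact: (smooth_linear (@continuous_snd _ _)). Qed.

Lemma smooth_comp_fst f : smooth f -> smooth (f \o (fst : heis R -> plane R)).
Proof. by move=> sf; exact: (smooth_comp_linear (@continuous_fst _ _) sf). Qed.

Lemma smooth_heis_y : smooth (snd \o fst : heis R -> R).
Proof. exact: (smooth_comp_linear (@continuous_fst _ _) smooth_snd). Qed.

Lemma derive_comp_fst f (u : heis R) p :
  'D_u (f \o (fst : heis R -> plane R)) p = 'D_(u.1) f p.1.
Proof. by []. Qed.

(** Reduces to [smooth_C11] by viewing [f] as a function on the space that ignores the last
    coordinate. *)
Lemma smooth_C11_plane f (r : R) : smooth f ->
  exists2 K, 0 <= K & forall p q, `|p| <= r -> `|q| <= r ->
    [/\ `|f p| <= K, `|f p - f q| <= K * `|p - q|,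
        forall u, `|'D_u f p| <= K * `|u|,
        forall u, `|'D_u f p - 'D_u f q| <= K * `|p - q| * `|u| &
        `|f p - f q - 'D_(p - q) f q| <= K * `|p - q| ^+ 2].
Proof.
move=> sf; have [K K0 KB] := smooth_C11 r (smooth_comp_fst sf).
have n0 (u : plane R) : `|((u, 0) : heis R)| = `|u|.
  by rewrite prod_normE/= normr0; apply/max_idPl.
have B0 (u w : plane R) : ((u, 0) : heis R) - (w, 0) = (u - w, 0).
  by congr (_, _); rewrite /= subrr.
exists K => // p q pr qr.
have [||h1 h2 h3 h4 h5] := KB (p, 0) (q, 0); rewrite ?n0//.
split => //.
- by move: h2; rewrite B0 n0.
- by move=> u; have := h3 (u, 0); rewrite derive_comp_fst n0.
- by move=> u; have := h4 (u, 0); rewrite !derive_comp_fst B0 !n0.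
- by move: h5; rewrite !derive_comp_fst B0 !n0.
Qed.

Lemma smooth_dx f : smooth f -> smooth (dx f).
Proof. exact: smooth_derive. Qed.

Lemma smooth_dz f : smooth f -> smooth (dz f).
Proof. exact: smooth_derive. Qed.

Lemma smooth_nabla f g : smooth f -> smooth g -> smooth (nabla f g).
Proof.
by move=> sf sg; apply: smoothB; [|apply: smoothM]; rewrite //; exact: smooth_derive.
Qed.

Lemma derive_planeE f v (u : plane R) : smooth f ->
  'D_u f v = u.1 * dx f v + u.2 * dz f v.
Proof.
move=> sf.
have uE : u = u.1 *: (1, 0) + u.2 *: (0, 1).
  by case: u => a b /=; congr (_, _);
    rewrite /= /GRing.scale/= ?mulr1 ?mulr0 ?addr0 ?add0r.
by rewrite {1}uE; exact: derive_comb2.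
Qed.

Lemma dxD f g v : smooth f -> smooth g -> dx (fun u => f u + g u) v = dx f v + dx g v.
Proof. by move=> sf sg; apply: deriveD; exact: smooth_derivable. Qed.

Lemma dzD f g v : smooth f -> smooth g -> dz (fun u => f u + g u) v = dz f v + dz g v.
Proof. by move=> sf sg; apply: deriveD; exact: smooth_derivable. Qed.

Lemma dxM f g v : smooth f -> smooth g ->
  dx (fun u => f u * g u) v = f v * dx g v + g v * dx f v.
Proof. by move=> sf sg; rewrite [LHS]deriveM//; exact: smooth_derivable. Qed.

Lemma dzM f g v : smooth f -> smooth g ->
  dz (fun u => f u * g u) v = f v * dz g v + g v * dz f v.
Proof. by move=> sf sg; rewrite [LHS]deriveM//; exact: smooth_derivable. Qed.

(* Both mixed derivatives are approximated by the same second difference quotient. *)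
Lemma dx_dz_comm f v : smooth f -> dx (dz f) v = dz (dx f) v.
Proof.
move=> sf.
pose a : plane R := (1, 0); pose b : plane R := (0, 1).
have key (c d : plane R) (h : R) : 0 < h -> exists2 p : plane R,
    (exists x y, [/\ 0 < x < h, 0 < y < h & p = x *: c + (y *: d + v)]) &
    (f (h *: c + (h *: d + v)) - f (h *: c + v)) - (f (h *: d + v) - f v)
     = h ^+ 2 * 'D_d ('D_c f) p.
  move=> h0.
  pose g (x : R) := f (x *: c + (h *: d + v)) - f (x *: c + v).
  have dg (x : R) : is_derive x 1 g
     ('D_c f (x *: c + (h *: d + v)) - 'D_c f (x *: c + v)).
    by apply: is_deriveB; apply: is_derive_line; exact: smooth_derivable.
  have cg : {within `[0, h], continuous g}.
    apply: continuous_subspaceT => x; apply: differentiable_continuous.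
    by apply/derivable1_diffP; have [] := dg x.
  have [x] := MVT h0 (fun x _ => dg x) cg; rewrite in_itv/= subr0 => xh gE.
  pose k (y : R) := 'D_c f (y *: d + (x *: c + v)).
  have dk (y : R) : is_derive y 1 k ('D_d ('D_c f) (y *: d + (x *: c + v))).
    by apply: is_derive_line; apply: smooth_derivable; exact: smooth_derive.
  have ck : {within `[0, h], continuous k}.
    apply: continuous_subspaceT => y; apply: differentiable_continuous.
    by apply/derivable1_diffP; have [] := dk y.
  have [y] := MVT h0 (fun y _ => dk y) ck; rewrite in_itv/= subr0 => yh kE.
  exists (y *: d + (x *: c + v)); first by exists x, y; split => //; rewrite addrCA.
  have -> : f (h *: c + (h *: d + v)) - f (h *: c + v) - (f (h *: d + v) - f v) = g h - g 0.
    by rewrite /g !scale0r !add0r.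
  rewrite gE; have -> : 'D_c f (x *: c + (h *: d + v)) - 'D_c f (x *: c + v) = k h - k 0.
    by rewrite /k scale0r add0r addrCA.
  by rewrite kE expr2 mulrC mulrA mulrAC mulrC mulrA.
have cab : {for v, continuous ('D_a ('D_b f))}.
  by apply: smooth_continuous; do 2 apply: smooth_derive.
have cba : {for v, continuous ('D_b ('D_a f))}.
  by apply: smooth_continuous; do 2 apply: smooth_derive.
apply/eqP; rewrite -subr_eq0 -normr_le0; apply/ler_addgt0Pr => e e0; rewrite add0r.
have e2 : 0 < e / 2 by rewrite divr_gt0.
have tri (A B C D : R) : D = C -> `|A - C| < e / 2 -> `|B - D| < e / 2 -> `|A - B| <= e.
  move=> ->; rewrite !ltr_norml ler_norml => /andP[? ?] /andP[? ?].
  by apply/andP; split; lra.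
have : \forall w \near v, `|'D_a ('D_b f) v - 'D_a ('D_b f) w| < e / 2.
  by have /cvgr_dist_lt/(_ _ e2) := cab.
move=> /nbhs_ballP[d1 /= d10 H1].
have : \forall w \near v, `|'D_b ('D_a f) v - 'D_b ('D_a f) w| < e / 2.
  by have /cvgr_dist_lt/(_ _ e2) := cba.
move=> /nbhs_ballP[d2 /= d20 H2].
pose h := Num.min d1 d2 / 2.
have m0 : 0 < Num.min d1 d2 by rewrite lt_min d10.
have h0 : 0 < h by rewrite divr_gt0.
have near (x y : R) : 0 < x < h -> 0 < y < h -> `|((x, y) : plane R) | < Num.min d1 d2.
  move=> /andP[x0 xh] /andP[y0 yh]; rewrite prod_normE/= gt_max !gtr0_norm//.
  by apply/andP; split; rewrite /h in xh yh; lra.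
have [p [x [y [xh yh pE]]] E1] := key a b h h0.
have [q [x' [y' [xh' yh' qE]]] E2] := key b a h h0.
have pE' : p = (x, y) + v.
  rewrite pE addrA; congr (_ + _); congr (_, _);
    by rewrite /= /GRing.scale/= ?mulr1 ?mulr0 ?addr0 ?add0r.
have qE' : q = (y', x') + v.
  rewrite qE addrA; congr (_ + _); congr (_, _);
    by rewrite /= /GRing.scale/= ?mulr1 ?mulr0 ?addr0 ?add0r.
have pq : 'D_b ('D_a f) p = 'D_a ('D_b f) q.
  have h20 : h ^+ 2 != 0 by rewrite expf_neq0// gt_eqF.
  have alg (x1 x2 x3 x4 : R) : x1 - x2 - (x3 - x4) = x1 - x3 - (x2 - x4) by ring.
  have swap : h *: b + (h *: a + v) = h *: a + (h *: b + v) by exact: addrCA.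
  rewrite swap in E2.
  exact: (mulfI h20 (etrans (esym E1) (etrans (alg _ _ _ _) E2))).
have bq : `|'D_a ('D_b f) v - 'D_a ('D_b f) q| < e / 2.
  apply: H1; rewrite -ball_normE/= qE' distrC addrK.
  by apply: lt_le_trans (near _ _ yh' xh') _; rewrite ge_min lexx.
have bp : `|'D_b ('D_a f) v - 'D_b ('D_a f) p| < e / 2.
  apply: H2; rewrite -ball_normE/= pE' distrC addrK.
  by apply: lt_le_trans (near _ _ xh yh) _; rewrite ge_min lexx orbT.
rewrite /dx /dz -/a -/b.
exact: (tri _ _ _ _ pq bq bp).
Qed.

End PlaneSmooth.

(** * Planar Lebesgue measure of images *)

Section PlaneMeasurable.
Context {R : realType}.
Local Notation mplane := (plane (measurableTypeR R)).

(** An open set is the countable union of the squares with rational center and radius that it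
    contains; [B] is empty for the other indices. *)
Lemma open_measurable_plane (A : set (plane R)) :
  open A -> measurable (A : set mplane).
Proof.
move=> oA.
pose B (q : rat) (q' : rat) (r : rat) : set mplane :=
  if `[< ball (ratr q : R) (ratr r) `*` ball (ratr q' : R) (ratr r) `<=` A >]
  then ball (ratr q : R) (ratr r) `*` ball (ratr q' : R) (ratr r) else set0.
suff -> : A = \bigcup_q \bigcup_q' \bigcup_r B q q' r.
  apply: bigcupT_measurable_rat => q; apply: bigcupT_measurable_rat => q'.
  apply: bigcupT_measurable_rat => r; rewrite /B; case: ifPn => // _.
  by apply: measurableX; apply: open_measurable; exact: ball_open.
apply/seteqP; split => [[x z] Axz|[x z] [q _ [q' _ [r _]]]]; last first.
  by rewrite /B; case: ifPn => // /asboolP; apply.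
have /nbhs_ballP[e /= e0 eA] := oA _ Axz.
have e2 : 0 < e / 2 :> R by rewrite divr_gt0.
have [r /= ] := @rat_in_itvoo _ 0 (e / 2) e2; rewrite in_itv/= => /andP[r0 re].
have [q] := @rat_in_itvoo R (x - ratr r) (x + ratr r) (ltac:(lra)).
rewrite in_itv/= => /andP[xq qx].
have [q'] := @rat_in_itvoo R (z - ratr r) (z + ratr r) (ltac:(lra)).
rewrite in_itv/= => /andP[zq qz].
exists q => //; exists q' => //; exists r => //.
rewrite /B; case: ifPn => [_|/asboolP[]].
  by split; rewrite /= -ball_normE/= ltr_norml; apply/andP; split; lra.
move=> [y w] [/=]; rewrite -!ball_normE/= !ltr_norml => /andP[h1 h2] /andP[h3 h4].
apply: eA; split; rewrite -ball_normE/= ltr_norml; apply/andP; split; lra.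
Qed.

Lemma continuous_on_measurable_plane (A : set (plane R)) (f : plane R -> R) :
  open A -> (forall x, A x -> {for x, continuous f}) ->
  measurable_fun (A : set mplane) (f : mplane -> measurableTypeR R).
Proof.
move=> oA cf mA; apply: (measurability _ (RGenOpens.measurableE R)) => //.
move=> _ [_ [a [b ->] <-]]; apply: open_measurable_plane.
rewrite openE => x [Ax fx]; rewrite /interior.
apply: filterI; first exact: oA.
by apply: cf => //; apply: interval_open.
Qed.

Lemma continuous_measurable_plane (A : set (plane R)) (f : plane R -> R) :
  open A -> continuous f ->
  measurable_fun (A : set mplane) (f : mplane -> measurableTypeR R).
Proof. by move=> oA cf; apply: continuous_on_measurable_plane => // x _; exact: cf. Qed.

End PlaneMeasurable.

Section PlaneMeasure.
Context {R : realType}.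
Local Notation mR := (measurableTypeR R).
Local Notation mplane := (plane (measurableTypeR R)).
Local Notation lam := (@lebesgue_measure R).

(** Slicing in the order opposite to the definition of the product: the two iterated measures agree
    on rectangles, hence everywhere. *)
Lemma mu_planeE (A : set mplane) : measurable A ->
  mu_plane A = (\int[lam]_z lam [set x : R | A (x, z)])%E.
Proof.
move=> mA.
have -> : mu_plane A = (lam \x^ lam)%E A.
  apply: product_measure_unique => // B C mB mC.
  exact: product_measure2E.
rewrite /product_measure2; apply: eq_integral => z _ /=; congr (lam _).
by apply/seteqP; split => x; rewrite /ysection/= inE.
Qed.

Lemma mu_planeE' (A : set mplane) :
  mu_plane A = (\int[lam]_x lam [set z : R | A (x, z)])%E.
Proof.
rewrite /mu_plane/= /product_measure1; apply: eq_integral => x _ /=; congr (lam _).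
by apply/seteqP; split => z; rewrite /xsection/= inE.
Qed.

Lemma mu_plane_box (a b c d : R) : a <= b -> c <= d ->
  mu_plane (`[a, b] `*` `[c, d]) = ((b - a) * (d - c))%:E.
Proof.
move=> ab cd.
have -> : mu_plane (`[a, b] `*` `[c, d]) = (lam `[a, b]%classic * lam `[c, d]%classic)%E.
  exact: product_measure1E.
have lam_itv (x y : R) : x <= y -> lam `[x, y]%classic = (y - x)%:E.
  by move=> xy; rewrite lebesgue_measure_itv/= lte_fin; case: ltgtP xy => // ->; rewrite subrr.
by rewrite !lam_itv.
Qed.

Lemma lebesgue_measure_shift (A : set mR) (s : R) : measurable A ->
  lam [set x : R | A (x - s)] = lam A.
Proof.
move=> mA; pose g (x : mR) : mR := x - s.
have mg : measurable_fun [set: mR] g by exact: measurable_funB.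
pose gM := isMeasurableFun.Build _ _ _ _ g mg.
pose gm : {mfun mR >-> mR} := HB.pack g gM.
have -> : lam [set x : R | A (x - s)] = pushforward lam gm A by [].
apply/esym/lebesgue_measure_unique => //= _ [[a b]] _ <-.
rewrite /pushforward/= (_ : _ @^-1` _ = `]a + s, b + s]%classic); last first.
  apply/seteqP; split => x; rewrite /g/= !in_itv/=; lra.
rewrite lebesgue_measure_itv/= lebesgue_measure_itv/= !lte_fin ltrD2r.
by case: ifPn => // _; rewrite -!EFinB; congr EFin; ring.
Qed.

Lemma measurable_strip (k l r e : R) :
  measurable ([set w : plane R | `|k * w.1 + l * w.2 - r| <= e] : set mplane).
Proof.
have cf : continuous (fun w : plane R => `|k * w.1 + l * w.2 - r|).
  move=> w; apply: cvg_norm; apply: cvgB; last exact: cvg_cst.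
  by apply: cvgD; apply: cvgM; (exact: cvg_cst || exact: cvg_fst || exact: cvg_snd).
have := @continuous_measurable_plane R setT _ openT cf measurableT `]-oo, e]%classic.
by move=> /(_ (measurable_itv _)); rewrite setTI; congr (measurable _).
Qed.

(* Shearing in the first variable turns the set into a rectangle times an interval. *)
Lemma mu_plane_parallelogram (a b c d p q : R) : 0 <= a -> 0 <= b -> p * q < 1 ->
  mu_plane [set w : plane R | `|w.1 - p * w.2 - c| <= a /\ `|w.2 - q * w.1 - d| <= b]
   = (4 * a * b / (1 - p * q))%:E.
Proof.
move=> a0 b0 pq; set S := [set w | _].
have k0 : 0 < 1 - p * q by rewrite subr_gt0.
have lam_itv (x y : R) : x <= y -> lam `[x, y]%classic = (y - x)%:E.
  by move=> xy; rewrite lebesgue_measure_itv/= lte_fin; case: ltgtP xy => // ->; rewrite subrr.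
pose T := [set w : plane R | `|(1 - p * q) * w.1 - p * w.2 - c| <= a /\ `|w.2 - d| <= b].
have mT : measurable (T : set mplane).
  rewrite (_ : T = [set w | `|(1 - p * q) * w.1 + (- p) * w.2 - c| <= a] `&`
    [set w | `|0 * w.1 + 1 * w.2 - d| <= b]); first by apply: measurableI; exact: measurable_strip.
  by apply/seteqP; split => w /=; rewrite mul0r add0r mul1r mulNr.
transitivity (mu_plane T).
  rewrite !mu_planeE'; apply: eq_integral => x _.
  have mTx : measurable ([set z | T (x, z)] : set mR).
    have := measurable_xsection x mT; congr (measurable _).
    by apply/seteqP; split => z; rewrite /xsection/= inE.
  rewrite -(lebesgue_measure_shift (q * x) mTx).
  congr (lam _); apply/seteqP; split => z /=; rewrite /S/T/= => -[h1 h2]; split => //.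
  - by move: h1; congr (_ <= _); congr `|_|; ring.
  - by move: h1; congr (_ <= _); congr `|_|; ring.
rewrite mu_planeE//.
transitivity (\int[lam]_(z in `[(d - b)%R, (d + b)%R]) (2 * a / (1 - p * q))%:E)%E; last first.
  transitivity ((2 * a / (1 - p * q))%:E * lam `[(d - b)%R, (d + b)%R]%classic)%E.
    by rewrite integral_cst.
  rewrite lam_itv; last by lra.
  rewrite -EFinM.
  by congr EFin; field; rewrite gt_eqF.
rewrite [RHS]integral_mkcond; apply: eq_integral => z _; rewrite patchE.
case: ifPn => [|/negP]; rewrite inE/= in_itv/= => zd.
  rewrite (_ : [set x | _] = `[(p * z + c - a) / (1 - p * q), (p * z + c + a) / (1 - p * q)]%classic).
    rewrite lam_itv; last by rewrite ler_pM2r ?invr_gt0//; lra.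
    by congr EFin; field; rewrite gt_eqF.
  apply/seteqP; split => x; rewrite /T/= in_itv/= ler_pdivrMr// ler_pdivlMr// ler_norml.
    by move=> [/andP[h1 h2] _]; apply/andP; split; lra.
  move=> /andP[h1 h2]; split; first by apply/andP; split; lra.
  by rewrite ler_norml; move: zd => /andP[]; lra.
rewrite (_ : [set x | _] = set0) ?measure0//; apply/seteqP; split => x //.
by rewrite /T/= => -[_]; rewrite ler_norml => /andP[h1 h2]; apply: zd; apply/andP; split; lra.
Qed.

End PlaneMeasure.

(** * Change of variables as an inequality *)

Section ChangeOfVariables.
Context {R : realType}.
Local Notation mR := (measurableTypeR R).
Local Notation mplane := (plane (measurableTypeR R)).
Local Open Scope ereal_scope.

(** No measurability is required: the integral of a nonnegative function is a supremum over the
    simple functions below it. This is how the energy density of [f_t] can be handled. *)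
Lemma le_integral_nonneg (mu : {measure set mplane -> \bar R}) (D : set mplane) (f g : mplane -> \bar R) :
  (forall x, D x -> 0 <= f x) -> (forall x, D x -> f x <= g x) ->
  \int[mu]_(x in D) f x <= \int[mu]_(x in D) g x.
Proof.
move=> f0 fg; rewrite !ge0_integralE//; last first.
  by move=> x Dx; exact: le_trans (f0 _ Dx) (fg _ Dx).
apply: ereal_sup_le => _ [h /= hf <-]; exists h => //= x.
apply: le_trans (hf x) _; rewrite !patchE; case: ifPn => // xD.
by apply: fg; rewrite inE in xD.
Qed.

(** An alias that carries the sigma-finite structure needed for Tonelli's theorem. *)
Definition planar_measure : set mplane -> \bar R := mu_plane.

HB.instance Definition _ := Measure.on planar_measure.

Lemma planar_measure_sigma_finite : sigma_finite setT planar_measure.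
Proof.
exists (fun n => `[- n%:R, n%:R] `*` `[- n%:R, n%:R])%R.
  apply/seteqP; split => // -[x z] _.
  pose n := (Num.truncn (`|x| + `|z|)).+1.
  have : (`|x| + `|z| < n%:R)%R by exact: truncnS_gt.
  have := normr_ge0 x; have := normr_ge0 z => z0 x0 xzn.
  exists n => //; split; rewrite /= in_itv/= -ler_norml; lra.
move=> n; split; first exact: measurableX.
have n0 : (- n%:R <= n%:R :> R)%R by rewrite ge0_cp.
by rewrite /planar_measure mu_plane_box// ltry.
Qed.

HB.instance Definition _ := Measure_isSigmaFinite.Build _ _ _ planar_measure
  planar_measure_sigma_finite.

Lemma measurable_pair_dist (e : R) :
  measurable [set w : mplane * mplane | `|w.1.1 - w.2.1| < e /\ `|w.1.2 - w.2.2| < e]%R.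
Proof.
have m (f : mplane -> mR) : measurable_fun setT f ->
    measurable [set w : mplane * mplane | `|f w.1 - f w.2| < e]%R.
  move=> mf.
  have mg : measurable_fun setT (fun w : mplane * mplane => `|f w.1 - f w.2|%R : mR).
    apply: measurableT_comp => //; apply: measurable_funB.
      by apply: measurableT_comp mf _; exact: measurable_fst.
    by apply: measurableT_comp mf _; exact: measurable_snd.
  have := mg measurableT `]-oo, e[%classic (measurable_itv _).
  by rewrite setTI; congr (measurable _).
by apply: measurableI; apply: m; [exact: measurable_fst|exact: measurable_snd].
Qed.

Definition square (v : plane R) (r : R) : set (plane R) :=
  [set u | `|u.1 - v.1| < r /\ `|u.2 - v.2| < r]%R.

Lemma squareP (v : plane R) (r : R) u : square v r u <-> (`|u - v| < r)%R.
Proof.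
rewrite /square prod_normE/= gt_max; split; first by move=> [-> ->].
by move=> /andP[].
Qed.

Lemma squareC (v : plane R) (r : R) u : square v r u <-> square u r v.
Proof. by rewrite /square/= ![`|v.1 - _|%R]distrC ![`|v.2 - _|%R]distrC. Qed.

Lemma mu_plane_square (v : plane R) (r : R) : (0 < r)%R ->
  mu_plane (square v r) = ((2 * r) ^+ 2)%:E.
Proof.
move=> r0.
have -> : square v r = `](v.1 - r)%R, (v.1 + r)%R[ `*` `](v.2 - r)%R, (v.2 + r)%R[.
  apply/seteqP; split => u; rewrite /square/= !in_itv/= !ltr_norml.
    by move=> [/andP[? ?] /andP[? ?]]; split; apply/andP; split; lra.
  by move=> [/andP[? ?] /andP[? ?]]; split; apply/andP; split; lra.
transitivity ((@lebesgue_measure R) `](v.1 - r)%R, (v.1 + r)%R[%classic *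
   (@lebesgue_measure R) `](v.2 - r)%R, (v.2 + r)%R[%classic).
  exact: product_measure1E.
have lam_itv (x : R) : (@lebesgue_measure R) `](x - r)%R, (x + r)%R[%classic = (2 * r)%:E.
  rewrite lebesgue_measure_itv/= lte_fin ifT; last by lra.
  by rewrite -EFinB; congr EFin; ring.
by rewrite !lam_itv -EFinM.
Qed.

Lemma measurable_square (v : plane R) (r : R) : measurable (square v r : set mplane).
Proof.
have := measurable_ysection v (measurable_pair_dist r).
by congr (measurable _); apply/seteqP; split => u; rewrite /ysection/= inE.
Qed.

(** The centers around which averaging at scale [r] does not leave [A], where alone [k] and [rho]
    are controlled. *)
Definition inner_part (A : set (plane R)) (r : R) : set (plane R) :=
  [set u | square u r `<=` A].

Lemma measurable_inner_part (A : set (plane R)) (r : R) :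
  measurable (inner_part A r : set mplane).
Proof.
rewrite -[X in measurable X]setCK; apply: measurableC; apply: open_measurable_plane.
rewrite openE => u /existsNP[v /not_implyP[/squareP uv Av]].
rewrite /interior; near=> w; apply/existsNP; exists v; apply/not_implyP; split => //.
apply/squareP.
have : (`|u - w| < r - `|v - u|)%R.
  suff : ball u (r - `|v - u|)%R w by rewrite -ball_normE.
  by near: w; apply: nbhsx_ballx; rewrite subr_gt0.
have : (`|v - w| <= `|v - u| + `|u - w|)%R by rewrite -(subrKA u) ler_normD.
lra.
Unshelve. all: by end_near. Qed.

Section Mollification.
Variable mu : {sigma_finite_measure set mplane -> \bar R}.
Hypothesis mu_square : forall v r, (0 < r)%R -> mu (square v r) = ((2 * r) ^+ 2)%:E.
Variables (A O : set (plane R)) (theta : plane R -> plane R) (k rho : plane R -> R).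
Variables (B B' L C r0 : R).
Hypothesis oA : open A.
Hypothesis muA : mu A < +oo.
Hypothesis mO : measurable (O : set mplane).
Hypothesis mtheta : measurable_fun (setT : set mplane) (theta : mplane -> mplane).
Hypothesis OA : forall w, O w -> A (theta w).
Hypothesis mk : measurable_fun (A : set mplane) (k : mplane -> mR).
Hypothesis mrho : measurable_fun (A : set mplane) (rho : mplane -> mR).
Hypothesis kB : forall v, A v -> (0 <= k v <= B)%R.
Hypothesis rhoB : forall v, A v -> (0 <= rho v <= B')%R.
Hypothesis L0 : (0 <= L)%R.
Hypothesis C0 : (0 <= C)%R.
Hypothesis r00 : (0 < r0)%R.
Hypothesis klip : forall u v, A u -> A v -> (`|k u - k v| <= L * `|u - v|)%R.
Hypothesis local_bound : forall v r, A v -> (0 < r <= r0)%R ->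
  mu [set w | O w /\ square v r (theta w)] <= ((rho v + C * r) * (2 * r) ^+ 2)%:E.

Let mA : measurable (A : set mplane). Proof. exact: open_measurable_plane. Qed.

Let mkt : measurable_fun (O : set mplane) (fun w : mplane => k (theta w) : mR).
Proof.
apply: (@measurable_comp _ _ _ _ _ _ (A : set mplane)) => //.
- by move=> _ [w Ow <-]; exact: OA.
- exact: measurable_funTS.
Qed.

Let On (r : R) := O `&` theta @^-1` inner_part A r.

Let mOn r : measurable (On r : set mplane).
Proof.
apply: measurableI => //; rewrite -[X in measurable X]setTI; apply: mtheta => //.
exact: measurable_inner_part.
Qed.

(** [L] and [C] appear only multiplied by [r], so they leave no trace once [r] tends to 0. *)
Lemma mollified_inner_bound (r : R) : (0 < r <= r0)%R ->
  \int[mu]_(w in On r) (k (theta w))%:E <=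
  \int[mu]_(v in A) ((k v + L * r) * (rho v + C * r))%:E.
Proof.
move=> /andP[rp rr0].
pose K : mplane -> R := (fun w => k (theta w)) \_ (On r).
have K0 w : (0 <= K w)%R.
  rewrite /K patchE; case: ifPn => // /[!inE] -[Ow _].
  by have /andP[] := kB (OA Ow).
have mK : measurable_fun setT (K : mplane -> mR).
  apply/(measurable_restrictT _ (mOn r)).
  by apply: measurable_funS mkt => // w [].
pose D : set (mplane * mplane) := [set p | square p.2 r (theta p.1)].
have mD : measurable D.
  have mf : measurable_fun setT (fun p : mplane * mplane => (theta p.1, p.2) : mplane * mplane).
    apply/measurable_fun_pairP; split => /=; last exact: measurable_snd.
    by apply: measurableT_comp mtheta _; exact: measurable_fst.
  have := mf measurableT _ (measurable_pair_dist r).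
  by rewrite setTI; congr (measurable _); apply/seteqP; split.
pose H (p : mplane * mplane) : \bar R := (K p.1 * \1_D p)%:E.
have mH : measurable_fun setT H.
  apply/measurable_EFinP; apply: measurable_funM; last exact: measurable_indic.
  by apply: measurableT_comp mK _; exact: measurable_fst.
have H0 p : 0 <= H p by rewrite lee_fin mulr_ge0.
have r2 : (0 < (2 * r) ^+ 2)%R by rewrite exprn_gt0// mulr_gt0.
(* Integrating in [v] first gives the area of a full square for every [w]; integrating in [w] first
   gives the measure of the preimage of a square, which is what [local_bound] controls. *)
have E1 : \int[mu]_w \int[mu]_v H (w, v) =
    ((2 * r) ^+ 2)%:E * \int[mu]_(w in On r) (k (theta w))%:E.
  rewrite [X in _ = _ * X]integral_mkcond.
  have -> : (fun w => (k (theta w))%:E) \_ (On r) = EFin \o K.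
    by apply/funext => w; rewrite /K /= !patchE; case: ifPn.
  rewrite -ge0_integralZl//; last 3 first.
  - exact/measurable_EFinP.
  - by move=> w _; rewrite lee_fin.
  - by rewrite lee_fin ltW.
  apply: eq_integral => w _.
  transitivity (\int[mu]_v ((K w)%:E * (\1_(square (theta w) r : set mplane) v)%:E)).
    apply: eq_integral => v _; rewrite /H -EFinM !indicE; congr (_ * _%:R)%:E.
    by congr nat_of_bool; apply: asbool_equiv_eq; apply: iff_sym; exact: squareC.
  rewrite ge0_integralZl//; last first.
  - by rewrite lee_fin.
  - apply/measurable_EFinP; apply: measurable_indic; exact: measurable_square.
  rewrite integral_indic//; last exact: measurable_square.
  by rewrite setIT muleC; congr (_ * _); exact: mu_square.
have mS v : measurable ([set w | O w /\ square v r (theta w)] : set mplane).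
  apply: measurableI => //.
  have := @mtheta measurableT _ (@measurable_square v r).
  by rewrite setTI.
have kL v : A v -> (0 <= k v + L * r)%R.
  by move=> /kB/andP[kv _]; rewrite addr_ge0// mulr_ge0// ltW.
have rC v : A v -> (0 <= rho v + C * r)%R.
  by move=> /rhoB/andP[rv _]; rewrite addr_ge0// mulr_ge0// ltW.
have E2 : \int[mu]_v \int[mu]_w H (w, v) <=
    ((2 * r) ^+ 2)%:E * \int[mu]_(v in A) ((k v + L * r) * (rho v + C * r))%:E.
  rewrite -ge0_integralZl//; last 3 first.
  - apply/measurable_EFinP; apply: measurable_funM; apply: measurable_funD => //.
  - by move=> v Av; rewrite lee_fin mulr_ge0// ?kL// rC.
  - by rewrite lee_fin ltW.
  rewrite [leRHS]integral_mkcond; apply: (le_integral_nonneg mu) => v _.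
    by apply: integral_ge0.
  rewrite patchE; case: ifPn => [/[!inE] Av|/negP Av].
    apply: (@le_trans _ _ (\int[mu]_w ((k v + L * r)%:E *
      (\1_([set w | O w /\ square v r (theta w)] : set mplane) w)%:E))).
      apply: (le_integral_nonneg mu) => // w _; rewrite /H -EFinM lee_fin.
      rewrite /K patchE; case: ifPn => [/[!inE] -[Ow Iw]|_]; last first.
        by rewrite mul0r mulr_ge0 ?kL.
      rewrite !indicE; have [Dw|Dw] := boolP ((w, v) \in D); last first.
        by rewrite mulr0 mulr_ge0 ?kL.
      rewrite inE in Dw; rewrite mem_set//= !mulr1.
      have := klip (OA Ow) Av; rewrite ler_norml => /andP[_].
      rewrite lerBlDl => /le_trans; apply; rewrite lerD2l ler_wpM2l// ltW//.
      exact/squareP.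
    rewrite ge0_integralZl//; last 2 first.
    - by apply/measurable_EFinP; apply: measurable_indic.
    - by rewrite lee_fin kL.
    rewrite integral_indic// setIT.
    rewrite [leRHS](_ : _ = (k v + L * r)%:E * ((rho v + C * r) * (2 * r) ^+ 2)%:E); last first.
      by rewrite -!EFinM; congr EFin; ring.
    by apply: lee_wpmul2l; [rewrite lee_fin kL|apply: local_bound => //; rewrite rp].
  (* For [v] outside [A] the inner integral vanishes, because the square around a point of the inner
     part stays in [A]. *)
  rewrite integral0_eq// => w _; rewrite /H /K patchE /=.
  case: ifPn => [/[!inE] -[Ow Iw]|_]; last by rewrite mul0r.
  rewrite indicE memNset ?mulr0// => Dw; apply: Av; rewrite inE; apply: Iw.
  exact/squareC.
have := E2; rewrite -(fubini_tonelli H mH H0) E1.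
by rewrite lee_pmul2l.
Qed.

(* Mollify with the normalized indicator of a square of side [2 r] and exchange the
   order of integration; the local bound controls the inner integral. Only an upper
   bound is available, the reverse one follows by exchanging the roles of theta and
   its inverse. *)
Lemma integral_image_le :
  \int[mu]_(w in O) (k (theta w))%:E <= \int[mu]_(v in A) (k v * rho v)%:E.
Proof.
have mkrho : measurable_fun (A : set mplane) (fun v : mplane => k v * rho v : mR)%R.
  exact: measurable_funM.
have B0 v : A v -> (0 <= B)%R by move=> /kB/andP[]; exact: le_trans.
have B'0 v : A v -> (0 <= B')%R by move=> /rhoB/andP[]; exact: le_trans.
have krho0 v : A v -> 0 <= (k v * rho v)%:E.
  by move=> Av; rewrite lee_fin mulr_ge0//; [case/andP: (kB Av)|case/andP: (rhoB Av)].
have inner (r : R) : (0 < r <= r0)%R -> \int[mu]_(w in On r) (k (theta w))%:E <=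
    \int[mu]_(v in A) (k v * rho v)%:E.
  move=> /andP[rp rr0].
  pose M := (`|B| * C + L * `|B'| + L * C * r0)%R.
  have M0 : (0 <= M)%R by rewrite !addr_ge0// !mulr_ge0// ltW.
  have muA0 : (0 <= fine (mu A))%R by rewrite fine_ge0.
  have muAE : mu A = (fine (mu A))%:E by rewrite fineK// ge0_fin_numE.
  (* The domain stays frozen at scale [r] while the averaging scale [s] tends to 0. [M] collects the
     cross terms of (k + L s) (rho + C s), and finiteness of [mu A] makes their integral of order
     [s]. *)
  have small (s : R) : (0 < s <= r)%R -> \int[mu]_(w in On r) (k (theta w))%:E <=
    \int[mu]_(v in A) (k v * rho v)%:E + (s * M * fine (mu A))%:E.
    move=> /andP[s0 sr].
    have Ors : On r `<=` On s.
      move=> w [Ow Iw]; split => // v /squareP vw; apply: Iw; apply/squareP.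
      exact: lt_le_trans vw sr.
    apply: (@le_trans _ _ (\int[mu]_(w in On s) (k (theta w))%:E)).
      apply: ge0_subset_integral => //.
        by apply/measurable_EFinP; apply: measurable_funS mkt => // w [].
      by move=> w [Ow _]; rewrite lee_fin; case/andP: (kB (OA Ow)).
    apply: le_trans (mollified_inner_bound _) _; first by rewrite s0 (le_trans sr).
    rewrite EFinM -muAE -integral_cst//.
    rewrite -ge0_integralD//; last 2 first.
    - exact/measurable_EFinP.
    - by move=> v _; rewrite lee_fin mulr_ge0// ltW.
    apply: (le_integral_nonneg mu) => v Av.
      rewrite lee_fin mulr_ge0// addr_ge0// ?mulr_ge0//; try exact: ltW.
      + by case/andP: (kB Av).
      + by case/andP: (rhoB Av).
    rewrite -EFinD lee_fin.
    have /andP[k0 kb] := kB Av; have /andP[h0 hb] := rhoB Av.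
    have : (k v * (C * s) <= `|B| * C * s)%R.
      rewrite mulrA ler_wpM2r ?(ltW s0)// ler_wpM2r//.
      by rewrite (le_trans kb)// ler_norm.
    have : (L * s * rho v <= L * `|B'| * s)%R.
      rewrite mulrAC ler_wpM2r ?(ltW s0)// ler_wpM2l//.
      by rewrite (le_trans hb)// ler_norm.
    have : (L * s * (C * s) <= L * C * r0 * s)%R.
      rewrite [leLHS](_ : _ = L * C * s * s)%R; last by ring.
      by rewrite ler_wpM2r ?(ltW s0)// ler_wpM2l ?mulr_ge0// (le_trans sr).
    rewrite /M; lra.
  apply/lee_addgt0Pr => e e0.
  pose s := Num.min r (e / (M * fine (mu A) + 1))%R.
  have d0 : (0 < M * fine (mu A) + 1)%R by rewrite ltr_wpDl// mulr_ge0.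
  have s0 : (0 < s)%R by rewrite lt_min rp divr_gt0.
  apply: le_trans (small s _) _; first by rewrite s0 ge_min lexx.
  rewrite leeD2l// lee_fin -mulrA.
  have : (s <= e / (M * fine (mu A) + 1))%R by rewrite ge_min lexx orbT.
  rewrite ler_pdivlMr// => /(le_trans _); apply.
  by rewrite ler_wpM2l ?(ltW s0)// lerDl.
(* As [A] is open, the inner parts exhaust it, and monotone convergence removes the restriction to
   them. *)
pose F n := On (r0 / n.+1%:R).
have rn n : (0 < r0 / n.+1%:R <= r0)%R.
  by rewrite divr_gt0//= ler_pdivrMr// ler_peMr ?(ltW r00)// ler1n.
have FO : O = \bigcup_n F n.
  apply/seteqP; split => [w Ow|w [n _ []]//].
  have /nbhs_ballP[e /= e0 eA] := oA (OA Ow).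
  have [n ne] : exists n, (r0 / n.+1%:R < e)%R.
    exists (Num.truncn (r0 / e)).
    by rewrite ltr_pdivrMr// mulrC -ltr_pdivrMr// truncnS_gt.
  exists n => //; split => // v /squareP vw; apply: eA.
  by rewrite -ball_normE/= distrC (lt_trans vw).
rewrite FO.
have cvF : (\int[mu]_(w in F i) (k (theta w))%:E) @[i --> \oo] -->
    \int[mu]_(w in \bigcup_i F i) (k (theta w))%:E.
  apply: ge0_nondecreasing_set_cvg_integral.
  - apply/nondecreasing_seqP => n; apply/subsetPset => w [Ow Iw]; split => //.
    move=> v /squareP vw; apply: Iw; apply/squareP; apply: lt_le_trans vw _.
    by rewrite ler_wpM2l ?(ltW r00)// lef_pV2 ?posrE// ler_nat.
  - by move=> n; exact: mOn.
  - by move=> n; apply/measurable_EFinP; apply: measurable_funS mkt => // w [].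
  - by move=> n w [Ow _]; rewrite lee_fin; case/andP: (kB (OA Ow)).
rewrite -(cvg_lim _ cvF)//; apply: lime_le; first by apply/cvg_ex; eexists; exact: cvF.
by apply: nearW => n; exact: inner.
Qed.

End Mollification.

Lemma integral_image_le_mu_plane (A O : set (plane R)) (theta : plane R -> plane R)
    (k rho : plane R -> R) (B B' L C r0 : R) :
  open A -> mu_plane A < +oo -> measurable (O : set mplane) ->
  measurable_fun (setT : set mplane) (theta : mplane -> mplane) ->
  (forall w, O w -> A (theta w)) ->
  measurable_fun (A : set mplane) (k : mplane -> mR) ->
  measurable_fun (A : set mplane) (rho : mplane -> mR) ->
  (forall v, A v -> (0 <= k v <= B)%R) -> (forall v, A v -> (0 <= rho v <= B')%R) ->
  (0 <= L)%R -> (0 <= C)%R -> (0 < r0)%R ->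
  (forall u v, A u -> A v -> (`|k u - k v| <= L * `|u - v|)%R) ->
  (forall v r, A v -> (0 < r <= r0)%R ->
    mu_plane [set w | O w /\ square v r (theta w)] <= ((rho v + C * r) * (2 * r) ^+ 2)%:E) ->
  \int[mu_plane]_(w in O) (k (theta w))%:E <= \int[mu_plane]_(v in A) (k v * rho v)%:E.
Proof.
move=> oA muA mO mtheta OA mk mrho kB rhoB L0 C0 r00 klip loc.
apply: (@integral_image_le planar_measure mu_plane_square A O theta k rho B B' L C r0) => //.
Qed.

End ChangeOfVariables.

(** * The contact flow in adapted coordinates *)

Section AdaptedCoordinates.
Context {R : realType}.
Implicit Types (p : heis R) (v : plane R).

Lemma is_derive_scalel (V : normedModType R) (x : V) (s : R) :
  is_derive s 1 (fun r : R => r *: x) x.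
Proof.
rewrite -[X in is_derive _ _ _ X]scale1r.
by apply: DeriveDef; [exact: diff_derivable|rewrite deriveE// diff_val].
Qed.

Definition graph_point v (y : R) : heis R := heis_mul (of_plane v) (powY y).

Lemma graph_pointE v y : graph_point v y = (v.1, y, v.2 + v.1 * y / 2).
Proof.
by rewrite /graph_point /heis_mul/=; congr (_, _, _); rewrite ?addr0 ?add0r ?mul0r ?subr0.
Qed.

Lemma heis_proj_graph_point v y : heis_proj (graph_point v y) = v.
Proof. by rewrite graph_pointE /heis_proj/= addrK; case: v. Qed.

Lemma graph_point_proj p : graph_point (heis_proj p) p.1.2 = p.
Proof. by rewrite graph_pointE /heis_proj/= subrK; case: p => -[]. Qed.

Lemma graph_point0 v : graph_point v 0 = of_plane v.
Proof. by rewrite graph_pointE mulr0 mul0r addr0. Qed.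

Lemma of_plane_linear : linear (@of_plane R).
Proof.
move=> a u v; rewrite /of_plane; congr (_, _, _).
by rewrite /= addr0 /GRing.scale/= mulr0.
Qed.

HB.instance Definition _ :=
  GRing.isLinear.Build R (plane R) (heis R) _ (@of_plane R) of_plane_linear.

Lemma continuous_of_plane : continuous (@of_plane R).
Proof.
move=> v; apply: differentiable_continuous.
have d1 : differentiable (fun v : plane R => (v.1, 0 : R)) v.
  exact: (differentiable_pair (@ex_diff _ _ _ _ _ _ _ (is_diff_fst v)) (differentiable_cst 0 v)).
exact: (differentiable_pair d1 (@ex_diff _ _ _ _ _ _ _ (is_diff_snd v))).
Qed.

Lemma smooth_heis_x : smooth (fst \o fst : heis R -> R).
Proof. exact: (smooth_comp_linear (@continuous_fst _ _ _) (@smooth_fst R)). Qed.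

Section Potential.
Variable psi : heis R -> R.
Hypothesis spsi : smooth psi.
Hypothesis YYpsi : forall p, vf_act fieldY (vf_act fieldY psi) p = 0.

Definition psi0 v : R := psi (of_plane v).
Definition Ypsi0 v : R := vf_act fieldY psi (of_plane v).

Lemma planeW_psi0 v : planeW psi v = (Ypsi0 v, psi0 v).
Proof. exact: planeWE. Qed.

Lemma smooth_psi0 : smooth psi0.
Proof. exact: (smooth_comp_linear continuous_of_plane spsi). Qed.

Lemma smooth_Ypsi : smooth (vf_act fieldY psi).
Proof.
pose e2 : heis R := (0, 1, 0); pose e3 : heis R := (0, 0, 1).
have -> : vf_act fieldY psi = (fun p => 'D_e2 psi p + p.1.1 * 2^-1 * 'D_e3 psi p).
  apply/funext => p; rewrite /vf_act.
  have -> : fieldY p = 1 *: e2 + (p.1.1 * 2^-1) *: e3.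
    by rewrite /fieldY; congr (_, _, _);
      rewrite /= /GRing.scale/= ?mulr1 ?mulr0 ?addr0 ?add0r.
  by rewrite derive_comb2// mul1r.
apply: smoothD; first exact: smooth_derive.
apply: smoothM; last exact: smooth_derive.
by apply: smoothM; [exact: smooth_heis_x|exact: smooth_cst].
Qed.

Lemma smooth_Ypsi0 : smooth Ypsi0.
Proof. exact: (smooth_comp_linear continuous_of_plane smooth_Ypsi). Qed.

Lemma zero_derive_const (g : R -> R) (x : R) :
  (forall s : R, is_derive s 1 g 0) -> g x = g 0.
Proof. by move=> dg; exact: is_derive_0_is_cst. Qed.

(** Along the coset of [v] the field [Y] is the constant vector [w], so the coset is a straight line
    and YY psi is an ordinary second derivative along it. *)
Lemma Ypsi_graph_point v y : vf_act fieldY psi (graph_point v y) = Ypsi0 v.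
Proof.
pose w : heis R := (0, 1, v.1 / 2).
have lineE (s : R) : s *: w + of_plane v = graph_point v s.
  rewrite graph_pointE; congr (_, _, _); rewrite /= /GRing.scale/=.
  - by rewrite mulr0 add0r.
  - by rewrite mulr1 addr0.
  - by rewrite addrC; congr (_ + _); ring.
have wE (s : R) : fieldY (graph_point v s) = w by rewrite graph_pointE.
pose g (s : R) := vf_act fieldY psi (s *: w + of_plane v).
have dg (s : R) : is_derive s 1 g 0.
  rewrite -(YYpsi (graph_point v s)) /(vf_act _ (vf_act _ _)) wE -lineE.
  by apply: is_derive_line; apply: smooth_derivable; exact: smooth_Ypsi.
have := zero_derive_const y dg.
by rewrite /g lineE scale0r add0r.
Qed.

Lemma psi_graph_point v y : psi (graph_point v y) = psi0 v + y * Ypsi0 v.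
Proof.
pose w : heis R := (0, 1, v.1 / 2).
have lineE (s : R) : s *: w + of_plane v = graph_point v s.
  rewrite graph_pointE; congr (_, _, _); rewrite /= /GRing.scale/=.
  - by rewrite mulr0 add0r.
  - by rewrite mulr1 addr0.
  - by rewrite addrC; congr (_ + _); ring.
have wE (s : R) : fieldY (graph_point v s) = w by rewrite graph_pointE.
pose g (s : R) := psi (s *: w + of_plane v) - s * Ypsi0 v.
have dg (s : R) : is_derive s 1 g 0.
  have -> : 0 = 'D_w psi (s *: w + of_plane v) - Ypsi0 v :> R.
    by rewrite lineE -(Ypsi_graph_point v s) /vf_act wE subrr.
  apply: is_deriveB; first by apply: is_derive_line; exact: smooth_derivable.
  exact: (@is_derive_scalel R (Ypsi0 v) s).
have := zero_derive_const y dg.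
rewrite /g lineE scale0r add0r mul0r subr0 -/(psi0 v) => <-.
by rewrite subrK.
Qed.

(** The speed [- X psi] of the [y] coordinate at the point v . Y^y, obtained by applying dx - y dz
    to [psi0 + y Ypsi0]; it is quadratic in y. *)
Definition riccati (P : heis R) : R :=
  - (dx psi0 P.1 - P.2 * dz psi0 P.1 + P.2 * (dx Ypsi0 P.1 - P.2 * dz Ypsi0 P.1)).

Lemma smooth_riccati : smooth riccati.
Proof.
have s2 : smooth (snd : heis R -> R).
  exact: (smooth_linear (@continuous_snd _ _ _)).
have sc (h : plane R -> R) : smooth h -> smooth (fun P : heis R => h P.1).
  exact: smooth_comp_fst.
apply: smoothN; apply: smoothD.
- apply: smoothB; first by apply: sc; apply: smooth_dx; exact: smooth_psi0.
  by apply: smoothM => //; apply: sc; apply: smooth_dz; exact: smooth_psi0.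
- apply: smoothM => //; apply: smoothB; first by apply: sc; apply: smooth_dx; exact: smooth_Ypsi0.
  by apply: smoothM => //; apply: sc; apply: smooth_dz; exact: smooth_Ypsi0.
Qed.

(** A step [h] along [X] from v . Y^y keeps y and moves [v] by h (1, - y). Hence [X] acts on
    functions of [v] as dx - y dz with y frozen. *)
Lemma Xpsi_graph_point v y :
  vf_act fieldX psi (graph_point v y) = - riccati (v, y).
Proof.
pose u : plane R := (1, - y).
have -> : vf_act fieldX psi (graph_point v y) = 'D_u (fun v' => psi0 v' + y * Ypsi0 v') v.
  rewrite /vf_act /derive.
  suff -> : (fun h : R => h^-1 *: ((psi \o shift (graph_point v y)) (h *: fieldX (graph_point v y))
     - psi (graph_point v y))) = (fun h : R => h^-1 *: (((fun v' => psi0 v' + y * Ypsi0 v') \o shift v)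
     (h *: u) - (psi0 v + y * Ypsi0 v))) by [].
  apply/funext => h; rewrite psi_graph_point /=; congr (_ *: (_ - _)).
  rewrite -psi_graph_point; congr psi.
  rewrite !graph_pointE /fieldX/=; congr (_, _, _); rewrite /= /GRing.scale/=.
  - by rewrite mulr0 add0r.
  - by field.
have sy : smooth (fun v' => y * Ypsi0 v') by apply: smoothM; [exact: smooth_cst|exact: smooth_Ypsi0].
rewrite derive_planeE; last by apply: smoothD => //; exact: smooth_psi0.
rewrite dxD//; last exact: smooth_psi0.
rewrite dzD//; last exact: smooth_psi0.
rewrite dxM; [|exact: smooth_cst|exact: smooth_Ypsi0].
rewrite dzM; [|exact: smooth_cst|exact: smooth_Ypsi0].
have -> : dx (fun _ : plane R => y) v = 0 by exact: derive_cst.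
have -> : dz (fun _ : plane R => y) v = 0 by exact: derive_cst.
rewrite /riccati /u /=.
move: (dx psi0 v) (dx Ypsi0 v) (dz psi0 v) (dz Ypsi0 v) (Ypsi0 v) => a b c d e; ring.
Qed.

(* In the coordinates (v, y) of the point v . Y^y the contact field is triangular:
   its planar part does not depend on y because psi is affine along the fibers. *)
Definition planar_field v : plane R := (Ypsi0 v, psi0 v).
Definition adapted_field (P : heis R) : heis R := (planar_field P.1, riccati P).
Definition adapted p : heis R := (heis_proj p, p.1.2).

Lemma is_derive_adapted (c : R -> heis R) (s : R) :
  is_derive s 1 c (contact_field psi (c s)) ->
  is_derive s 1 (adapted \o c) (adapted_field (adapted (c s))).
Proof.
move=> dc.
have dx1 := is_derive_fst (is_derive_fst dc); have dy1 := is_derive_snd (is_derive_fst dc).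
have dz1 := is_derive_snd dc.
set p := c s in dx1 dy1 dz1 *.
have pE := graph_point_proj p.
have YE : vf_act fieldY psi p = Ypsi0 (heis_proj p) by rewrite -[in LHS]pE Ypsi_graph_point.
have XE : vf_act fieldX psi p = - riccati (heis_proj p, p.1.2).
  by rewrite -[in LHS]pE Xpsi_graph_point.
have PE : psi p = psi0 (heis_proj p) + p.1.2 * Ypsi0 (heis_proj p).
  by rewrite -[in LHS]pE psi_graph_point.
have -> : adapted \o c = fun t => (((fst \o (fst \o c)) t,
    (snd \o c) t - (fst \o (fst \o c)) t * (snd \o (fst \o c)) t / 2), (snd \o (fst \o c)) t).
  by apply/funext => t.
rewrite /adapted_field /planar_field /adapted/=.
have cE : contact_field psi p = (Ypsi0 (heis_proj p), riccati (heis_proj p, p.1.2),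
  - (Ypsi0 (heis_proj p) * p.1.2 / 2) + riccati (heis_proj p, p.1.2) * p.1.1 / 2 + psi p).
  rewrite /contact_field YE XE; congr (_, _, _); rewrite /= /GRing.scale/=; ring.
rewrite cE in dx1 dy1 dz1.
have dxy := is_deriveM dx1 dy1.
have dxy2 : is_derive s 1 (fun x => (fst \o (fst \o c)) x * (snd \o (fst \o c)) x / 2)
    ((p.1.1 * riccati (heis_proj p, p.1.2) + p.1.2 * Ypsi0 (heis_proj p)) / 2).
  have -> : (fun x => (fst \o (fst \o c)) x * (snd \o (fst \o c)) x / 2) =
    2^-1 *: ((fst \o (fst \o c)) * (snd \o (fst \o c)) : R -> R).
    by apply/funext => x; rewrite mulrC.
  by rewrite [X in is_derive _ _ _ X]mulrC; exact: (is_deriveZ 2^-1 dxy).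
have := is_derive_pair (is_derive_pair dx1 (is_deriveB dz1 dxy2)) dy1.
rewrite /= (_ : _ + psi p - _ = psi0 (heis_proj p)) //.
by rewrite PE; field.
Qed.

Definition planar_Dfield v (u : plane R) : plane R := ('D_u Ypsi0 v, 'D_u psi0 v).
Definition adapted_Dfield P (u : heis R) : heis R :=
  (planar_Dfield P.1 u.1, 'D_u riccati P).

End Potential.
End AdaptedCoordinates.

Section FieldBounds.
Context {R : realType}.

Lemma pair_norm_le (V W : normedModType R) (x : V * W) (c : R) :
  `|x.1| <= c -> `|x.2| <= c -> `|x| <= c.
Proof. by move=> h1 h2; rewrite prod_normE/= ge_max h1 h2. Qed.

Lemma norm_fst_le (V W : normedModType R) (x : V * W) : `|x.1| <= `|x|.
Proof. by rewrite prod_normE/= le_max lexx. Qed.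

Lemma norm_snd_le (V W : normedModType R) (x : V * W) : `|x.2| <= `|x|.
Proof. by rewrite prod_normE/= le_max lexx orbT. Qed.

Lemma C11_on_ballW (V : normedModType R) (F : V -> V) DF rad K K' :
  K <= K' -> C11_on_ball F DF rad K K K -> C11_on_ball F DF rad K' K' K'.
Proof.
move=> KK' [K0 _ _ h1 h2 h3 h4 h5 h6]; have K'0 := le_trans K0 KK'.
split => //.
- by move=> p /h1 /le_trans; apply.
- by move=> p q pr qr; apply: le_trans (h2 p q pr qr) _; rewrite ler_wpM2r.
- by move=> p u pr; apply: le_trans (h4 p u pr) _; rewrite ler_wpM2r.
- by move=> p q u pr qr; apply: le_trans (h5 p q u pr qr) _; rewrite ler_wpM2r// ler_wpM2r.
- by move=> p q pr qr; apply: le_trans (h6 p q pr qr) _; rewrite ler_wpM2r// exprn_ge0.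
Qed.

Variable psi : heis R -> R.
Hypothesis spsi : smooth psi.

Lemma planar_field_C11 (rad : R) : exists2 K, 0 <= K &
  C11_on_ball (planar_field psi) (planar_Dfield psi) rad K K K.
Proof.
have sal := smooth_psi0 spsi; have sbe := smooth_Ypsi0 spsi.
have [Ka Ka0 KaP] := smooth_C11_plane rad sal.
have [Kb Kb0 KbP] := smooth_C11_plane rad sbe.
have K0 : 0 <= Ka + Kb by rewrite addr_ge0.
have la : Ka <= Ka + Kb by rewrite lerDl.
have lb : Kb <= Ka + Kb by rewrite lerDr.
exists (Ka + Kb) => //; split => //.
- move=> p pr; have [a1 _ _ _ _] := KaP p p pr pr; have [b1 _ _ _ _] := KbP p p pr pr.
  by apply: pair_norm_le; [exact: le_trans b1 lb|exact: le_trans a1 la].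
- move=> p q pr qr; have [_ a1 _ _ _] := KaP p q pr qr; have [_ b1 _ _ _] := KbP p q pr qr.
  by apply: pair_norm_le; [apply: le_trans b1 _|apply: le_trans a1 _]; rewrite ler_wpM2r.
- by move=> p a u v; congr (_, _); rewrite deriveDl_smooth.
- move=> p u pr; have [_ _ a1 _ _] := KaP p p pr pr; have [_ _ b1 _ _] := KbP p p pr pr.
  by apply: pair_norm_le; [apply: le_trans (b1 u) _|apply: le_trans (a1 u) _]; rewrite ler_wpM2r.
- move=> p q u pr qr; have [_ _ _ a1 _] := KaP p q pr qr; have [_ _ _ b1 _] := KbP p q pr qr.
  by apply: pair_norm_le; [apply: le_trans (b1 u) _|apply: le_trans (a1 u) _];
    rewrite ler_wpM2r// ler_wpM2r.
- move=> p q pr qr; have [_ _ _ _ a1] := KaP p q pr qr; have [_ _ _ _ b1] := KbP p q pr qr.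
  by apply: pair_norm_le; [apply: le_trans b1 _|apply: le_trans a1 _];
    rewrite ler_wpM2r// exprn_ge0.
Qed.

Lemma adapted_field_C11 (rad : R) : exists2 K, 0 <= K &
  C11_on_ball (adapted_field psi) (adapted_Dfield psi) rad K K K.
Proof.
have src := smooth_riccati spsi.
have [Ka Ka0 [_ _ _ p1 p2 p3 p4 p5 p6]] := planar_field_C11 rad.
have [Kb Kb0 KbP] := smooth_C11 rad src.
have K0 : 0 <= Ka + Kb by rewrite addr_ge0.
have la : Ka <= Ka + Kb by rewrite lerDl.
have lb : Kb <= Ka + Kb by rewrite lerDr.
have n1 (P : heis R) : `|P| <= rad -> `|P.1| <= rad by apply: le_trans; exact: norm_fst_le.
exists (Ka + Kb) => //; split => //.
- move=> p pr; have [b1 _ _ _ _] := KbP p p pr pr.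
  by apply: pair_norm_le; [exact: le_trans (p1 _ (n1 _ pr)) la|exact: le_trans b1 lb].
- move=> p q pr qr; have [_ b1 _ _ _] := KbP p q pr qr.
  apply: pair_norm_le; last by apply: le_trans b1 _; rewrite ler_wpM2r.
  apply: le_trans (p2 _ _ (n1 _ pr) (n1 _ qr)) _; apply: ler_pM => //.
  exact: (norm_fst_le (p - q)).
- move=> p a u v; congr (_, _); last by rewrite deriveDl_smooth.
  exact: p3.
- move=> p u pr; have [_ _ b1 _ _] := KbP p p pr pr.
  apply: pair_norm_le; last by apply: le_trans (b1 u) _; rewrite ler_wpM2r.
  apply: le_trans (p4 _ _ (n1 _ pr)) _; apply: ler_pM => //.
  exact: norm_fst_le.
- move=> p q u pr qr; have [_ _ _ b1 _] := KbP p q pr qr.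
  apply: pair_norm_le; last by apply: le_trans (b1 u) _; rewrite ler_wpM2r// ler_wpM2r.
  apply: le_trans (p5 _ _ _ (n1 _ pr) (n1 _ qr)) _; apply: ler_pM => //.
  + by rewrite mulr_ge0.
  + by apply: ler_pM => //; exact: (norm_fst_le (p - q)).
  + exact: norm_fst_le.
- move=> p q pr qr; have [_ _ _ _ b1] := KbP p q pr qr.
  apply: pair_norm_le; last by apply: le_trans b1 _; rewrite ler_wpM2r// exprn_ge0.
  apply: le_trans (p6 _ _ (n1 _ pr) (n1 _ qr)) _; apply: ler_pM => //.
  by rewrite ler_pXn2r ?nnegrE//; exact: (norm_fst_le (p - q)).
Qed.

End FieldBounds.

Section Flows.
Context {R : realType}.

Lemma within_continuous_comp (V : normedModType R) (f : R -> V) (h : R -> R) (A B : set R) :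
  {within B, continuous f} -> continuous h -> (forall x, A x -> B (h x)) ->
  {within A, continuous (f \o h)}.
Proof.
move=> /subspace_continuousP cf ch AB; apply/subspace_continuousP => x Ax W /= fW.
have H : \forall y \near h x, B y -> W (f y) by exact: (cf (h x) (AB _ Ax) _ fW).
have : \forall z \near x, B (h z) -> W (f (h z)) by exact: (ch x _ H).
by apply: filterS => z Hz Az; exact: Hz (AB _ Az).
Qed.

Lemma within_continuous_postcomp (V W : normedModType R) (f : R -> V) (g : V -> W) (A : set R) :
  {within A, continuous f} -> continuous g -> {within A, continuous (g \o f)}.
Proof. by move=> cf cg x; apply: (cvg_comp _ _ (cf x)); exact: cg. Qed.

Lemma is_derive_real_dir (V : normedModType R) (c : R -> V) (x u : R) (d : V) :
  is_derive x 1 c d -> is_derive x u c (u *: d).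
Proof.
move=> [/derivable1_diffP dc dE]; apply: DeriveDef; first exact: diff_derivable.
rewrite deriveE// -[u in LHS]mulr1 -dE deriveE//.
exact: linearZ.
Qed.

Lemma is_derive_affine (V : normedModType R) (c : R -> V) (u q s : R) (d : V) :
  is_derive (s * u + q) 1 c d -> is_derive s 1 (fun x => c (x * u + q)) (u *: d).
Proof.
move=> /(is_derive_real_dir u)[dc <-].
exact: (@is_derive_line R R V c q u s dc).
Qed.

Lemma solution_reverse (V : normedModType R) (F : V -> V) (t : R) c :
  solution F t c -> solution F (- t) (fun s => c (1 - s)).
Proof.
move=> [cc dc].
have E : (fun s => c (1 - s)) = (fun s => c (s * (-1) + 1)).
  by apply/funext => s; rewrite mulrN1 addrC.
split.
  rewrite E; apply: (within_continuous_comp (h := fun s => s * (-1) + 1) cc).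
    by move=> s; apply: cvgD; [apply: cvgM; [exact: cvg_id|exact: cvg_cst]|exact: cvg_cst].
  by move=> x /=; rewrite !in_itv/= => /andP[x0 x1]; apply/andP; split; lra.
move=> s s01; rewrite E.
have s01' : 0 < s * (-1) + 1 < 1 by case/andP: s01 => ? ?; apply/andP; split; lra.
have := is_derive_affine (dc _ s01').
by rewrite scalerA mulN1r (_ : 1 - s = s * -1 + 1)// mulrN1 addrC.
Qed.

Variables (psi : heis R -> R) (phi : R -> heis R -> heis R) (eps : R).
Hypothesis spsi : smooth psi.
Hypothesis YYpsi : forall p, vf_act fieldY (vf_act fieldY psi) p = 0.
Hypothesis eps0 : 0 < eps.
Hypothesis phi_flow : is_flow (contact_field psi) eps phi.

Lemma continuous_adapted : continuous (@adapted R).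
Proof.
move=> p; apply: differentiable_continuous.
have d1 : differentiable (fun q : heis R => q.1.1) p.
  by apply: smooth_differentiable; exact: smooth_heis_x.
have d2 : differentiable (fun q : heis R => q.1.2) p.
  by apply: smooth_differentiable; exact: smooth_heis_y.
have d3 : differentiable (fun q : heis R => q.2 - q.1.1 * q.1.2 / 2) p.
  apply: smooth_differentiable; apply: smoothB; first exact: (smooth_linear (@continuous_snd _ _ _)).
  by apply: smoothM; [apply: smoothM; [exact: smooth_heis_x|exact: smooth_heis_y]|exact: smooth_cst].
exact: (differentiable_pair (differentiable_pair d1 d3) d2).
Qed.

Lemma flow_solution (t : R) (P : heis R) : - eps <= t <= eps ->
  exists c, [/\ solution (adapted_field psi) t c, c 0 = P &
    c 1 = adapted (phi t (graph_point P.1 P.2))].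
Proof.
move=> /andP[t1 t2]; have [phi0 cphi dphi] := phi_flow (graph_point P.1 P.2).
set q := graph_point P.1 P.2 in phi0 cphi dphi *.
pose c (s : R) := adapted (phi (s * t + 0) q).
have tin (s : R) : 0 <= s <= 1 -> - eps <= s * t + 0 <= eps.
  move=> /andP[s0 s1]; rewrite addr0 -ler_norml normrM (ger0_norm s0).
  apply: (@le_trans _ _ `|t|); first by rewrite ler_piMl.
  by rewrite ler_norml t1.
exists c; split.
- split.
    have cA : {within `[- eps, eps], continuous (fun t => adapted (phi t q))}.
      have cA : {within `[- eps, eps], continuous (@adapted R \o (phi ^~ q))}.
        exact: within_continuous_postcomp cphi continuous_adapted.
      exact: cA.
    apply: (within_continuous_comp (h := fun s => s * t + 0) cA).
      by move=> s; apply: cvgD; [apply: cvgM; [exact: cvg_id|exact: cvg_cst]|exact: cvg_cst].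
    by move=> s /=; rewrite !in_itv/=; exact: tin.
  move=> s /andP[s0 s1].
  apply: (@is_derive_affine _ (fun x => adapted (phi x q)) t 0 s).
  have tin' : - eps < s * t + 0 < eps.
    rewrite addr0 -ltr_norml normrM (gtr0_norm s0).
    have : `|t| <= eps by rewrite ler_norml t1.
    have := normr_ge0 t; rewrite le_eqVlt => /orP[/eqP <-|t0 teps].
      by rewrite mulr0.
    by apply: lt_le_trans teps; rewrite gtr_pMl.
  exact: (is_derive_adapted spsi YYpsi (dphi _ tin')).
- by rewrite /c mul0r addr0 phi0 /adapted /q heis_proj_graph_point/= add0r; case: (P).
- by rewrite /c mul1r addr0.
Qed.

End Flows.

(** * First order expansion of flow maps *)

Section QuasilinearPair.
Context {R : realType}.

(** As with [mean_value_ineq], a property of the target that passes to products coordinate by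
    coordinate. *)
Definition quasilinear_differentiability (W : normedModType R) :=
  forall (V : normedModType R) (f : V -> W) (x : V) (r B K : R),
  0 < r -> 0 <= K ->
  (forall u, `|u| <= r -> `|f (u + x) - f x| <= B * `|u|) ->
  (forall (a b : R) u1 u2, `|u1| <= r -> `|u2| <= r -> `|a *: u1 + b *: u2| <= r ->
    `|f (a *: u1 + b *: u2 + x) - f x - a *: (f (u1 + x) - f x)
       - b *: (f (u2 + x) - f x)|
    <= K * (`|a *: u1 + b *: u2| ^+ 2 + `|a| * `|u1| ^+ 2 + `|b| * `|u2| ^+ 2)) ->
  differentiable f x.

Lemma quasilinear_differentiability_real : quasilinear_differentiability R.
Proof. by move=> V f x r B K; exact: (@quasilinear_differentiable R V R f x r B K). Qed.

Lemma quasilinear_differentiability_pair (V W : normedModType R) :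
  quasilinear_differentiability V -> quasilinear_differentiability W ->
  quasilinear_differentiability (V * W)%type.
Proof.
move=> hV hW U f x r B K r0 K0 fB fK.
have -> : f = (fun y => ((fst \o f) y, (snd \o f) y)) by apply/funext => y /=; case: (f y).
apply: differentiable_pair.
- apply: (hV U (fst \o f) x r B K) => //.
  + by move=> u /fB; apply: le_trans; exact: (norm_fst_le (f (u + x) - f x)).
  + move=> a b u1 u2 h1 h2 h3; apply: le_trans (fK a b u1 u2 h1 h2 h3).
    exact: (norm_fst_le (f (a *: u1 + b *: u2 + x) - f x - a *: (f (u1 + x) - f x)
       - b *: (f (u2 + x) - f x))).
- apply: (hW U (snd \o f) x r B K) => //.
  + by move=> u /fB; apply: le_trans; exact: (norm_snd_le (f (u + x) - f x)).
  + move=> a b u1 u2 h1 h2 h3; apply: le_trans (fK a b u1 u2 h1 h2 h3).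
    exact: (norm_snd_le (f (a *: u1 + b *: u2 + x) - f x - a *: (f (u1 + x) - f x)
       - b *: (f (u2 + x) - f x))).
Qed.

Lemma quasilinear_differentiability_plane : quasilinear_differentiability (plane R).
Proof. by apply: quasilinear_differentiability_pair; exact: quasilinear_differentiability_real. Qed.

Lemma quasilinear_differentiability_heis : quasilinear_differentiability (heis R).
Proof.
apply: quasilinear_differentiability_pair; last exact: quasilinear_differentiability_real.
exact: quasilinear_differentiability_plane.
Qed.

Lemma is_derive_congr (V W : normedModType R) (f : V -> W) x v df df' :
  is_derive x v f df -> df = df' -> is_derive x v f df'.
Proof. by move=> h <-. Qed.

End QuasilinearPair.

Section FlowMap.
Context {R : realType}.

(** Only the curve issued from each point is given; dependence on the point is left to be proved. *)
Definition flow_map (V : normedModType R) (F : V -> V) (t : R) (Phi : V -> V) :=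
  forall P, exists c, [/\ solution F t c, c 0 = P & c 1 = Phi P].

Section General.
Context {V : normedModType R}.
Hypothesis mviV : mean_value_ineq V.
Hypothesis qldV : quasilinear_differentiability V.
Variables (F : V -> V) (DF : V -> V -> V) (rad K t : R) (Phi : V -> V).
Hypothesis C11 : C11_on_ball F DF rad K K K.
Hypothesis tK : `|t| * K <= 2^-1.
Hypothesis Phi_flow : flow_map F t Phi.

Let tK1 : `|t| * K < 1. Proof. by apply: le_lt_trans tK _; lra. Qed.
Let K0 := C11_M_ge0 C11.
Let s01 : 0 <= (1 : R) <= 1. Proof. by rewrite ler01 lexx. Qed.

Lemma flow_map_moves P : `|P| <= rad - 1 -> `|Phi P - P| <= `|t| * K.
Proof.
have [c [sc c0 c1]] := Phi_flow P; rewrite -c1 -c0 => Pr.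
exact: (solution_moves mviV C11 tK1).
Qed.

Lemma flow_map_dist P Q : `|P| <= rad - 1 -> `|Q| <= rad - 1 ->
  `|Phi P - Phi Q| <= 2 * `|P - Q|.
Proof.
have [c [sc c0 c1]] := Phi_flow P; have [d [sd d0 d1]] := Phi_flow Q.
rewrite -c1 -d1 -c0 -d0 => Pr Qr.
exact: (solution_dist mviV C11 tK1 tK sc sd).
Qed.

Lemma flow_map_linearized P Q : `|P| <= rad - 1 -> `|Q| <= rad - 1 ->
  `|Phi P - Phi Q - (P - Q) - t *: DF Q (P - Q)|
    <= (4 * K + 4 * K ^+ 2) * `|t| * (`|t| + `|P - Q|) * `|P - Q|.
Proof.
have [c [sc c0 c1]] := Phi_flow P; have [d [sd d0 d1]] := Phi_flow Q.
rewrite -c1 -d1 -c0 -d0 => Pr Qr.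
have := solution_linearized mviV C11 tK1 tK sc sd Pr Qr erefl.
by rewrite (_ : 4 * K + 2 * K * K + 2 * K ^+ 2 = 4 * K + 4 * K ^+ 2); last by ring.
Qed.

(** A further unit of radius is given up so that all increments of length at most 1 start within
    [rad - 1]. *)
Lemma flow_map_differentiable P : `|P| <= rad - 2 -> differentiable Phi P.
Proof.
move=> Pr.
have near u : `|u| <= 1 -> `|u + P| <= rad - 1.
  by move=> u1; apply: le_trans (ler_normD _ _) _; lra.
have P1 : `|P| <= rad - 1 by lra.
apply: (@qldV _ Phi P 1 2 (8 * `|t| * K)) => //.
- by rewrite !mulr_ge0.
- move=> u u1; have := flow_map_dist (near _ u1) P1.
  by rewrite addrK.
- move=> a b u1 u2 h1 h2 h3.
  have [c [sc c0 c1]] := Phi_flow P.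
  have [d1 [sd1 d10 d11]] := Phi_flow (u1 + P).
  have [d2 [sd2 d20 d21]] := Phi_flow (u2 + P).
  have [d3 [sd3 d30 d31]] := Phi_flow (a *: u1 + b *: u2 + P).
  rewrite -c1 -d11 -d21 -d31.
  by apply: (solution_quasilinear mviV C11 tK1 tK sc sd1 sd2 sd3);
    rewrite ?c0 ?d10 ?d20 ?d30 ?addrK// near.
Qed.

(** [flow_map_linearized] for the increment [h *: u], divided by [h]: in the factor |t| + |P - Q|
    the second term becomes |h| |u| and vanishes in the limit, which leaves t^2. *)
Lemma diff_flow_map P u : `|P| <= rad - 2 ->
  `|'d Phi P u - u - t *: DF P u| <= (4 * K + 4 * K ^+ 2) * `|t| ^+ 2 * `|u|.
Proof.
move=> Pr; have dPhi := flow_map_differentiable Pr.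
pose C := 4 * K + 4 * K ^+ 2.
have C0 : 0 <= C by rewrite addr_ge0 ?mulr_ge0.
have P1 : `|P| <= rad - 1 by lra.
have lim : h^-1 *: (Phi (h *: u + P) - Phi P) @[h --> 0^'] --> 'd Phi P u.
  rewrite -deriveE//; exact: (@diff_derivable _ _ _ Phi P u dPhi).
have lim2 : h^-1 *: (Phi (h *: u + P) - Phi P) - u - t *: DF P u @[h --> 0^'] -->
    'd Phi P u - u - t *: DF P u.
  by apply: cvgB; [apply: cvgB|]; [exact: lim|exact: cvg_cst|exact: cvg_cst].
rewrite -[X in `|X|]subr0; apply/ler_addgt0Pr => e e0.
apply: (cvg_dist_le_lim lim2); near=> h; rewrite subr0.
have h0 : h != 0 by near: h; exact: nbhs_dnbhs_neq.
have hu1 : `|h| <= (`|u| + 1)^-1.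
  by near: h; apply: dnbhs0_le; rewrite invr_gt0 ltr_wpDl.
have hu : `|h *: u| <= 1.
  rewrite normrZ; apply: (@le_trans _ _ ((`|u| + 1)^-1 * (`|u| + 1))).
    by apply: ler_pM => //; rewrite lerDl.
  by rewrite mulVf// gt_eqF// ltr_wpDl.
have hP : `|h *: u + P| <= rad - 1.
  by apply: le_trans (ler_normD _ _) _; lra.
have := flow_map_linearized hP P1; rewrite addrK.
have -> : Phi (h *: u + P) - Phi P - h *: u - t *: DF P (h *: u) =
    h *: (h^-1 *: (Phi (h *: u + P) - Phi P) - u - t *: DF P u).
  have -> : DF P (h *: u) = h *: DF P u.
    have DF00 : DF P 0 = 0.
      have := C11_lin C11 P 1 0 0; rewrite scaler0 addr0 scale1r => /eqP.
      by rewrite -subr_eq subrr eq_sym => /eqP.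
    by rewrite -[h *: u]addr0 (C11_lin C11) DF00 addr0.
  rewrite [in RHS]scalerBr [in RHS]scalerBr [h *: (h^-1 *: _)]scalerA mulfV// scale1r.
  by congr (_ - _); rewrite !scalerA mulrC.
rewrite normrZ -/C (normrZ h u) => H.
have h0' : 0 < `|h| by rewrite normr_gt0.
rewrite -(ler_pM2l h0'); apply: le_trans H _.
rewrite [leLHS](_ : _ = `|h| * (C * `|t| ^+ 2 * `|u| + C * `|t| * `|u| ^+ 2 * `|h|)); last by ring.
rewrite ler_wpM2l// lerD2l.
have : `|h| <= e / (C * `|t| * `|u| ^+ 2 + 1).
  by near: h; apply: dnbhs0_le; rewrite divr_gt0// ltr_wpDl// !mulr_ge0// exprn_ge0.
have D0 : 0 <= C * `|t| * `|u| ^+ 2 by rewrite !mulr_ge0// exprn_ge0.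
rewrite ler_pdivlMr ?ltr_wpDl// => /(le_trans _); apply.
by rewrite mulrC ler_wpM2l// lerDl.
Unshelve. all: by end_near. Qed.

(** The reversed curve of [P] and the curve defining [Theta (Phi P)] solve the same equation from
    the same point, so [solution_dist] identifies them. *)
Lemma flow_map_inverse Theta P : flow_map F (- t) Theta -> `|Phi P| <= rad - 1 ->
  Theta (Phi P) = P.
Proof.
move=> Theta_flow Pr.
have [c [/solution_reverse sc c0 c1]] := Phi_flow P.
have [d [sd d0 d1]] := Theta_flow (Phi P).
have tK' : `|- t| * K <= 2^-1 by rewrite normrN.
have tK1' : `|- t| * K < 1 by rewrite normrN.
have := solution_dist mviV C11 tK1' tK' sd sc.
rewrite d0 subr0 c1 subrr normr0 mulr0 => /(_ Pr Pr 1 s01).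
by rewrite d1 subrr c0 normr_le0 subr_eq0 => /eqP.
Qed.

End General.
End FlowMap.

(** * Invariance of the contact planes *)

Lemma contact_algebra (R : realFieldType) (t K rad y D1 D2 a1 b1 alx alz bex bez D G : R) :
  `|a1 - (D1 * alx + D2 * alz)| <= K * D ^+ 2 ->
  `|b1 - (D1 * bex + D2 * bez)| <= K * D ^+ 2 ->
  `|alz| <= K -> `|bez| <= K -> `|y| <= rad -> 0 <= D -> D <= G ->
  `|t * (a1 + - (alx - y * alz + y * (bex - y * bez)) * D1 + y * b1)|
    <= `|t| * (K * (1 + rad)) * `|D2 + y * D1| + `|t| * (K * (1 + rad)) * G ^+ 2.
Proof.
move=> h1 h2 h3 h4 h5 D0 DG.
have K0 : 0 <= K by exact: le_trans h3.
have r0 : 0 <= rad by exact: le_trans h5.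
have DG2 : D ^+ 2 <= G ^+ 2 by rewrite ler_pXn2r// nnegrE// (le_trans D0).
rewrite -!mulrA -mulrDr normrM ler_wpM2l//.
(* The x derivatives cancel, and what remains of the linear part is a multiple of the defect D2 + y
   D1 itself. This is what closes the differential inequality, at rate K (1 + rad). *)
rewrite (_ : _ + _ + _ = (alz + y * bez) * (D2 + y * D1)
  + (a1 - (D1 * alx + D2 * alz)) + y * (b1 - (D1 * bex + D2 * bez))); last by ring.
have e1 : `|(alz + y * bez) * (D2 + y * D1)| <= K * ((1 + rad) * `|D2 + y * D1|).
  rewrite normrM mulrA ler_wpM2r//; apply: le_trans (ler_normD _ _) _.
  by rewrite mulrDr mulr1 lerD// normrM [K * _]mulrC ler_pM.
have e2 : `|y * (b1 - (D1 * bex + D2 * bez))| <= rad * (K * G ^+ 2).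
  rewrite normrM ler_pM//; apply: le_trans h2 _; by rewrite ler_wpM2l.
have e3 : `|a1 - (D1 * alx + D2 * alz)| <= K * G ^+ 2.
  by apply: le_trans h1 _; rewrite ler_wpM2l.
apply: le_trans (ler_normD _ _) _; apply: le_trans (lerD (ler_normD _ _) (lexx _)) _.
lra.
Qed.

Section ContactPreserved.
Context {R : realType}.
Variables (psi : heis R -> R).
Hypothesis spsi : smooth psi.

Lemma mean_value_ineq_plane : mean_value_ineq (plane R).
Proof. by apply: mean_value_ineq_pair; exact: mean_value_ineq_real. Qed.

Lemma mean_value_ineq_heis : mean_value_ineq (heis R).
Proof. by apply: mean_value_ineq_pair; [exact: mean_value_ineq_plane|exact: mean_value_ineq_real]. Qed.

Variables (rad K t : R) (Phi : heis R -> heis R) (phi : plane R -> plane R).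
Hypothesis rad1 : 1 <= rad.
Hypothesis W11 : C11_on_ball (planar_field psi) (planar_Dfield psi) rad K K K.
Hypothesis F11 : C11_on_ball (adapted_field psi) (adapted_Dfield psi) rad K K K.
Hypothesis tK : `|t| * (K * (1 + rad)) <= 2^-1.
Hypothesis Phi_flow : flow_map (adapted_field psi) t Phi.
Hypothesis phi_flow : flow_map (planar_field psi) t phi.

Let K0 := C11_M_ge0 F11.

Lemma tK_weak : `|t| * K <= 2^-1.
Proof.
apply: le_trans tK; rewrite ler_wpM2l//.
by rewrite ler_peMr// lerDl (le_trans ler01).
Qed.

Lemma planar_solution c : solution (adapted_field psi) t c ->
  solution (planar_field psi) t (fst \o c).
Proof.
move=> [cc dc]; split; first exact: within_continuous_postcomp cc (@continuous_fst _ _ _).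
by move=> s s01; have := is_derive_fst (dc s s01).
Qed.

Lemma fst_flow_map P : `|P.1| <= rad - 1 -> (Phi P).1 = phi P.1.
Proof.
move=> Pr; have [c [sc c0 c1]] := Phi_flow P; have [d [sd d0 d1]] := phi_flow P.1.
have tK1 : `|t| * K < 1 by apply: le_lt_trans tK_weak _; lra.
have s01 : 0 <= (1 : R) <= 1 by rewrite ler01 lexx.
have := solution_dist mean_value_ineq_plane W11 tK1 tK_weak (planar_solution sc) sd.
rewrite /= c0 d0 subrr normr0 mulr0 => /(_ Pr Pr 1 s01).
by rewrite c1 d1 normr_le0 subr_eq0 => /eqP.
Qed.

(* The defect dz + y dx of the increment from being tangent to the contact planes
   satisfies a linear differential inequality. *)
Lemma contact_defect P Q : `|P| <= rad - 1 -> `|Q| <= rad - 1 ->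
  (Q.1.2 - P.1.2) + P.2 * (Q.1.1 - P.1.1) = 0 ->
  `|((Phi Q).1.2 - (Phi P).1.2) + (Phi P).2 * ((Phi Q).1.1 - (Phi P).1.1)|
   <= 4 * `|Q - P| ^+ 2.
Proof.
move=> Pr Qr PQ0.
have [c [sc c0 c1]] := Phi_flow P; have [d [sd d0 d1]] := Phi_flow Q.
have tKw := tK_weak.
have tK1 : `|t| * K < 1 by apply: le_lt_trans tKw _; lra.
have s01 : 0 <= (1 : R) <= 1 by rewrite ler01 lexx.
have [cc dc] := sc; have [cd dd] := sd.
pose E (s : R) : R := ((d s).1.2 - (c s).1.2) + (c s).2 * ((d s).1.1 - (c s).1.1).
pose e (s : R) : R := t * (psi0 psi (d s).1 - psi0 psi (c s).1 +
  riccati psi (c s) * ((d s).1.1 - (c s).1.1) + (c s).2 * (Ypsi0 psi (d s).1 - Ypsi0 psi (c s).1)).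
pose k := `|t| * (K * (1 + rad)) * (2 * `|Q - P|) ^+ 2.
have rad0 : 0 <= 1 + rad by rewrite addr_ge0// (le_trans ler01).
have k0 : 0 <= k by rewrite mulr_ge0 ?exprn_ge0 ?mulr_ge0.
have E0 : E 0 = 0 by rewrite /E c0 d0.
have -> : (Phi Q).1.2 - (Phi P).1.2 + (Phi P).2 * ((Phi Q).1.1 - (Phi P).1.1) = E 1.
  by rewrite /E c1 d1.
suff : `|E 1| <= 2 * (`|E 0| + k).
  rewrite E0 normr0 add0r => /le_trans; apply.
  have : k <= 2^-1 * (2 * `|Q - P|) ^+ 2.
    by rewrite /k ler_wpM2r// exprn_ge0// mulr_ge0.
  rewrite exprMn; lra.
apply: (gronwall01 (@mean_value_ineq_real R) (l := `|t| * (K * (1 + rad))) _ k0 (E := E) (e := e)) => //.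
- by rewrite tK andbT !mulr_ge0.
- have pc (x : R -> heis R) (g : heis R -> R) : {within `[0, 1], continuous x} ->
      continuous g -> {within `[0, 1], continuous (g \o x)}.
    exact: within_continuous_postcomp.
  have g11 := smooth_continuous (@smooth_heis_x R).
  have g12 := smooth_continuous (@smooth_heis_y R).
  have g2 : continuous (snd : heis R -> R) := @continuous_snd _ _ _.
  move=> s; apply: cvgD; first by apply: cvgB; [exact: (pc _ _ cd g12)|exact: (pc _ _ cc g12)].
  apply: cvgM; first exact: (pc _ _ cc g2).
  by apply: cvgB; [exact: (pc _ _ cd g11)|exact: (pc _ _ cc g11)].
- move=> s s01'.
  have dcs := dc s s01'; have dds := dd s s01'.
  have c11 := is_derive_fst (is_derive_fst dcs); have c12 := is_derive_snd (is_derive_fst dcs).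
  have c2 := is_derive_snd dcs.
  have d11 := is_derive_fst (is_derive_fst dds); have d12 := is_derive_snd (is_derive_fst dds).
  have := is_deriveD (is_deriveB d12 c12) (is_deriveM c2 (is_deriveB d11 c11)).
  move=> h; apply: (is_derive_congr (f := E) h).
  rewrite /e !fctE /= /GRing.scale/=; ring.
- move=> s s01'.
  have ss : 0 <= s <= 1 by case/andP: s01' => *; rewrite !ltW.
  have cP : `|c 0| <= rad - 1 by rewrite c0.
  have dQ : `|d 0| <= rad - 1 by rewrite d0.
  have cr := solution_stays mean_value_ineq_heis F11 tK1 sc cP ss.
  have dr := solution_stays mean_value_ineq_heis F11 tK1 sd dQ ss.
  have cdr := solution_dist mean_value_ineq_heis F11 tK1 tKw sd sc dQ cP ss.
  rewrite c0 d0 in cdr.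
  set p := (c s).1; set q := (d s).1; set y := (c s).2.
  have pr : `|p| <= rad by apply: le_trans (norm_fst_le _) cr.
  have qr : `|q| <= rad by apply: le_trans (norm_fst_le _) dr.
  have yr : `|y| <= rad by apply: le_trans (norm_snd_le _) cr.
  have pq : `|q - p| <= 2 * `|Q - P| by apply: le_trans (norm_fst_le (d s - c s)) cdr.
  have Tay := C11_taylor W11 qr pr.
  have Tb := le_trans (norm_fst_le _) Tay; have Ta := le_trans (norm_snd_le _) Tay.
  have Dz := C11_Dbound W11 (0, 1) pr.
  have n1 : `|((0, 1) : plane R)| = 1 by rewrite prod_normE/= normr0 normr1; apply/max_idPr; lra.
  rewrite n1 mulr1 in Dz.
  have Zb := le_trans (norm_fst_le _) Dz; have Za := le_trans (norm_snd_le _) Dz.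
  rewrite /= !derive_planeE in Ta Tb; try exact: smooth_psi0; try exact: smooth_Ypsi0.
  have D0 := normr_ge0 (q - p).
  change (`|t * (psi0 psi q - psi0 psi p + - (dx (psi0 psi) p - y * dz (psi0 psi) p
      + y * (dx (Ypsi0 psi) p - y * dz (Ypsi0 psi) p)) * (q - p).1 + y * (Ypsi0 psi q - Ypsi0 psi p))|
    <= `|t| * (K * (1 + rad)) * `|(q - p).2 + y * (q - p).1|
     + `|t| * (K * (1 + rad)) * (2 * `|Q - P|) ^+ 2).
  exact: (contact_algebra t Ta Tb Za Zb yr D0 pq).
Qed.

(** The increment [h *: u] starts with zero defect, so by [contact_defect] its image has defect of
    order h^2, which is negligible after division by [h]. *)
Lemma diff_flow_map_contact P (u : heis R) : `|P| <= rad - 2 ->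
  u.1.2 + P.2 * u.1.1 = 0 ->
  ('d Phi P u).1.2 + (Phi P).2 * ('d Phi P u).1.1 = 0.
Proof.
move=> Pr u0.
have dPhi := flow_map_differentiable mean_value_ineq_heis quasilinear_differentiability_heis F11 tK_weak Phi_flow Pr.
have lim : h^-1 *: (Phi (h *: u + P) - Phi P) @[h --> 0^'] --> 'd Phi P u.
  rewrite -deriveE//; exact: (@diff_derivable _ _ _ Phi P u dPhi).
pose T (w : heis R) : R := w.1.2 + (Phi P).2 * w.1.1.
have cT : continuous T.
  apply: smooth_continuous; apply: smoothD; first exact: smooth_heis_y.
  by apply: smoothM; [exact: smooth_cst|exact: smooth_heis_x].
have lim2 : T (h^-1 *: (Phi (h *: u + P) - Phi P)) @[h --> 0^'] --> T ('d Phi P u).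
  by apply: (cvg_comp _ _ lim); exact: cT.
apply/eqP; rewrite -normr_le0 -[X in `|X|]subr0; apply/ler_addgt0Pr => e e0.
rewrite add0r; apply: (cvg_dist_le_lim lim2); near=> h; rewrite subr0.
have h0 : h != 0 by near: h; exact: nbhs_dnbhs_neq.
have hu1 : `|h| <= (`|u| + 1)^-1.
  by near: h; apply: dnbhs0_le; rewrite invr_gt0 ltr_wpDl.
have hu : `|h *: u| <= 1.
  rewrite normrZ; apply: (@le_trans _ _ ((`|u| + 1)^-1 * (`|u| + 1))).
    by apply: ler_pM => //; rewrite lerDl.
  by rewrite mulVf// gt_eqF// ltr_wpDl.
have P1 : `|P| <= rad - 1 by lra.
have hP : `|h *: u + P| <= rad - 1 by apply: le_trans (ler_normD _ _) _; lra.
have TZ (a : R) w : T (a *: w) = a * T w.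
  by rewrite /T /= /GRing.scale/=; ring.
have hE : h *: u + P - P = h *: u by rewrite addrK.
have := contact_defect P1 hP; rewrite hE (normrZ h u).
have -> : (h *: u + P).1.2 - P.1.2 + P.2 * ((h *: u + P).1.1 - P.1.1) = 0.
  rewrite /= !addrK /GRing.scale/= -[RHS](mulr0 h) -u0; ring.
move=> /(_ erefl) H; rewrite TZ normrM normfV.
have h0' : 0 < `|h| by rewrite normr_gt0.
rewrite ler_pdivrMl//; apply: le_trans H _.
rewrite [leLHS](_ : _ = `|h| * (`|h| * (4 * `|u| ^+ 2))); last by ring.
rewrite ler_wpM2l//.
have D0 : 0 <= 4 * `|u| ^+ 2 by rewrite !mulr_ge0// exprn_ge0.
have : `|h| <= e / (4 * `|u| ^+ 2 + 1).
  by near: h; apply: dnbhs0_le; rewrite divr_gt0// ltr_wpDl.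
rewrite ler_pdivlMr ?ltr_wpDl// => /(le_trans _); apply.
by rewrite ler_wpM2l// lerDl.
Unshelve. all: by end_near. Qed.

End ContactPreserved.

(** * Area of the image of a small square *)

Lemma image_square_algebra (R : realFieldType) (t r L K m11 m12 m21 m22 : R) :
  0 < r -> r <= 1 -> `|t| <= 1 -> `|t| * L <= 2^-1 -> 0 <= K ->
  `|m11| <= L -> `|m12| <= L -> `|m21| <= L -> `|m22| <= L ->
  forall D d C C' : R, D = 2 * L ^+ 2 + 2 * K -> d = D * (t ^+ 2 + r) ->
  C = L ^+ 2 + 3 * D + 2 * D ^+ 2 -> C' = C + 2 * L ^+ 2 * (2 + 2 * C) ->
  4 * (r * (1 + t * m11 + d)) * (r * (1 + t * m22 + d)) / (1 - t * m12 * (t * m21)) <=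
  (1 + t * (m11 + m22) + C' * t ^+ 2 + C' * r) * (2 * r) ^+ 2.
Proof.
move=> r0 r1 t1 tL K0 h11 h12 h21 h22 D d C C' DE dE CE C'E.
have L0 : 0 <= L by exact: le_trans h11.
have t20 : 0 <= t ^+ 2 by rewrite sqr_ge0.
have t21 : t ^+ 2 <= 1 by rewrite -real_normK ?num_real// expr_le1.
have tm m : `|m| <= L -> `|t * m| <= 2^-1.
  by move=> mL; apply: le_trans tL; rewrite normrM ler_wpM2l.
have D0 : 0 <= D by rewrite DE addr_ge0// mulr_ge0// sqr_ge0.
have s0 : 0 <= t ^+ 2 + r by rewrite addr_ge0// ltW.
have d0 : 0 <= d by rewrite dE mulr_ge0.
have C0 : 0 <= C by rewrite CE !addr_ge0// ?mulr_ge0// sqr_ge0.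
have C'0 : 0 <= C' by rewrite C'E addr_ge0// mulr_ge0 ?mulr_ge0 ?sqr_ge0// addr_ge0// mulr_ge0.
have a1 := tm _ h11; have a2 := tm _ h22.
have b12 : `|t * m12 * (t * m21)| <= t ^+ 2 * L ^+ 2.
  rewrite -exprMn expr2 normrM.
  have n12 : `|t * m12| <= `|t * L|.
    by rewrite !normrM ler_wpM2l// (le_trans h12)// ler_norm.
  have n21 : `|t * m21| <= `|t * L|.
    by rewrite !normrM ler_wpM2l// (le_trans h21)// ler_norm.
  rewrite -expr2 -[leRHS]real_normK ?num_real// expr2.
  exact: ler_pM.
have q14 : t ^+ 2 * L ^+ 2 <= 4^-1.
  rewrite -exprMn -real_normK ?num_real// normrM (ger0_norm L0).
  have -> : 4^-1 = (2^-1) ^+ 2 :> R by field.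
  by rewrite ler_pXn2r// nnegrE ?mulr_ge0.
have [k1 k2] : - (t ^+ 2 * L ^+ 2) <= t * m12 * (t * m21) /\
    t * m12 * (t * m21) <= t ^+ 2 * L ^+ 2 by move: b12; rewrite ler_norml => /andP[].
set x := t * m12 * (t * m21) in k1 k2 *.
set X := t ^+ 2 * L ^+ 2 in k1 k2 q14.
have X0 : 0 <= X by rewrite mulr_ge0// sqr_ge0.
have x1 : 0 < 1 - x by lra.
rewrite ler_pdivrMr//.
have [c1 c2] : - 2^-1 <= t * m11 /\ t * m11 <= 2^-1 by move: a1; rewrite ler_norml => /andP[].
have [e1 e2] : - 2^-1 <= t * m22 /\ t * m22 <= 2^-1 by move: a2; rewrite ler_norml => /andP[].
set s := t ^+ 2 + r in s0 dE *.
have s2 : s <= 2 by rewrite /s; lra.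
(* [C] gathers everything beyond first order in the product of the two half-widths, measured by s =
   t^2 + r. *)
have p1 : (1 + t * m11 + d) * (1 + t * m22 + d) <= 1 + t * (m11 + m22) + C * s.
  have -> : (1 + t * m11 + d) * (1 + t * m22 + d) =
    1 + t * (m11 + m22) + (t * m11 * (t * m22) + d * (2 + t * m11 + t * m22) + d * d) by ring.
  rewrite lerD2l.
  have g1 : t * m11 * (t * m22) <= L ^+ 2 * s.
    have : t * m11 * (t * m22) <= t ^+ 2 * L ^+ 2.
      rewrite mulrACA -expr2 ler_wpM2l//.
      apply: le_trans (ler_norm _) _; rewrite normrM expr2.
      by apply: ler_pM.
    move=> /le_trans; apply; rewrite mulrC ler_wpM2l ?sqr_ge0//.
    by rewrite /s lerDl ltW.
  have g2 : d * (2 + t * m11 + t * m22) <= d * 3 by rewrite ler_wpM2l//; lra.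
  have g3 : d * d <= d * (2 * D).
    by rewrite ler_wpM2l// dE mulrC ler_wpM2r.
  have -> : C * s = L ^+ 2 * s + d * 3 + d * (2 * D) by rewrite CE dE; ring.
  lra.
set T := 1 + t * (m11 + m22) in p1 *.
have T2 : T <= 2 by rewrite /T mulrDr; lra.
have T0 : 0 <= T by rewrite /T mulrDr; lra.
(* [C'] additionally pays for the denominator of the area, which is at least 1 - X with X = t^2 L^2
   <= 1/4. *)
have p2 : T + C * s <= (T + C' * t ^+ 2 + C' * r) * (1 - X).
  have -> : T + C' * t ^+ 2 + C' * r = T + C' * s by rewrite /s; ring.
  have Xs : X <= L ^+ 2 * s.
    by rewrite /X mulrC ler_wpM2l ?sqr_ge0// /s lerDl ltW.
  have f1 : T * X <= 2 * (L ^+ 2 * s) by apply: ler_pM.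
  have f2 : C' * s * X <= C' * s * 4^-1 by rewrite ler_wpM2l// mulr_ge0.
  have f3 : C' * s = C * s + 4 * (L ^+ 2 * s) + 4 * C * (L ^+ 2 * s) by rewrite C'E; ring.
  have f4 : C * s * X <= C * s * 4^-1 by rewrite ler_wpM2l// mulr_ge0.
  have f5 : C * s * X <= 2 * (C * (L ^+ 2 * s)).
    have : s * X <= 2 * (L ^+ 2 * s) by apply: ler_pM.
    by move=> /(ler_wpM2l C0); lra.
  have f6 : L ^+ 2 * s * X <= L ^+ 2 * s * 4^-1.
    by rewrite ler_wpM2l// mulr_ge0 ?sqr_ge0.
  have f7 : C * (L ^+ 2 * s) * X <= C * (L ^+ 2 * s) * 4^-1.
    by rewrite ler_wpM2l// !mulr_ge0 ?sqr_ge0.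
  have g1 : 0 <= L ^+ 2 * s by rewrite mulr_ge0 ?sqr_ge0.
  have g2 : 0 <= C * (L ^+ 2 * s) by rewrite mulr_ge0.
  rewrite f3; lra.
have V0 : 0 <= T + C' * t ^+ 2 + C' * r.
  by rewrite -addrA -mulrDr addr_ge0// mulr_ge0.
have p3 : (T + C' * t ^+ 2 + C' * r) * (1 - X) <= (T + C' * t ^+ 2 + C' * r) * (1 - x).
  by rewrite ler_wpM2l//; lra.
have -> : 4 * (r * (1 + t * m11 + d)) * (r * (1 + t * m22 + d)) =
  (2 * r) ^+ 2 * ((1 + t * m11 + d) * (1 + t * m22 + d)) by ring.
have -> : (T + C' * t ^+ 2 + C' * r) * (2 * r) ^+ 2 * (1 - x) =
  (2 * r) ^+ 2 * ((T + C' * t ^+ 2 + C' * r) * (1 - x)) by ring.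
by rewrite ler_wpM2l ?sqr_ge0// (le_trans p1)// (le_trans p2).
Qed.

(** Subtracting [t * m12 * y] cancels the off-diagonal term [t * m12 * u2] up to second order. A
    bounding box with axes parallel to the coordinates would instead add |t| (|m12| + |m21|) to the
    area factor and spoil the coefficient of t. *)
Lemma image_square_coordinate (R : realFieldType)
    (t r L K m11 m12 m21 m22 u1 u2 x y D d : R) :
  0 <= r -> `|t| <= 1 -> `|t| * L <= 2^-1 -> 0 <= K ->
  `|m11| <= L -> `|m12| <= L -> `|m21| <= L -> `|m22| <= L ->
  `|u1| <= r -> `|u2| <= r -> D = 2 * L ^+ 2 + 2 * K -> d = D * (t ^+ 2 + r) ->
  `|x - u1 - t * (m11 * u1 + m12 * u2)| <= K * `|t| * (`|t| + r) * r ->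
  `|y - u2 - t * (m21 * u1 + m22 * u2)| <= K * `|t| * (`|t| + r) * r ->
  `|x - t * m12 * y| <= r * (1 + t * m11 + d).
Proof.
move=> r0 t1 tL K0 h11 h12 h21 h22 hu1 hu2 -> ->.
set e1 := x - u1 - _; set e2 := y - u2 - _ => he1 he2.
have L0 : 0 <= L by exact: le_trans h11.
have tt0 := normr_ge0 t.
set E := t ^+ 2 + r.
have Ebound : `|t| * (`|t| + r) <= E.
  rewrite mulrDr -expr2 real_normK ?num_real// lerD2l.
  by rewrite -[leRHS]mul1r ler_wpM2r.
have he (b : R) : `|b| <= K * `|t| * (`|t| + r) * r -> `|b| <= K * E * r.
  by move=> /le_trans; apply; rewrite -(mulrA K) ler_wpM2r// ler_wpM2l.
have {}he1 := he _ he1; have {}he2 := he _ he2.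
have -> : x - t * m12 * y =
    u1 * (1 + t * m11) + e1 - t * m12 * (t * m21 * u1 + t * m22 * u2) - t * m12 * e2.
  by rewrite /e1 /e2; ring.
have tm : `|t * m12| <= 2^-1.
  by apply: le_trans tL; rewrite normrM ler_wpM2l.
have tm2 m : `|m| <= L -> `|t * m| <= `|t| * L by move=> ?; rewrite normrM ler_wpM2l.
have c1 : `|u1 * (1 + t * m11)| <= r * (1 + t * m11).
  have : `|t * m11| <= 2^-1 by exact: le_trans (tm2 _ h11) tL.
  rewrite ler_norml => /andP[q _].
  have q0 : 0 <= 1 + t * m11 by lra.
  by rewrite normrM (ger0_norm q0) ler_wpM2r.
have c2 : `|t * m12 * (t * m21 * u1 + t * m22 * u2)| <= r * (2 * L ^+ 2 * E).
  have a1 : `|t * m21 * u1 + t * m22 * u2| <= `|t| * L * r + `|t| * L * r.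
    by apply: le_trans (ler_normD _ _) _; rewrite !(normrM (t * _)) lerD// ler_pM// tm2.
  have : `|t * m12 * (t * m21 * u1 + t * m22 * u2)| <= `|t| * L * (`|t| * L * r + `|t| * L * r).
    by rewrite normrM ler_pM// tm2.
  move=> /le_trans; apply.
  rewrite [leLHS](_ : _ = r * (2 * L ^+ 2 * `|t| ^+ 2)); last by ring.
  rewrite ler_wpM2l// ler_wpM2l ?mulr_ge0 ?sqr_ge0// real_normK ?num_real//.
  by rewrite lerDl.
have c3 : `|t * m12 * e2| <= 2^-1 * (K * E * r) by rewrite normrM ler_pM.
apply: le_trans (ler_normB _ _) _; apply: le_trans (lerD (ler_normB _ _) (lexx _)) _.
apply: le_trans (lerD (lerD (ler_normD _ _) (lexx _)) (lexx _)) _.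
have KE0 : 0 <= K * E * r by rewrite !mulr_ge0// addr_ge0// sqr_ge0.
have -> : r * (1 + t * m11 + (2 * L ^+ 2 + 2 * K) * E) =
  r * (1 + t * m11) + r * (2 * L ^+ 2 * E) + 2 * (K * E * r) by ring.
lra.
Qed.

Lemma image_square_bound (R : realType) (w0 : plane R) (t r L K m11 m12 m21 m22 : R)
    (S : set (plane (measurableTypeR R))) (D C C' : R) :
  0 < r -> r <= 1 -> `|t| <= 1 -> `|t| * L <= 2^-1 -> 0 <= K ->
  `|m11| <= L -> `|m12| <= L -> `|m21| <= L -> `|m22| <= L ->
  D = 2 * L ^+ 2 + 2 * K -> C = L ^+ 2 + 3 * D + 2 * D ^+ 2 ->
  C' = C + 2 * L ^+ 2 * (2 + 2 * C) -> measurable S ->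
  (forall w, S w -> exists u : plane R, [/\ `|u| < r,
    `|w.1 - w0.1 - u.1 - t * (m11 * u.1 + m12 * u.2)| <= K * `|t| * (`|t| + r) * r &
    `|w.2 - w0.2 - u.2 - t * (m21 * u.1 + m22 * u.2)| <= K * `|t| * (`|t| + r) * r]) ->
  (mu_plane S <= ((1 + t * (m11 + m22) + C' * t ^+ 2 + C' * r) * (2 * r) ^+ 2)%:E)%E.
Proof.
move=> r0 r1 t1 tL K0 h11 h12 h21 h22 DE CE C'E mS Sw.
pose d := D * (t ^+ 2 + r).
have L0 : 0 <= L by exact: le_trans h11.
have d0 : 0 <= d.
  have r0' := ltW r0.
  have L20 := sqr_ge0 L; have t20 := sqr_ge0 t.
  by rewrite /d DE; apply: mulr_ge0; apply: addr_ge0 => //; apply: mulr_ge0.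
have tm m : `|m| <= L -> `|t * m| <= 2^-1.
  by move=> mL; apply: le_trans tL; rewrite normrM ler_wpM2l.
have nonneg m : `|m| <= L -> 0 <= r * (1 + t * m + d).
  move=> /tm; rewrite ler_norml => /andP[q _].
  by rewrite mulr_ge0 ?(ltW r0)//; lra.
have pq : t * m12 * (t * m21) < 1.
  apply: le_lt_trans (ler_norm _) _; rewrite normrM.
  apply: (@le_lt_trans _ _ (2^-1 * 2^-1)); first by rewrite ler_pM// tm.
  lra.
have muP := mu_plane_parallelogram (w0.1 - t * m12 * w0.2) (w0.2 - t * m21 * w0.1)
  (nonneg _ h11) (nonneg _ h22) pq.
have sub : S `<=` [set w : plane (measurableTypeR R) |
    `|w.1 - t * m12 * w.2 - (w0.1 - t * m12 * w0.2)| <= r * (1 + t * m11 + d) /\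
    `|w.2 - t * m21 * w.1 - (w0.2 - t * m21 * w0.1)| <= r * (1 + t * m22 + d)].
  move=> w /Sw[u [ur e1 e2]] /=.
  have u1 : `|u.1| <= r by apply: le_trans (norm_fst_le _) (ltW ur).
  have u2 : `|u.2| <= r by apply: le_trans (norm_snd_le _) (ltW ur).
  have r0' := ltW r0.
  split.
    have -> : w.1 - t * m12 * w.2 - (w0.1 - t * m12 * w0.2) =
      (w.1 - w0.1) - t * m12 * (w.2 - w0.2) by ring.
    exact: (image_square_coordinate r0' t1 tL K0 h11 h12 h21 h22 u1 u2 DE erefl e1 e2).
  have -> : w.2 - t * m21 * w.1 - (w0.2 - t * m21 * w0.1) =
      (w.2 - w0.2) - t * m21 * (w.1 - w0.1) by ring.
  rewrite addrC (addrC (m21 * _)) in e2; rewrite (addrC (m11 * _)) in e1.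
  rewrite addrC in e2.
  exact: (image_square_coordinate r0' t1 tL K0 h22 h21 h12 h11 u2 u1 DE erefl e2 e1).
have mP : measurable ([set w : plane R |
    `|w.1 - t * m12 * w.2 - (w0.1 - t * m12 * w0.2)| <= r * (1 + t * m11 + d) /\
    `|w.2 - t * m21 * w.1 - (w0.2 - t * m21 * w0.1)| <= r * (1 + t * m22 + d)]
    : set (plane (measurableTypeR R))).
  rewrite (_ : [set _ | _] =
    [set w | `|1 * w.1 + (- (t * m12)) * w.2 - (w0.1 - t * m12 * w0.2)|
      <= r * (1 + t * m11 + d)] `&`
    [set w | `|(- (t * m21)) * w.1 + 1 * w.2 - (w0.2 - t * m21 * w0.1)|
      <= r * (1 + t * m22 + d)]); first by apply: measurableI; exact: measurable_strip.
  apply/seteqP; split => w /=; rewrite !mul1r !mulNr => -[h1 h2]; split => //.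
    by rewrite [X in `|X - _|]addrC.
  by rewrite [X in `|X - _|]addrC.
apply: (le_trans (le_measure mu_plane (mem_set mS) (mem_set mP) sub)).
move: muP => /= ->; rewrite lee_fin.
exact: (image_square_algebra r0 r1 t1 tL K0 h11 h12 h21 h22 DE erefl CE C'E).
Qed.

(** * First variation of the energy density *)

Lemma near_eq_differentiable (R : realType) (V W : normedModType R) (f g : V -> W) (x : V) :
  (\forall y \near x, f y = g y) -> differentiable g x -> differentiable f x.
Proof.
move=> fg dg.
suff: is_diff x f ('d g x) by move=> [].
apply: is_diff_near; first exact: diff_continuous.
move=> e e0; have fgx : f x = g x by exact: (nbhs_singleton fg).
have fgh : \forall h \near 0, f (h + x) = g (h + x).
  have cs : {for (0 : V), continuous (fun h : V => h + x)}.
    by apply: cvgD; [exact: cvg_id|exact: cvg_cst].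
  by apply: (cs (fun y => f y = g y)); rewrite add0r.
have dgh := differentiable_near dg e0.
near=> h; rewrite fgx (near fgh h)//; exact: (near dgh h).
Unshelve. all: by end_near. Qed.


Lemma near_norm_le (R : realType) (V W : normedModType R) (h : V -> W) (v : V) (r : R) :
  {for v, continuous h} -> `|h v| < r -> \forall w \near v, `|h w| <= r.
Proof. by move=> ch; exact: (@cvgr_norm_le R W V (nbhs v) _ h (h v) ch r). Qed.

(** [n] is the quotient y / x, with first order coefficient b - g a. As [b] and [e2] may grow
    linearly in [g], every bound is kept proportional to s = 1 + |g|. The lower bound 1/2 on [x]
    doubles the constant in [D], and s^2 <= 2 (1 + g^2) accounts for the factor 2 in [C]. *)
Lemma square_quotient_expansion (R : realFieldType) (t g a b e1 e2 x y n B D C : R) :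
  x = 1 + t * a + e1 -> y = g + t * b + e2 -> x * n = y -> `|t| <= 1 -> 2^-1 <= x ->
  `|a| <= B -> `|b| <= B * (1 + `|g|) -> `|e1| <= B * t ^+ 2 ->
  `|e2| <= B * t ^+ 2 * (1 + `|g|) ->
  D = 4 * B + 8 * B ^+ 2 -> C = 2 * (4 * B ^+ 2 + 2 * (1 + 2 * B) * D + D ^+ 2) ->
  `|n ^+ 2 - (g ^+ 2 + 2 * t * g * (b - g * a))| <= C * t ^+ 2 * (1 + g ^+ 2).
Proof.
move=> xE yE xn t1 x2 aB bB e1B e2B DE CE.
have B0 : 0 <= B by exact: le_trans aB.
have T0 : 0 <= t ^+ 2 := sqr_ge0 t.
have T1 : t ^+ 2 <= 1 by rewrite -real_normK ?num_real// expr_le1.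
pose s := 1 + `|g|; pose g1 := b - g * a.
have s1 : 1 <= s by rewrite lerDl.
have s0 : 0 <= s by exact: le_trans ler01 s1.
have gs : `|g| <= s by rewrite lerDr.
have g1s : `|g1| <= 2 * B * s.
  apply: le_trans (ler_normB _ _) _; rewrite normrM.
  have : `|g| * `|a| <= s * B by rewrite ler_pM.
  by move: bB; rewrite -/s; lra.
have tg1s : `|t * g1| <= 2 * B * s.
  by rewrite normrM; apply: le_trans g1s; rewrite ler_piMl.
have h1 : `|g + t * g1| <= (1 + 2 * B) * s.
  by apply: le_trans (ler_normD _ _) _; rewrite mulrDl mul1r lerD.
pose e3 := n - g - t * g1.
have x0 : 0 < x by apply: lt_le_trans x2; rewrite invr_gt0 ltr0n.
have D0 : 0 <= D by rewrite DE addr_ge0// mulr_ge0// sqr_ge0.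
have e3E : x * e3 = e2 - e1 * (g + t * g1) - t ^+ 2 * (a * g1).
  by rewrite /e3 2!mulrBr xn yE xE /g1; ring.
have e3B : `|e3| <= D * t ^+ 2 * s.
  have xe3 : `|x * e3| <= t ^+ 2 * s * (2 * B + 4 * B ^+ 2).
    rewrite e3E; apply: le_trans (ler_normB _ _) _.
    apply: le_trans (lerD (ler_normB _ _) (lexx _)) _.
    rewrite 2!normrM (ger0_norm T0).
    have q1 : `|e1| * `|g + t * g1| <= B * t ^+ 2 * ((1 + 2 * B) * s) by rewrite ler_pM.
    have q2 : `|a * g1| <= B * (2 * B * s) by rewrite normrM ler_pM.
    have q3 : t ^+ 2 * `|a * g1| <= t ^+ 2 * (B * (2 * B * s)) by rewrite ler_wpM2l.
    rewrite -/s in e2B.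
    have -> : t ^+ 2 * s * (2 * B + 4 * B ^+ 2) = B * t ^+ 2 * s +
      B * t ^+ 2 * ((1 + 2 * B) * s) + t ^+ 2 * (B * (2 * B * s)) by ring.
    by rewrite lerD// lerD.
  rewrite normrM (gtr0_norm x0) in xe3.
  have : 2^-1 * `|e3| <= x * `|e3| by rewrite ler_wpM2r.
  move=> /le_trans /(_ xe3); rewrite mulrC ler_pdivrMr ?ltr0n//.
  move=> /le_trans; apply; rewrite DE.
  rewrite le_eqVlt; apply/orP; left; apply/eqP; ring.
have -> : n ^+ 2 - (g ^+ 2 + 2 * t * g * (b - g * a)) =
    t ^+ 2 * g1 ^+ 2 + 2 * ((g + t * g1) * e3) + e3 ^+ 2.
  by rewrite /e3 /g1; ring.
have Ds0 : 0 <= D * t ^+ 2 * s by rewrite mulr_ge0// mulr_ge0.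
have p1 : t ^+ 2 * g1 ^+ 2 <= t ^+ 2 * (2 * B * s) ^+ 2.
  rewrite ler_wpM2l// -real_normK ?num_real// ler_pXn2r// ?nnegrE//.
  by rewrite !mulr_ge0.
have p2 : `|(g + t * g1) * e3| <= (1 + 2 * B) * s * (D * t ^+ 2 * s) by rewrite normrM ler_pM.
have p3 : e3 ^+ 2 <= t ^+ 2 * (D * s) ^+ 2.
  apply: (@le_trans _ _ ((D * t ^+ 2 * s) ^+ 2)).
    by rewrite -real_normK ?num_real// ler_pXn2r// ?nnegrE.
  have -> : (D * t ^+ 2 * s) ^+ 2 = t ^+ 2 * (t ^+ 2 * (D * s) ^+ 2) by ring.
  by rewrite ler_piMl// mulr_ge0// sqr_ge0.
have p0 : 0 <= t ^+ 2 * g1 ^+ 2 by rewrite mulr_ge0// sqr_ge0.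
have p4 : 0 <= e3 ^+ 2 := sqr_ge0 e3.
have ss : s ^+ 2 <= 2 * (1 + g ^+ 2).
  rewrite /s -(real_normK (num_real g)).
  by have := sqr_ge0 (1 - `|g|); rewrite !sqrrD sqrrN expr1n mulrN; lra.
apply: (@le_trans _ _ (t ^+ 2 * s ^+ 2 * (4 * B ^+ 2 + 2 * (1 + 2 * B) * D + D ^+ 2))).
  move: p2; rewrite ler_norml => /andP[p5 p6].
  have -> : t ^+ 2 * s ^+ 2 * (4 * B ^+ 2 + 2 * (1 + 2 * B) * D + D ^+ 2) =
    t ^+ 2 * (2 * B * s) ^+ 2 + 2 * ((1 + 2 * B) * s * (D * t ^+ 2 * s)) + t ^+ 2 * (D * s) ^+ 2.
    by ring.
  have q1 : 0 <= t ^+ 2 * (2 * B * s) ^+ 2 := le_trans p0 p1.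
  have q2 : 0 <= t ^+ 2 * (D * s) ^+ 2 := le_trans p4 p3.
  move: p0 p1 p3 p4 p5 p6 q1 q2.
  set A1 := t ^+ 2 * g1 ^+ 2; set A2 := e3 ^+ 2; set A3 := (g + t * g1) * e3.
  set A4 := t ^+ 2 * (2 * B * s) ^+ 2; set A5 := t ^+ 2 * (D * s) ^+ 2.
  set A6 := (1 + 2 * B) * s * _.
  by clearbody A1 A2 A3 A4 A5 A6; clear => *; rewrite ler_norml; apply/andP; split; lra.
have E0 : 0 <= 4 * B ^+ 2 + 2 * (1 + 2 * B) * D + D ^+ 2.
  by rewrite !addr_ge0 ?mulr_ge0 ?sqr_ge0 ?addr_ge0 ?mulr_ge0.
have -> : C * t ^+ 2 * (1 + g ^+ 2) = t ^+ 2 * (2 * (1 + g ^+ 2)) *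
   (4 * B ^+ 2 + 2 * (1 + 2 * B) * D + D ^+ 2) by rewrite CE; ring.
by rewrite ler_wpM2r// ler_wpM2l.
Qed.

Section PlanarFlow.
Context {R : realType}.
Variables (psi : heis R -> R) (rad K t : R).
Hypothesis W11 : C11_on_ball (planar_field psi) (planar_Dfield psi) rad K K K.
Hypothesis tK : `|t| * K <= 2^-1.
Variables (phi theta : plane R -> plane R).
Hypothesis phi_flow : flow_map (planar_field psi) t phi.
Hypothesis theta_flow : flow_map (planar_field psi) (- t) theta.

Let tK' : `|- t| * K <= 2^-1. Proof. by rewrite normrN. Qed.

Lemma planar_flow_norm v : `|v| <= rad - 1 -> `|phi v| <= `|v| + 2^-1.
Proof.
move=> vr; have h := flow_map_moves (@mean_value_ineq_plane R) W11 tK phi_flow vr.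
rewrite -(subrK v (phi v)) addrC; apply: le_trans (ler_normD _ _) _.
by rewrite lerD2l (le_trans h).
Qed.

Lemma planar_flow_inverse v : `|phi v| <= rad - 1 -> theta (phi v) = v.
Proof. exact: (flow_map_inverse (@mean_value_ineq_plane R) W11 tK phi_flow theta_flow). Qed.

Lemma planar_flow_differentiable v : `|v| <= rad - 2 -> differentiable phi v.
Proof.
exact: (flow_map_differentiable (@mean_value_ineq_plane R)
  (@quasilinear_differentiability_plane R) W11 tK phi_flow).
Qed.

Lemma planar_flow_lipschitz u v : `|u| <= rad - 1 -> `|v| <= rad - 1 ->
  `|phi u - phi v| <= 2 * `|u - v|.
Proof. exact: (flow_map_dist (@mean_value_ineq_plane R) W11 tK phi_flow). Qed.

End PlanarFlow.

Section EnergyDensity.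
Context {R : realType}.
Variables (psi : heis R -> R) (f : plane R -> R).
Hypothesis spsi : smooth psi.
Hypothesis sf : smooth f.
Variables (rad K t : R).
Hypothesis rad1 : 1 <= rad.
Hypothesis W11 : C11_on_ball (planar_field psi) (planar_Dfield psi) rad K K K.
Hypothesis F11 : C11_on_ball (adapted_field psi) (adapted_Dfield psi) rad K K K.
Hypothesis tK : `|t| * (K * (1 + rad)) <= 2^-1.
Variables (Phi : heis R -> heis R) (phi theta : plane R -> plane R) (ft : plane R -> R).
Hypothesis Phi_flow : flow_map (adapted_field psi) t Phi.
Hypothesis phi_flow : flow_map (planar_field psi) t phi.
Hypothesis theta_flow : flow_map (planar_field psi) (- t) theta.
Hypothesis ft_graph : forall v, ft (Phi (v, f v)).1 = (Phi (v, f v)).2.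

Let tKw : `|t| * K <= 2^-1.
Proof. exact: (@tK_weak R psi rad K t rad1 F11 tK). Qed.

Let tKw' : `|- t| * K <= 2^-1. Proof. by rewrite normrN. Qed.
Let phi_flow' : flow_map (planar_field psi) (- - t) phi. Proof. by rewrite opprK. Qed.

Let mvp := @mean_value_ineq_plane R.
Let mvh := @mean_value_ineq_heis R.
Let qlp := @quasilinear_differentiability_plane R.
Let qlh := @quasilinear_differentiability_heis R.

Lemma phi_fst v : `|v| <= rad - 1 -> phi v = (Phi (v, f v)).1.
Proof. by move=> vr; rewrite (fst_flow_map rad1 W11 F11 tK Phi_flow phi_flow). Qed.

Lemma Phi_differentiable P : `|P| <= rad - 2 -> differentiable Phi P.
Proof. exact: (flow_map_differentiable mvh qlh F11 tKw Phi_flow). Qed.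

Let graph v : heis R := (v, f v).

Let graph_differentiable v : differentiable graph v.
Proof.
by apply: differentiable_pair; [exact: ex_diff|exact: smooth_differentiable].
Qed.

Lemma ft_phi v : `|v| <= rad - 1 -> ft (phi v) = (Phi (v, f v)).2.
Proof. by move=> vr; rewrite phi_fst. Qed.

(** Nothing is known of [ft] beyond its graph. Near [phi v] it coincides with the last coordinate of
    [Phi] applied to the graph of [f] over [theta], a composition of differentiable maps. *)
Lemma ft_differentiable v : `|v| <= rad - 4 -> `|f v| <= rad - 4 ->
  differentiable ft (phi v).
Proof.
move=> vr fvr.
have phir : `|phi v| <= rad - 2.
  by apply: le_trans (planar_flow_norm W11 tKw phi_flow _) _; lra.
have thv : theta (phi v) = v by apply: (planar_flow_inverse W11 tKw phi_flow theta_flow); lra.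
have dth := planar_flow_differentiable W11 tKw' theta_flow phir.
apply: (@near_eq_differentiable _ _ _ _ (snd \o (Phi \o (graph \o theta)))).
  have vr1 : `|theta (phi v)| < rad - 1 by rewrite thv; lra.
  apply: filterS (near_norm_le (differentiable_continuous dth) vr1) => w thw.
  by rewrite /= /graph -ft_phi// (planar_flow_inverse W11 tKw' theta_flow phi_flow').
apply: differentiable_comp; last exact: (@ex_diff _ _ _ _ _ _ _ (is_diff_snd _)).
apply: differentiable_comp.
  by apply: differentiable_comp => //; exact: graph_differentiable.
rewrite /= thv; apply: Phi_differentiable.
by apply: pair_norm_le => /=; lra.
Qed.

Let g := nabla f f.

Lemma diff_f_horizontal v : 'd f v (1, - f v) = g v.
Proof.
have df : differentiable f v by exact: smooth_differentiable.
by rewrite -deriveE// derive_planeE//= /g /nabla mul1r mulNr.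
Qed.

Let q v : heis R := 'd Phi (v, f v) ((1, - f v), g v).

Lemma diff_phi_horizontal v : `|v| <= rad - 4 -> `|f v| <= rad - 4 ->
  'd phi v (1, - f v) = (q v).1.
Proof.
move=> vr fvr.
have dphi : differentiable phi v by apply: (planar_flow_differentiable W11 tKw phi_flow); lra.
have dPhi : differentiable Phi (v, f v).
  by apply: Phi_differentiable; apply: pair_norm_le => /=; lra.
have dg := graph_differentiable v.
have dPg : differentiable (Phi \o graph) v by exact: differentiable_comp.
rewrite -deriveE//.
rewrite (@near_eq_derive _ _ _ _ (fst \o (Phi \o graph))); last first.
  have vr1 : `|v| < rad - 1 by lra.
  by apply: filterS (near_norm_le (@cvg_id _ (nbhs v)) vr1) => w wr; rewrite /= /graph -phi_fst.
have df1 := @ex_diff _ _ _ _ _ _ _ (is_diff_fst ((Phi \o graph) v)).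
rewrite deriveE; last exact: differentiable_comp.
rewrite diff_comp// (@diff_val _ _ _ _ _ _ _ (is_diff_fst _))/=.
rewrite diff_comp//= diff_pair//=; last exact: smooth_differentiable.
by rewrite diff_f_horizontal (@diff_val _ _ _ _ _ _ _ (is_diff_id v)).
Qed.

(** The composite of [ft] and [phi] is differentiated along (1, - f v). Invariance of the contact
    planes makes the image of this direction under ['d phi] a multiple of (1, - ft), so that only
    [nabla ft ft] is left of the gradient of [ft]. *)
Lemma nabla_ft v : `|v| <= rad - 4 -> `|f v| <= rad - 4 ->
  (q v).1.1 * nabla ft ft (phi v) = (q v).2.
Proof.
move=> vr fvr.
have dphi : differentiable phi v by apply: (planar_flow_differentiable W11 tKw phi_flow); lra.
have dPhi : differentiable Phi (v, f v).
  by apply: Phi_differentiable; apply: pair_norm_le => /=; lra.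
have dg := graph_differentiable v.
have dft := ft_differentiable vr fvr.
have dPg : differentiable (Phi \o graph) v by exact: differentiable_comp.
have ds := @ex_diff _ _ _ _ _ _ _ (is_diff_snd ((Phi \o graph) v)).
have E : 'd (ft \o phi) v (1, - f v) = (q v).2.
  rewrite -deriveE; last exact: differentiable_comp.
  rewrite (@near_eq_derive _ _ _ _ (snd \o (Phi \o graph))); last first.
    have vr1 : `|v| < rad - 1 by lra.
    by apply: filterS (near_norm_le (@cvg_id _ (nbhs v)) vr1) => w wr; rewrite /= /graph -ft_phi.
  rewrite deriveE; last exact: differentiable_comp.
  rewrite diff_comp// (@diff_val _ _ _ _ _ _ _ (is_diff_snd _))/=.
  rewrite diff_comp//= diff_pair//=; last exact: smooth_differentiable.
  by rewrite diff_f_horizontal (@diff_val _ _ _ _ _ _ _ (is_diff_id v)).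
have contact : (q v).1.2 + ft (phi v) * (q v).1.1 = 0.
  rewrite ft_phi; last by lra.
  have Pr : `|(v, f v)| <= rad - 2 by apply: pair_norm_le => /=; lra.
  have := diff_flow_map_contact spsi rad1 W11 F11 tK Phi_flow Pr.
  by move=> /(_ ((1, - f v), g v)); apply; rewrite /= mulr1 addNr.
rewrite -E diff_comp//= diff_phi_horizontal//.
have dftE (x : plane R) : 'd ft (phi v) x = x.1 * dx ft (phi v) + x.2 * dz ft (phi v).
  have xE : x = x.1 *: ((1, 0) : plane R) + x.2 *: ((0, 1) : plane R).
    by case: x => a b; congr pair; rewrite /= /GRing.scale/= ?mulr1 ?mulr0 ?addr0 ?add0r.
  by rewrite {1}xE linearD !linearZ/= -!deriveE.
rewrite dftE /nabla.
move: contact => /eqP; rewrite addr_eq0 => /eqP ->.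
by rewrite mulrBr mulNr; congr (_ - _); rewrite mulrCA mulrA.
Qed.

(** This and [horizontal_riccati] are the coefficients of [t] in the first and in the last
    coordinate of the transported tangent vector [q v]. *)
Definition horizontal_Ypsi0 v := 'D_((1, - f v) : plane R) (Ypsi0 psi) v.
Definition horizontal_riccati v :=
  'D_(((1, - f v), nabla f f v) : heis R) (riccati psi) (v, f v).

Let horizontal_vector_norm v : `|v| <= rad - 4 -> `|f v| <= rad - 4 ->
  `|((1, - f v) : plane R)| <= 1 + rad /\
  `|(((1, - f v), g v) : heis R)| <= (1 + rad) * (1 + `|g v|).
Proof.
move=> vr fvr.
have rad0 : 0 <= 1 + rad by rewrite addr_ge0// (le_trans ler01).
have u1 : `|((1, - f v) : plane R)| <= 1 + rad.
  apply: pair_norm_le; first by rewrite normr1 lerDl (le_trans ler01 rad1).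
  by rewrite normrN (le_trans fvr)//; lra.
split => //; apply: pair_norm_le => /=.
  by apply: le_trans u1 _; rewrite ler_peMr// lerDl.
apply: (@le_trans _ _ (1 + `|g v|)); first by rewrite lerDr.
by rewrite ler_peMl ?addr_ge0// lerDl (le_trans ler01 rad1).
Qed.

Lemma horizontal_bounds v (B : R) : `|v| <= rad - 4 -> `|f v| <= rad - 4 ->
  K * (1 + rad) <= B ->
  `|horizontal_Ypsi0 v| <= B /\ `|horizontal_riccati v| <= B * (1 + `|g v|).
Proof.
move=> vr fvr KB; have [u1 u'1] := horizontal_vector_norm vr fvr.
have K0 : 0 <= K := C11_M_ge0 F11.
have vr1 : `|v| <= rad by lra.
have Pr1 : `|(v, f v)| <= rad by apply: pair_norm_le => /=; lra.
split.
  have := C11_Dbound W11 (1, - f v) vr1 => h.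
  apply: le_trans (le_trans (norm_fst_le _) h) _.
  by apply: le_trans KB; rewrite ler_wpM2l.
have := C11_Dbound F11 ((1, - f v), g v) Pr1 => h.
apply: le_trans (le_trans (norm_snd_le _) h) _.
apply: (@le_trans _ _ (K * ((1 + rad) * (1 + `|g v|)))); first by rewrite ler_wpM2l.
by rewrite mulrA ler_wpM2r// addr_ge0.
Qed.

(** In [B], one K serves the first order coefficients and 4 K + 4 K^2 the remainder of
    [diff_flow_map], while 1 + rad bounds the tangent vector up to the factor 1 + |g|. With |t| B <=
    1/4 the first coordinate of [q v] is at least 1 - 1/4 - 1/4, so the quotient is harmless. *)
Lemma energy_density_expansion v (B D C : R) : `|v| <= rad - 4 -> `|f v| <= rad - 4 ->
  `|t| <= 1 -> `|t| * B <= 4^-1 -> B = (5 * K + 4 * K ^+ 2) * (1 + rad) ->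
  D = 4 * B + 8 * B ^+ 2 -> C = 2 * (4 * B ^+ 2 + 2 * (1 + 2 * B) * D + D ^+ 2) ->
  `|nabla ft ft (phi v) ^+ 2 -
     (g v ^+ 2 + 2 * t * g v * (horizontal_riccati v - g v * horizontal_Ypsi0 v))|
  <= C * t ^+ 2 * (1 + g v ^+ 2).
Proof.
move=> vr fvr t1 tB BE DE CE.
have K0 : 0 <= K := C11_M_ge0 F11.
have K20 : 0 <= 4 * K + 4 * K ^+ 2 by rewrite addr_ge0// mulr_ge0// sqr_ge0.
have rad0 : 0 <= 1 + rad by rewrite addr_ge0// (le_trans ler01).
pose u : plane R := (1, - f v); pose u' : heis R := (u, g v).
have [u1 u'1] := horizontal_vector_norm vr fvr.
have T0 : 0 <= t ^+ 2 := sqr_ge0 t.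
have KB : K * (1 + rad) <= B.
  rewrite BE ler_wpM2r//; have := sqr_ge0 K; lra.
have KB' : (4 * K + 4 * K ^+ 2) * (1 + rad) <= B by rewrite BE ler_wpM2r//; lra.
have B0 : 0 <= B by apply: le_trans KB; rewrite mulr_ge0.
have vr2 : `|v| <= rad - 2 by lra.
have Pr2 : `|(v, f v)| <= rad - 2 by apply: pair_norm_le => /=; lra.
have est1 : `|(q v).1.1 - 1 - t * horizontal_Ypsi0 v| <= B * t ^+ 2.
  have := diff_flow_map mvp qlp W11 tKw phi_flow u vr2.
  rewrite diff_phi_horizontal// => h; apply: le_trans (le_trans (norm_fst_le _) h) _.
  rewrite real_normK ?num_real// mulrAC ler_wpM2r//.
  by apply: le_trans KB'; rewrite ler_wpM2l.
have est2 : `|(q v).2 - g v - t * horizontal_riccati v| <= B * t ^+ 2 * (1 + `|g v|).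
  have := diff_flow_map mvh qlh F11 tKw Phi_flow u' Pr2 => h.
  apply: le_trans (le_trans (norm_snd_le _) h) _.
  rewrite real_normK ?num_real//.
  apply: (@le_trans _ _ ((4 * K + 4 * K ^+ 2) * t ^+ 2 * ((1 + rad) * (1 + `|g v|)))).
    by rewrite ler_wpM2l// mulr_ge0.
  rewrite mulrA ler_wpM2r ?addr_ge0// mulrAC ler_wpM2r//.
have [aB bB] := horizontal_bounds vr fvr KB.
have x2 : 2^-1 <= (q v).1.1.
  have ta : `|t * horizontal_Ypsi0 v| <= 4^-1.
    by rewrite normrM; apply: le_trans tB; rewrite ler_wpM2l.
  have : B * t ^+ 2 <= 4^-1.
    apply: le_trans tB; rewrite mulrC ler_wpM2r// -real_normK ?num_real//.
    by rewrite expr2 ler_piMr.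
  move=> /(le_trans est1); move: ta; rewrite !ler_norml => /andP[p1 _] /andP[p2 _].
  have alg (w z : R) : - 4^-1 <= w -> - 4^-1 <= z - 1 - w -> 2^-1 <= z by lra.
  exact: alg p1 p2.
have e1E : (q v).1.1 = 1 + t * horizontal_Ypsi0 v + ((q v).1.1 - 1 - t * horizontal_Ypsi0 v) by ring.
have e2E : (q v).2 = g v + t * horizontal_riccati v + ((q v).2 - g v - t * horizontal_riccati v)
  by ring.
exact: (square_quotient_expansion e1E e2E (nabla_ft vr fvr) t1 x2 aB bB est1 est2 DE CE).
Qed.

End EnergyDensity.

(** * Identification of the first order coefficient *)

Section NablaDerivation.
Context {R : realType}.
Implicit Types (f h k : plane R -> R) (v : plane R).

Lemma dxB f h v : smooth f -> smooth h -> dx (fun u => f u - h u) v = dx f v - dx h v.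
Proof. by move=> sf sh; apply: deriveB; exact: smooth_derivable. Qed.

Lemma dzB f h v : smooth f -> smooth h -> dz (fun u => f u - h u) v = dz f v - dz h v.
Proof. by move=> sf sh; apply: deriveB; exact: smooth_derivable. Qed.

Lemma nablaD f h k v : smooth h -> smooth k ->
  nabla f (fun u => h u + k u) v = nabla f h v + nabla f k v.
Proof.
move=> sh sk; rewrite /nabla dxD// dzD//.
by rewrite mulrDr opprD addrACA.
Qed.

Lemma nablaM f h k v : smooth h -> smooth k ->
  nabla f (fun u => h u * k u) v = h v * nabla f k v + k v * nabla f h v.
Proof.
move=> sh sk; rewrite /nabla dxM// dzM//.
have alg (F H K hx hz kx kz : R) : H * kx + K * hx - F * (H * kz + K * hz) =
  H * (kx - F * kz) + K * (hx - F * hz) by ring.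
exact: alg.
Qed.

(** The derivatives of the coefficient [f] recombine into [nabla f f], the only derivative of [f] in
    the result. *)
Lemma nabla_nabla f h v : smooth f -> smooth h -> nabla f (nabla f h) v =
  dx (dx h) v - f v * dx (dz h) v - nabla f f v * dz h v
    - f v * (dz (dx h) v - f v * dz (dz h) v).
Proof.
move=> sf sh; have sx := smooth_dx sh; have sz := smooth_dz sh.
have sfz := smoothM sf sz.
rewrite {1}/nabla dxB// dzB// dxM// dzM// /nabla.
have alg (F fx fz hz xx xz zx zz : R) :
  xx - (F * xz + hz * fx) - F * (zx - (F * zz + hz * fz)) =
  xx - F * xz - (fx - F * fz) * hz - F * (zx - F * zz) by ring.
exact: alg.
Qed.

End NablaDerivation.

Section FirstVariation.
Context {R : realType}.
Variables (psi : heis R -> R) (f : plane R -> R).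
Hypothesis spsi : smooth psi.
Hypothesis sf : smooth f.

Let sal := smooth_psi0 spsi.
Let sbe := smooth_Ypsi0 spsi.
Let g := nabla f f.

Lemma w1E : w1 psi = Ypsi0 psi.
Proof. by apply/funext => v; rewrite /w1 planeW_psi0. Qed.

Lemma w2E : w2 psi f = (fun v => Ypsi0 psi v * f v + psi0 psi v).
Proof. by apply/funext => v; rewrite /w2 planeW_psi0. Qed.

Lemma nabla_w2 :
  nabla f (w2 psi f) = fun v => Ypsi0 psi v * g v + f v * nabla f (Ypsi0 psi) v + nabla f (psi0 psi) v.
Proof.
apply/funext => v; rewrite w2E nablaD//; last exact: smoothM.
by rewrite nablaM.
Qed.

Lemma horizontal_Ypsi0E v : horizontal_Ypsi0 psi f v = dx (Ypsi0 psi) v - f v * dz (Ypsi0 psi) v.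
Proof. by rewrite /horizontal_Ypsi0 derive_planeE//= mul1r mulNr. Qed.

(** The shape of [riccati] with arbitrary coefficients: the planar part of the direction acts as dx
    - F dz on them, and [G] differentiates the explicit powers of the fiber coordinate. *)
Lemma derive_quadratic_fiber (a c b d : plane R -> R) (v : plane R) (F G : R) :
  smooth a -> smooth c -> smooth b -> smooth d ->
  'D_(((1, - F), G) : heis R)
    (fun P : heis R => - (a P.1 - P.2 * c P.1 + P.2 * (b P.1 - P.2 * d P.1))) (v, F) =
  - ((dx a v - F * dz a v) + F * (dx b v - F * dz b v) - F * (dx c v - F * dz c v)
     - F ^+ 2 * (dx d v - F * dz d v)) - G * (b v - c v - 2 * F * d v).
Proof.
move=> sa0 sc0 sb0 sd0.
pose p : heis R := (v, F); pose u : heis R := ((1, - F), G).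
pose y : heis R -> R := snd.
have sy : smooth y := smooth_linear (@continuous_snd _ _ _).
have sa := smooth_comp_fst sa0; have sc := smooth_comp_fst sc0.
have sb := smooth_comp_fst sb0; have sd := smooth_comp_fst sd0.
have dy : 'D_u y p = G by have [_ ->] := is_derive_snd (is_derive_id p u).
have s1 := smoothM sy sc; have s2 := smoothM sy sd.
have s3 := smoothB sb s2; have s4 := smoothM sy s3; have s5 := smoothB sa s1.
have s6 := smoothD s5 s4.
have dN (h : heis R -> R) : smooth h -> 'D_u (fun P => - h P) p = - 'D_u h p.
  by move=> sh; apply: deriveN; exact: smooth_derivable.
have dD (h k : heis R -> R) : smooth h -> smooth k ->
    'D_u (fun P => h P + k P) p = 'D_u h p + 'D_u k p.
  by move=> sh sk; apply: deriveD; exact: smooth_derivable.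
have dB (h k : heis R -> R) : smooth h -> smooth k ->
    'D_u (fun P => h P - k P) p = 'D_u h p - 'D_u k p.
  by move=> sh sk; apply: deriveB; exact: smooth_derivable.
have dM (h k : heis R -> R) : smooth h -> smooth k ->
    'D_u (fun P => h P * k P) p = h p * 'D_u k p + k p * 'D_u h p.
  by move=> sh sk; rewrite [LHS]deriveM//; exact: smooth_derivable.
rewrite (dN _ s6) (dD _ _ s5 s4) (dB _ _ sa s1) (dM _ _ sy s3) (dB _ _ sb s2)
  (dM _ _ sy sc) (dM _ _ sy sd) dy !derive_comp_fst.
have dh h : smooth h -> 'D_(u.1) h p.1 = dx h v - F * dz h v.
  by move=> sh; rewrite derive_planeE//= mul1r mulNr.
rewrite !dh// /y /=.
have alg (a1 a2 a3 a4 b1 b2 b3 b4 c1 c2 c3 : R) :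
  - (a1 - F * a2 - (F * (a3 - F * a4) + c1 * G) +
     (F * (b1 - F * b2 - (F * (b3 - F * b4) + c3 * G)) + (c2 - F * c3) * G)) =
  - (a1 - F * a2 + F * (b1 - F * b2) - F * (a3 - F * a4) - F ^+ 2 * (b3 - F * b4))
  - G * (c2 - c1 - 2 * F * c3) by ring.
exact: alg.
Qed.

Lemma horizontal_riccatiE v : horizontal_riccati psi f v =
  - ((dx (dx (psi0 psi)) v - f v * dz (dx (psi0 psi)) v)
     + f v * (dx (dx (Ypsi0 psi)) v - f v * dz (dx (Ypsi0 psi)) v)
     - f v * (dx (dz (psi0 psi)) v - f v * dz (dz (psi0 psi)) v)
     - f v ^+ 2 * (dx (dz (Ypsi0 psi)) v - f v * dz (dz (Ypsi0 psi)) v))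
  - g v * (dx (Ypsi0 psi) v - dz (psi0 psi) v - 2 * f v * dz (Ypsi0 psi) v).
Proof.
exact: (derive_quadratic_fiber v (f v) (nabla f f v) (smooth_dx sal) (smooth_dz sal)
  (smooth_dx sbe) (smooth_dz sbe)).
Qed.

(** Bridge between the flow and the stated integrands: the coefficient of [t] in [nabla ft ft] at
    [phi v] is w1 nabla^2 f - nabla^2 w2. Both sides are expanded to second derivatives of [psi0]
    and [Ypsi0], where they agree. *)
Lemma nabla2_w2 v : iter 2 (nabla f) (w2 psi f) v =
  Ypsi0 psi v * iter 2 (nabla f) f v
  - (horizontal_riccati psi f v - g v * horizontal_Ypsi0 psi f v).
Proof.
rewrite /= nabla_w2 horizontal_riccatiE horizontal_Ypsi0E.
have sg : smooth g by exact: smooth_nabla.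
have snb : smooth (nabla f (Ypsi0 psi)) by exact: smooth_nabla.
have sna : smooth (nabla f (psi0 psi)) by exact: smooth_nabla.
have s1 := smoothM sbe sg; have s2 := smoothM sf snb; have s3 := smoothD s1 s2.
rewrite (nablaD _ _ s3 sna) (nablaD _ _ s1 s2) (nablaM _ _ sbe sg) (nablaM _ _ sf snb).
rewrite (nabla_nabla _ sf sbe) (nabla_nabla _ sf sal).
have alg (B F G H a1 a2 a3 a4 b1 b2 b3 b4 c1 c2 c3 : R) :
  B * H + G * (c2 - F * c3) +
  (F * (b1 - F * b3 - G * c3 - F * (b2 - F * b4)) + (c2 - F * c3) * G) +
  (a1 - F * a3 - G * c1 - F * (a2 - F * a4)) =
  B * H - (- (a1 - F * a2 + F * (b1 - F * b2) - F * (a3 - F * a4) - F ^+ 2 * (b3 - F * b4))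
  - G * (c2 - c1 - 2 * F * c3) - G * (c2 - F * c3)) by ring.
exact: alg.
Qed.

(** In the sum the terms in nabla^2 f cancel by [nabla2_w2], and dz (f w1) cancels against the same
    term inside [dz w2]. The divergence of W remains. *)
Lemma variation_integrand v :
  (w1 psi v * iter 2 (nabla f) f v * g v
     + 2^-1 * g v ^+ 2 * (dx (w1 psi) v - dz (fun u => f u * w1 psi u) v))
  + (- iter 2 (nabla f) (w2 psi f) v * g v + 2^-1 * g v ^+ 2 * dz (w2 psi f) v)
  = g v * (horizontal_riccati psi f v - g v * horizontal_Ypsi0 psi f v)
    + 2^-1 * g v ^+ 2 * (dx (Ypsi0 psi) v + dz (psi0 psi) v).
Proof.
rewrite nabla2_w2 w1E w2E dzD//; last exact: smoothM.
rewrite !dzM//.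
set a1 := dx (Ypsi0 psi) v; set a2 := dz (psi0 psi) v; set a3 := dz (Ypsi0 psi) v.
set b := horizontal_riccati _ _ _; set c := horizontal_Ypsi0 _ _ _; set G := g v; set h := iter _ _ _ _.
clearbody a1 a2 a3 b c G h; ring.
Qed.

End FirstVariation.

(** * Integrals over the image of the planar flow *)

Section Transport.
Context {R : realType}.
Let mR := measurableTypeR R.
Let mplane := (mR * mR)%type.
Variables (psi : heis R -> R).
Hypothesis spsi : smooth psi.
Variables (rad K t : R).
Hypothesis W11 : C11_on_ball (planar_field psi) (planar_Dfield psi) rad K K K.
Hypothesis t1 : `|t| <= 1.
Hypothesis tK : `|t| * K <= 2^-1.
Variables (phi theta : plane R -> plane R).
Hypothesis phi_flow : flow_map (planar_field psi) t phi.
Hypothesis theta_flow : flow_map (planar_field psi) (- t) theta.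
Variable A : set (plane R).
Hypothesis oA : open A.
Hypothesis Arad : forall v, A v -> `|v| <= rad - 3.

Let tK' : `|- t| * K <= 2^-1. Proof. by rewrite normrN. Qed.
Let phi_flow' : flow_map (planar_field psi) (- - t) phi. Proof. by rewrite opprK. Qed.

Let mvp := @mean_value_ineq_plane R.

(** The image becomes a preimage under the inverse flow, from which openness is read off. *)
Lemma planar_flow_image : phi @` A = [set w | `|w| < rad - 2 /\ A (theta w)].
Proof.
apply/seteqP; split => [_ [v Av <-]|w [wr Aw]] /=.
  have vr := Arad Av.
  have pv : `|phi v| < rad - 2.
    apply: (@le_lt_trans _ _ (`|v| + 2^-1)); last by lra.
    by apply: (planar_flow_norm W11 tK phi_flow); lra.
  split => //; rewrite (planar_flow_inverse W11 tK phi_flow theta_flow)//; lra.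
exists (theta w) => //.
by apply: (planar_flow_inverse W11 tK' theta_flow phi_flow'); have := Arad Aw; lra.
Qed.

Lemma open_planar_flow_image : open (phi @` A).
Proof.
rewrite planar_flow_image openE => w [wr Aw].
have dth : differentiable theta w.
  by apply: (planar_flow_differentiable W11 tK' theta_flow); exact: ltW.
have n1 : \forall x \near w, `|x| < rad - 2.
  exact: (@cvgr_norm_lt R _ _ (nbhs w) _ id w (@cvg_id _ _) _ wr).
have n2 : \forall x \near w, A (theta x).
  have nA : nbhs (theta w) A by exact: open_nbhs_nbhs.
  have cth : {for w, continuous theta} by exact: differentiable_continuous.
  by apply: cth.
by apply: filterS2 n1 n2.
Qed.

Lemma mu_plane_bounded (B : set mplane) (r : R) : measurable B ->
  (forall v, B v -> `|v : plane R| <= r) -> (mu_plane B < +oo)%E.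
Proof.
move=> mB Br; have [r0|r0] := ltP r 0.
  have -> : B = set0.
    by apply/seteqP; split => // v /Br; rewrite leNgt (lt_le_trans r0).
  by rewrite measure0.
pose S : set mplane := `[- r, r] `*` `[- r, r].
have sub : B `<=` S.
  move=> [x z] /Br; rewrite prod_normE/= ge_max !ler_norml => /andP[h1 h2].
  by split; rewrite /= in_itv.
have mS : measurable S by apply: measurableX; exact: measurable_itv.
have rr : - r <= r by lra.
have muS : mu_plane S = ((r - - r) * (r - - r))%:E := mu_plane_box rr rr.
have muSy : (mu_plane S < +oo)%E by rewrite muS ltry.
exact: le_lt_trans (le_measure mu_plane (mem_set mB) (mem_set mS) sub) muSy.
Qed.

Definition divergence v := dx (Ypsi0 psi) v + dz (psi0 psi) v.

Lemma planar_Dfield_bound v (u : plane R) : `|v| <= rad -> `|u| <= 1 ->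
  `|'D_u (Ypsi0 psi) v| <= K /\ `|'D_u (psi0 psi) v| <= K.
Proof.
move=> vr u1; have h := C11_Dbound W11 u vr.
have {}h : `|planar_Dfield psi v u| <= K.
  by apply: le_trans h _; rewrite ler_piMr// (C11_L_ge0 W11).
split; apply: le_trans h; first exact: (norm_fst_le (planar_Dfield psi v u)).
exact: (norm_snd_le (planar_Dfield psi v u)).
Qed.

(** The points that [theta] sends into the square around [v] are images under [phi] of that square,
    and [flow_map_linearized] puts them in the situation of [image_square_bound], with the
    derivatives of the field at [v] as matrix and 4 K + 4 K^2 as remainder constant. The trace of
    the matrix is the divergence. *)
Lemma transport_integral_le (k : plane R -> R) (B L D C C' : R) :
  D = 2 * K ^+ 2 + 2 * (4 * K + 4 * K ^+ 2) -> C = K ^+ 2 + 3 * D + 2 * D ^+ 2 ->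
  C' = C + 2 * K ^+ 2 * (2 + 2 * C) ->
  measurable_fun (A : set mplane) (k : mplane -> mR) ->
  (forall v, A v -> 0 <= k v <= B) -> 0 <= L ->
  (forall u v, A u -> A v -> `|k u - k v| <= L * `|u - v|) ->
  (\int[mu_plane]_(w in phi @` A) (k (theta w))%:E
   <= \int[mu_plane]_(v in A) (k v * (1 + t * divergence v + C' * t ^+ 2))%:E)%E.
Proof.
move=> DE CE C'E mk kB L0 klip.
have K0 : 0 <= K := C11_M_ge0 W11.
have K20 : 0 <= 4 * K + 4 * K ^+ 2 by rewrite addr_ge0// mulr_ge0// sqr_ge0.
have D0 : 0 <= D by rewrite DE addr_ge0// mulr_ge0// sqr_ge0.
have C0 : 0 <= C by rewrite CE !addr_ge0// ?mulr_ge0 ?sqr_ge0.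
have C'0 : 0 <= C' by rewrite C'E addr_ge0// mulr_ge0 ?mulr_ge0 ?sqr_ge0// addr_ge0// mulr_ge0.
pose O := phi @` A; have oO : open O := open_planar_flow_image.
have mO : measurable (O : set mplane) := open_measurable_plane oO.
have mA : measurable (A : set mplane) := open_measurable_plane oA.
(* Differentiability of [theta] is available on [O] only; the value 0 elsewhere makes the map
   measurable on the whole plane. *)
pose th (w : plane R) : plane R := if `[< O w >] then theta w else 0.
have thE w : O w -> th w = theta w by move=> /asboolP; rewrite /th => ->.
have e1n : `|((1, 0) : plane R)| <= 1 by apply: pair_norm_le; rewrite /= ?normr1 ?normr0.
have e2n : `|((0, 1) : plane R)| <= 1 by apply: pair_norm_le; rewrite /= ?normr1 ?normr0.
have AO w : O w -> A (theta w) by rewrite /O planar_flow_image => -[].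
have AO1 w : O w -> `|theta w| <= rad - 1.
  by move=> /AO /Arad /le_trans; apply; rewrite lerD2l lerN2 ler1n.
have dO w : O w -> differentiable theta w.
  rewrite /O planar_flow_image => -[wr _].
  by apply: (planar_flow_differentiable W11 tK' theta_flow); exact: ltW.
have mth : measurable_fun (setT : set mplane) (th : mplane -> mplane).
  have aux (p : plane R -> R) : continuous p -> p 0 = 0 ->
      measurable_fun (setT : set mplane) ((p \o th) : mplane -> mR).
    move=> cp p0; rewrite (_ : p \o th = (p \o theta) \_ O); last first.
      apply/funext => w; rewrite patchE /th /=; case: ifPn => [|].
        by move=> /asboolP Ow; rewrite mem_set.
      by move=> /asboolP Ow; rewrite memNset.
    apply/(measurable_restrictT _ mO).
    apply: continuous_on_measurable_plane => // w Ow.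
    apply: continuous_comp; first exact/differentiable_continuous/dO.
    exact: cp.
  apply/measurable_fun_pairP; split.
    by apply: aux => //; exact: continuous_fst.
  by apply: aux => //; exact: continuous_snd.
rewrite (_ : (\int[mu_plane]_(w in O) (k (theta w))%:E)%E =
   (\int[mu_plane]_(w in O) (k (th w))%:E)%E); last first.
  by apply: eq_integral => w; rewrite inE => Ow; rewrite thE.
have divb v : A v -> `|t * divergence v| <= 1.
  move=> /Arad vr.
  have vr' : `|v| <= rad by lra.
  have [b1 _] := planar_Dfield_bound vr' e1n; have [_ b2] := planar_Dfield_bound vr' e2n.
  have : `|divergence v| <= K + K by apply: le_trans (ler_normD _ _) _; exact: lerD.
  move=> /(ler_wpM2l (normr_ge0 t)); rewrite -normrM => /le_trans; apply.
  by rewrite mulrDr; move: tK; lra.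
pose rho v := 1 + t * divergence v + C' * t ^+ 2.
have T0 : 0 <= C' * t ^+ 2 by rewrite mulr_ge0// sqr_ge0.
apply: (@integral_image_le_mu_plane R A O th k rho B (2 + C' * t ^+ 2) L C' 1) => //.
- by apply: (mu_plane_bounded mA) => v /Arad; exact.
- by move=> w Ow; rewrite thE//; exact: AO.
- apply: continuous_measurable_plane => //.
  apply: smooth_continuous; apply: smoothD; last exact: smooth_cst.
  apply: smoothD; first exact: smooth_cst.
  apply: smoothM; first exact: smooth_cst.
  by apply: smoothD; [apply: smooth_dx; exact: smooth_Ypsi0|apply: smooth_dz; exact: smooth_psi0].
- move=> v /divb; rewrite ler_norml /rho => /andP[h1 h2].
  by rewrite addr_ge0//=; [lra|lra].
- move=> v r Av /andP[r0 r1].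
  pose S : set mplane := [set w | O w /\ square v r (th w)].
  have mS : measurable S.
    have := mth measurableT _ (measurable_square v r); rewrite setTI => h.
    exact: measurableI.
  have vr := Arad Av; have vr' : `|v| <= rad by lra.
  have [b11 b12] := planar_Dfield_bound vr' e1n; have [b21 b22] := planar_Dfield_bound vr' e2n.
  have -> : rho v + C' * r = 1 + t * (dx (Ypsi0 psi) v + dz (psi0 psi) v) + C' * t ^+ 2 + C' * r by [].
  apply: (image_square_bound (w0 := phi v) (D := D) (C := C) (C' := C') (K := 4 * K + 4 * K ^+ 2)
    r0 r1 t1 tK K20 b11 b21 b12 b22) => //.
  have ub (x : R) : 0 <= x -> x <= r -> (4 * K + 4 * K ^+ 2) * `|t| * (`|t| + x) * x
      <= (4 * K + 4 * K ^+ 2) * `|t| * (`|t| + r) * r.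
    move=> x0 xr; rewrite -2!(mulrA (_ * `|t|)) ler_wpM2l ?mulr_ge0// ler_pM// ?addr_ge0//.
    by rewrite lerD2l.
  move=> w [Ow]; rewrite thE// => /squareP ur.
  have thr := AO1 _ Ow.
  have vr1 : `|v| <= rad - 1 by apply: le_trans vr _; rewrite lerD2l lerN2 ler1n.
  have := flow_map_linearized mvp W11 tK phi_flow thr vr1.
  rewrite (planar_flow_inverse W11 tK' theta_flow phi_flow')//.
  set u := theta w - v in ur *.
  have {}ub := ub _ (normr_ge0 u) (ltW ur).
  have dE (h : plane R -> R) : smooth h ->
      'D_((1, 0) : plane R) h v * u.1 + 'D_((0, 1) : plane R) h v * u.2 = 'D_u h v.
    by move=> sh; rewrite [RHS]derive_planeE// (mulrC u.1) (mulrC u.2).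
  move=> h; exists u; split => //; apply: le_trans ub; apply: le_trans h.
    by rewrite (dE _ (smooth_Ypsi0 spsi)); exact: (norm_fst_le (w - phi v - u - t *: planar_Dfield psi v u)).
  by rewrite (dE _ (smooth_psi0 spsi)); exact: (norm_snd_le (w - phi v - u - t *: planar_Dfield psi v u)).
Qed.

End Transport.

(** * Second order bounds for the integrands *)

Section IntegrandAlgebra.
Context {R : realFieldType}.

Lemma cross_term_bound (g g1 B : R) : 0 <= B -> `|g1| <= 2 * B * (1 + `|g|) ->
  `|g * g1| <= 3 * B * (1 + g ^+ 2).
Proof.
move=> B0 h; rewrite normrM -(real_normK (num_real g)).
set x := `|g| in h *; have x0 : 0 <= x by exact: normr_ge0.
apply: (@le_trans _ _ (x * (2 * B * (1 + x)))); first by rewrite ler_wpM2l.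
have -> : 3 * B * (1 + x ^+ 2) = x * (2 * B * (1 + x)) + B * ((1 - x) ^+ 2 + 2) by ring.
by rewrite lerDl mulr_ge0// addr_ge0// sqr_ge0.
Qed.

Lemma abs_bounds (x c : R) : `|x| <= c -> - c <= x /\ x <= c.
Proof. by rewrite ler_norml => /andP[]. Qed.

(** Density times Jacobian. The summands of [Cu] bound, in this order, the coefficients of t^2
    coming from g^2, from p d with p = g g1, from t p, and from the error of the density. *)
Lemma upper_integrand (t g g1 d B Cd C' Cu : R) : `|t| <= 1 -> 0 <= B ->
  `|g1| <= 2 * B * (1 + `|g|) -> `|d| <= B -> 0 <= Cd -> 0 <= C' ->
  Cu = C' + 6 * B ^+ 2 + 6 * (C' * B) + Cd * (1 + B + C') ->
  (g ^+ 2 + 2 * t * (g * g1) + Cd * t ^+ 2 * (1 + g ^+ 2)) * (1 + t * d + C' * t ^+ 2)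
  <= g ^+ 2 + 2 * t * (g * g1 + 2^-1 * g ^+ 2 * d) + Cu * t ^+ 2 * (1 + g ^+ 2).
Proof.
move=> t1 B0 /(cross_term_bound B0); set p := g * g1 => pB dB Cd0 C'0 CuE.
have T0 : 0 <= t ^+ 2 := sqr_ge0 t.
have T1 : t ^+ 2 <= 1 by rewrite -real_normK ?num_real// expr_le1.
have g20 := sqr_ge0 g; set G := 1 + g ^+ 2 in pB *.
have G0 : 0 <= G by rewrite addr_ge0.
have gG : g ^+ 2 <= G by rewrite lerDr.
have BG0 : 0 <= 3 * B * G by rewrite !mulr_ge0.
have pd : p * d <= 3 * B * G * B.
  by apply: le_trans (ler_norm _) _; rewrite normrM ler_pM.
have tp : t * p <= 3 * B * G.
  by apply: le_trans (ler_norm _) _; rewrite normrM -[leRHS]mul1r ler_pM.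
have td : t * d <= B.
  by apply: le_trans (ler_norm _) _; rewrite normrM -[leRHS]mul1r ler_pM.
have -> : (g ^+ 2 + 2 * t * p + Cd * t ^+ 2 * G) * (1 + t * d + C' * t ^+ 2) =
  g ^+ 2 + 2 * t * (p + 2^-1 * g ^+ 2 * d) + t ^+ 2 * (C' * g ^+ 2 + 2 * (p * d)
    + 2 * C' * (t * p) + Cd * G * (1 + t * d + C' * t ^+ 2)) by field.
have -> : Cu * t ^+ 2 * G = t ^+ 2 * (Cu * G) by ring.
rewrite lerD2l ler_wpM2l//.
rewrite CuE.
have -> : (C' + 6 * B ^+ 2 + 6 * (C' * B) + Cd * (1 + B + C')) * G =
  C' * G + 2 * (3 * B * G * B) + 2 * C' * (3 * B * G) + Cd * G * (1 + B + C') by ring.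
have q1 : C' * g ^+ 2 <= C' * G by rewrite ler_wpM2l.
have q2 : 2 * C' * (t * p) <= 2 * C' * (3 * B * G) by rewrite ler_wpM2l// mulr_ge0.
have q3 : Cd * G * (1 + t * d + C' * t ^+ 2) <= Cd * G * (1 + B + C').
  rewrite ler_wpM2l ?mulr_ge0// lerD//; first by rewrite lerD2l.
  by rewrite ler_piMr.
by rewrite lerD// lerD// lerD// ler_wpM2l.
Qed.

Lemma lower_integrand (t g g1 d B Cd C4 Cl : R) : `|t| <= 1 -> 0 <= B ->
  `|g1| <= 2 * B * (1 + `|g|) -> `|d| <= B -> 0 <= Cd -> 0 <= C4 ->
  Cl = 6 * B ^+ 2 + C4 + 6 * (C4 * B) + Cd * (1 + B) ->
  g ^+ 2 + 2 * t * (g * g1 + 2^-1 * g ^+ 2 * d) - Cl * t ^+ 2 * (1 + g ^+ 2) <=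
  (g ^+ 2 + 2 * t * (g * g1) - Cd * t ^+ 2 * (1 + g ^+ 2)) * (1 + t * d - C4 * t ^+ 2).
Proof.
move=> t1 B0 /(cross_term_bound B0); set p := g * g1 => pB dB Cd0 C40 ClE.
have T0 : 0 <= t ^+ 2 := sqr_ge0 t.
have g20 := sqr_ge0 g; set G := 1 + g ^+ 2 in pB *.
have G0 : 0 <= G by rewrite addr_ge0.
have gG : g ^+ 2 <= G by rewrite lerDr.
have BG0 : 0 <= 3 * B * G by rewrite !mulr_ge0.
have pd : - (p * d) <= 3 * B * G * B.
  by apply: le_trans (ler_norm _) _; rewrite normrN normrM ler_pM.
have tp : t * p <= 3 * B * G.
  by apply: le_trans (ler_norm _) _; rewrite normrM -[leRHS]mul1r ler_pM.
have td : t * d <= B.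
  by apply: le_trans (ler_norm _) _; rewrite normrM -[leRHS]mul1r ler_pM.
have -> : (g ^+ 2 + 2 * t * p - Cd * t ^+ 2 * G) * (1 + t * d - C4 * t ^+ 2) =
  g ^+ 2 + 2 * t * (p + 2^-1 * g ^+ 2 * d) - t ^+ 2 * (2 * (- (p * d)) + C4 * g ^+ 2
    + 2 * C4 * (t * p) + Cd * G * (1 + t * d - C4 * t ^+ 2)) by field.
have -> : Cl * t ^+ 2 * G = t ^+ 2 * (Cl * G) by ring.
rewrite lerD2l lerN2 ler_wpM2l// ClE.
have -> : (6 * B ^+ 2 + C4 + 6 * (C4 * B) + Cd * (1 + B)) * G =
  2 * (3 * B * G * B) + C4 * G + 2 * C4 * (3 * B * G) + Cd * G * (1 + B) by ring.
have q1 : C4 * g ^+ 2 <= C4 * G by rewrite ler_wpM2l.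
have q2 : 2 * C4 * (t * p) <= 2 * C4 * (3 * B * G) by rewrite ler_wpM2l// mulr_ge0.
have q3 : Cd * G * (1 + t * d - C4 * t ^+ 2) <= Cd * G * (1 + B).
  rewrite ler_wpM2l ?mulr_ge0//.
  by rewrite lerBlDr -addrA lerD2l (le_trans td)// lerDl mulr_ge0.
by rewrite lerD// lerD// lerD// ler_wpM2l.
Qed.

(** The weight 1 + t d - C4 t^2 stays below the reciprocal of the Jacobian bound of the inverse
    flow, whose divergence [d'] is taken at the image point. [C4] makes the bracket of t^2 at most -
    2 B^2, exactly enough to absorb t (d - d'). *)
Lemma jacobian_product_le1 (t d d' B C' C4 : R) : `|t| <= 1 -> `|t| * B <= 4^-1 ->
  `|d| <= B -> `|d'| <= B -> `|d - d'| <= 2 * B ^+ 2 * `|t| -> 0 <= C' ->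
  C4 = 4 * B ^+ 2 + 2 * C' -> `|t| * C4 <= 2^-1 ->
  0 <= 1 + t * d - C4 * t ^+ 2 /\
  (1 + t * d - C4 * t ^+ 2) * (1 - t * d' + C' * t ^+ 2) <= 1.
Proof.
move=> t1 tB dB d'B dd C'0 C4E tC4.
have B0 : 0 <= B by exact: le_trans dB.
have T0 : 0 <= t ^+ 2 := sqr_ge0 t.
have C40 : 0 <= C4 by rewrite C4E addr_ge0// mulr_ge0// sqr_ge0.
have tm (x : R) : `|x| <= B -> `|t * x| <= 4^-1.
  by move=> xB; apply: le_trans tB; rewrite normrM ler_wpM2l.
have [a1 a2] := abs_bounds (tm _ dB); have [b1 b2] := abs_bounds (tm _ d'B).
have TC4 : C4 * t ^+ 2 <= 2^-1.
  apply: le_trans tC4; rewrite mulrC ler_wpM2r// -real_normK ?num_real//.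
  by rewrite expr2 ler_piMr.
split; first by lra.
have -> : (1 + t * d - C4 * t ^+ 2) * (1 - t * d' + C' * t ^+ 2) =
  1 + t * (d - d') + t ^+ 2 * (- (d * d') + C' - C4 + C' * (t * d) + C4 * (t * d')
    - C4 * C' * t ^+ 2) by ring.
have e1 : t * (d - d') <= t ^+ 2 * (2 * B ^+ 2).
  apply: le_trans (ler_norm _) _; rewrite normrM.
  apply: (@le_trans _ _ (`|t| * (2 * B ^+ 2 * `|t|))); first by rewrite ler_wpM2l.
  by rewrite mulrCA -expr2 real_normK ?num_real// mulrC.
have e2 : - (d * d') <= B ^+ 2.
  by apply: le_trans (ler_norm _) _; rewrite normrN normrM expr2 ler_pM.
have e3 : C' * (t * d) <= C' * 4^-1 by rewrite ler_wpM2l.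
have e4 : C4 * (t * d') <= C4 * 4^-1 by rewrite ler_wpM2l.
have e5 : 0 <= C4 * C' * t ^+ 2 by rewrite mulr_ge0// mulr_ge0.
have e6 : - (d * d') + C' - C4 + C' * (t * d) + C4 * (t * d') - C4 * C' * t ^+ 2 <= - (2 * B ^+ 2).
  have B20 := sqr_ge0 B.
  move: e2 e3 e4 e5; set x1 := d * d'; set x2 := C' * (t * d); set x3 := C4 * (t * d').
  set x4 := _ * t ^+ 2; rewrite C4E; lra.
have e7 := ler_wpM2l T0 e6.
move: e1 e7; rewrite mulrN; set y1 := t * (d - d'); set y2 := t ^+ 2 * (2 * _); set y3 := t ^+ 2 * _; lra.
Qed.

End IntegrandAlgebra.

Section IntegralOn.
Context {R : realType}.
Let mR := measurableTypeR R.
Let mplane := (mR * mR)%type.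
Variables (U : set (plane R)) (r : R).
Hypothesis oU : open U.
Hypothesis Ur : forall v, U v -> `|v| <= r.

Let mU : measurable (U : set mplane) := open_measurable_plane oU.

Lemma mu_plane_lty : (mu_plane (U : set mplane) < +oo)%E.
Proof. exact: (mu_plane_bounded mU Ur). Qed.

Lemma continuous_bounded_plane (h : plane R -> R) (s : R) : continuous h ->
  exists2 K, 0 <= K & forall v, `|v| <= s -> `|h v| <= K.
Proof.
move=> ch; pose k (p : heis R) := h p.1.
have ck : continuous k.
  by move=> p; apply: continuous_comp; [exact: continuous_fst|exact: ch].
have [K K0 kK] := continuous_bounded_ball s ck.
exists K => // v vs; apply: (kK (v, 0)).
by apply: pair_norm_le => //=; rewrite normr0 (le_trans _ vs).
Qed.

Lemma integrable_continuous (h : plane R -> R) : continuous h ->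
  mu_plane.-integrable (U : set mplane) (EFin \o (h : mplane -> R)).
Proof.
move=> ch; apply: measurable_bounded_integrable => //.
- exact: mu_plane_lty.
- exact: continuous_measurable_plane.
have [K K0 hK] := continuous_bounded_plane r ch.
exists K; split; first exact: num_real.
by move=> x Kx v Uv; apply: le_trans (ltW Kx); apply: hK; exact: Ur.
Qed.

(** Real-valued, so that ordinary arithmetic applies; by [int_onE] nothing is lost for continuous
    integrands on a bounded open set. *)
Definition int_on (h : plane R -> R) : R := fine (\int[mu_plane]_(v in U) (h v)%:E)%E.

Lemma int_onE h : continuous h -> (\int[mu_plane]_(v in U) (h v)%:E)%E = (int_on h)%:E.
Proof. by move=> ch; rewrite /int_on fineK//; apply: integrable_fin_num => //; exact: integrable_continuous. Qed.

Lemma int_onD h k : continuous h -> continuous k ->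
  int_on (fun v => h v + k v) = int_on h + int_on k.
Proof.
move=> ch ck; apply: EFin_inj; rewrite EFinD -!int_onE//; last first.
  by move=> v; apply: cvgD; [exact: ch|exact: ck].
rewrite -integralD//; last 2 first.
- exact: integrable_continuous.
- exact: integrable_continuous.
Qed.

Lemma int_onZ (a : R) h : continuous h -> int_on (fun v => a * h v) = a * int_on h.
Proof.
move=> ch; apply: EFin_inj; rewrite EFinM -!int_onE//; last first.
  by move=> v; apply: cvgM; [exact: cvg_cst|exact: ch].
rewrite -integralZl//; last exact: integrable_continuous.
Qed.

Lemma int_on_cst (a : R) : int_on (fun _ => a) = a * fine (mu_plane (U : set mplane)).
Proof.
apply: EFin_inj; rewrite -int_onE; last by move=> v; exact: cvg_cst.
rewrite (integral_cst _ mU a%:E) EFinM fineK//.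
by rewrite ge0_fin_numE ?mu_plane_lty.
Qed.

Lemma int_on_le h k : continuous h -> continuous k ->
  (forall v, U v -> h v <= k v) -> int_on h <= int_on k.
Proof.
move=> ch ck hk; rewrite -lee_fin -!int_onE//.
apply: le_integral => //; [exact: integrable_continuous|exact: integrable_continuous|].
by move=> v; rewrite inE => /hk; rewrite lee_fin.
Qed.

End IntegralOn.

(** * Expansion of the energy *)

Section BoundedLipschitz.
Context {R : realType}.
Implicit Types (A : set (plane R)) (k l : plane R -> R).

Definition bounded_lipschitz A k := exists B L : R, [/\ 0 <= B, 0 <= L,
  forall u, A u -> `|k u| <= B & forall u v, A u -> A v -> `|k u - k v| <= L * `|u - v|].

Lemma bounded_lipschitz_smooth A k (r : R) : smooth k -> (forall v, A v -> `|v| <= r) ->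
  bounded_lipschitz A k.
Proof.
move=> sk Ar; have [K K0 KP] := smooth_C11_plane r sk.
exists K, K; split => // [u /Ar ur|u v /Ar ur /Ar vr]; first by have [] := KP _ _ ur ur.
by have [] := KP _ _ ur vr.
Qed.

Lemma bounded_lipschitzM A k l : bounded_lipschitz A k -> bounded_lipschitz A l ->
  bounded_lipschitz A (fun v => k v * l v).
Proof.
move=> [B [L [B0 L0 kB kL]]] [B' [L' [B'0 L'0 lB lL]]].
exists (B * B'), (B * L' + B' * L); split.
- by rewrite mulr_ge0.
- by rewrite addr_ge0// mulr_ge0.
- by move=> u Au; rewrite normrM ler_pM// ?kB ?lB.
move=> u v Au Av.
have -> : k u * l u - k v * l v = k u * (l u - l v) + l v * (k u - k v) by ring.
apply: le_trans (ler_normD _ _) _; rewrite !normrM mulrDl -!mulrA.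
by apply: lerD; apply: ler_pM => //; [exact: kB|exact: lL|exact: lB|exact: kL].
Qed.

(** The lower bound for the density may be negative, whereas the change of variables needs
    nonnegative weights. Through the norm, continuity and the Lipschitz bound are immediate. *)
Definition pos_part (x : R) := (x + `|x|) / 2.

Lemma pos_part_ge0 x : 0 <= pos_part x.
Proof. by rewrite divr_ge0// -[x]opprK normrN addrC subr_ge0 ler_norm. Qed.

Lemma le_pos_part x : x <= pos_part x.
Proof. by rewrite ler_pdivlMr// mulr_natr mulr2n lerD2l ler_norm. Qed.

Lemma pos_part_le x y : x <= y -> 0 <= y -> pos_part x <= y.
Proof.
move=> xy y0; rewrite ler_pdivrMr// mulr_natr mulr2n.
have [x0|x0] := leP 0 x; first by rewrite ger0_norm// lerD.
by rewrite ltr0_norm// subrr addr_ge0.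
Qed.

Lemma bounded_lipschitz_pos_part A k : bounded_lipschitz A k ->
  bounded_lipschitz A (fun v => pos_part (k v)).
Proof.
move=> [B [L [B0 L0 kB kL]]]; exists B, L; split => //.
  move=> u Au; rewrite ger0_norm ?pos_part_ge0//; apply: pos_part_le => //.
  exact: le_trans (ler_norm _) (kB u Au).
move=> u v Au Av; apply: le_trans (kL u v Au Av).
have -> : pos_part (k u) - pos_part (k v) = ((k u - k v) + (`|k u| - `|k v|)) / 2.
  by rewrite /pos_part; field.
rewrite normrM normfV (ger0_norm (ler0n R 2)) ler_pdivrMr// mulr_natr mulr2n.
by apply: le_trans (ler_normD _ _) _; rewrite lerD2l ler_dist_dist.
Qed.

Lemma bounded_lipschitz_comp A O (theta : plane R -> plane R) k (c : R) : 0 <= c ->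
  (forall w, O w -> A (theta w)) ->
  (forall u v, O u -> O v -> `|theta u - theta v| <= c * `|u - v|) ->
  bounded_lipschitz A k -> bounded_lipschitz O (k \o theta).
Proof.
move=> c0 OA thc [B [L [B0 L0 kB kL]]]; exists B, (L * c); split => //.
- by rewrite mulr_ge0.
- by move=> u Ou; apply: kB; exact: OA.
move=> u v Ou Ov; apply: le_trans (kL _ _ (OA _ Ou) (OA _ Ov)) _.
by rewrite -mulrA ler_wpM2l// thc.
Qed.

End BoundedLipschitz.

Ltac smoothness := repeat match goal with
  | H : smooth ?h |- smooth ?k => constr_eq h k; exact: H
  | |- smooth (fun _ => ?c) => exact: smooth_cst
  | |- smooth (nabla _ _) => apply: smooth_nabla
  | |- smooth (fun p => @?a p - @?b p) => apply: smoothB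
  | |- smooth (fun p => @?a p + @?b p) => apply: smoothD
  | |- smooth (fun p => @?a p * @?b p) => apply: smoothM
  end.

Section EnergyExpansion.
Context {R : realType}.
Let mR := measurableTypeR R.
Let mplane := (mR * mR)%type.
Variables (psi : heis R -> R) (f : plane R -> R).
Hypothesis spsi : smooth psi.
Hypothesis sf : smooth f.
Variables (rad K t : R).
Hypothesis rad1 : 1 <= rad.
Hypothesis W11 : C11_on_ball (planar_field psi) (planar_Dfield psi) rad K K K.
Hypothesis F11 : C11_on_ball (adapted_field psi) (adapted_Dfield psi) rad K K K.
Variables (Phi : heis R -> heis R) (phi theta : plane R -> plane R) (ft : plane R -> R).
Hypothesis Phi_flow : flow_map (adapted_field psi) t Phi.
Hypothesis phi_flow : flow_map (planar_field psi) t phi.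
Hypothesis theta_flow : flow_map (planar_field psi) (- t) theta.
Hypothesis ft_graph : forall v, ft (Phi (v, f v)).1 = (Phi (v, f v)).2.
Variable U : set (plane R).
Hypothesis oU : open U.
Hypothesis Ur : forall v, U v -> `|v| <= rad - 4.
Hypothesis fr : forall v, U v -> `|f v| <= rad - 4.
(** [B], [D], [Cd] belong to the density expansion, [D'], [C0'], [C'] to the Jacobian bound, [C4] to
    the weight that compensates the Jacobian of the inverse, [Cu] and [Cl] to the two integrand
    bounds. Given by equations, they remain atoms for the arithmetic. *)
Variables (B D Cd D' C0' C' C4 Cu Cl : R).
Hypothesis BE : B = (5 * K + 4 * K ^+ 2) * (1 + rad).
Hypothesis DE : D = 4 * B + 8 * B ^+ 2.
Hypothesis CdE : Cd = 2 * (4 * B ^+ 2 + 2 * (1 + 2 * B) * D + D ^+ 2).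
Hypothesis D'E : D' = 2 * K ^+ 2 + 2 * (4 * K + 4 * K ^+ 2).
Hypothesis C0'E : C0' = K ^+ 2 + 3 * D' + 2 * D' ^+ 2.
Hypothesis C'E : C' = C0' + 2 * K ^+ 2 * (2 + 2 * C0').
Hypothesis C4E : C4 = 4 * B ^+ 2 + 2 * C'.
Hypothesis CuE : Cu = C' + 6 * B ^+ 2 + 6 * (C' * B) + Cd * (1 + B + C').
Hypothesis ClE : Cl = 6 * B ^+ 2 + C4 + 6 * (C4 * B) + Cd * (1 + B).
Hypothesis t1 : `|t| <= 1.
Hypothesis tB : `|t| * B <= 4^-1.
Hypothesis tC4 : `|t| * C4 <= 2^-1.

Let g := nabla f f.
Let g1 v := Ypsi0 psi v * iter 2 (nabla f) f v - iter 2 (nabla f) (w2 psi f) v.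
Let d := divergence psi.
Let S v := g v * g1 v + 2^-1 * g v ^+ 2 * d v.
Let h w := nabla ft ft w ^+ 2.

Let K0 : 0 <= K. Proof. exact: (C11_M_ge0 F11). Qed.

Let KB : K * (1 + rad) <= B.
Proof.
have rad0 : 0 <= 1 + rad by rewrite addr_ge0// (le_trans ler01).
rewrite BE ler_wpM2r//; have := sqr_ge0 K; move: K0; lra.
Qed.

Let K2B : 2 * K <= B.
Proof.
apply: le_trans KB; rewrite mulrC ler_wpM2l//.
by rewrite -[2]/(1 + 1) lerD2l.
Qed.

Let B0 : 0 <= B. Proof. by apply: le_trans K2B; rewrite mulr_ge0. Qed.

Let Cd0 : 0 <= Cd.
Proof.
have D0 : 0 <= D by rewrite DE addr_ge0// mulr_ge0// sqr_ge0.
by rewrite CdE !(mulr_ge0, addr_ge0)// ?sqr_ge0// !(mulr_ge0, addr_ge0).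
Qed.

Let C'0 : 0 <= C'.
Proof.
have D'0 : 0 <= D' by rewrite D'E !(mulr_ge0, addr_ge0)// sqr_ge0.
have C0'0 : 0 <= C0' by rewrite C0'E !addr_ge0 ?mulr_ge0 ?sqr_ge0.
by rewrite C'E addr_ge0// mulr_ge0 ?mulr_ge0 ?sqr_ge0// addr_ge0// mulr_ge0.
Qed.

Let C40 : 0 <= C4.
Proof. by rewrite C4E addr_ge0// mulr_ge0// sqr_ge0. Qed.

Let tK1 : `|t| * (K * (1 + rad)) <= 2^-1.
Proof.
apply: (@le_trans _ _ (`|t| * B)); first by rewrite ler_wpM2l.
by apply: le_trans tB _; lra.
Qed.

Let tKw : `|t| * K <= 2^-1.
Proof. exact: (@tK_weak R psi rad K t rad1 F11 tK1). Qed.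

Let tKw' : `|- t| * K <= 2^-1. Proof. by rewrite normrN. Qed.
Let phi_flow' : flow_map (planar_field psi) (- - t) phi. Proof. by rewrite opprK. Qed.

Let sal := smooth_psi0 spsi.
Let sbe := smooth_Ypsi0 spsi.
Let sg : smooth g := smooth_nabla sf sf.
Let sw2 : smooth (w2 psi f).
Proof. by rewrite w2E; apply: smoothD => //; exact: smoothM. Qed.
Let sg1 : smooth g1.
Proof.
by rewrite /g1 /=; smoothness.
Qed.
Let sd : smooth d.
Proof. by apply: smoothD; [exact: smooth_dx|exact: smooth_dz]. Qed.
Let sgg : smooth (fun v => g v ^+ 2).
Proof.
rewrite (_ : (fun _ => _) = fun v => g v * g v); first exact: smoothM.
by apply/funext => v; rewrite expr2.
Qed.
Let sgg1 : smooth (fun v => g v * g1 v). Proof. by smoothness. Qed.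
Let sS : smooth S.
Proof.
by rewrite /S; smoothness.
Qed.

Lemma g1E v : g1 v = horizontal_riccati psi f v - g v * horizontal_Ypsi0 psi f v.
Proof. by rewrite /g1 nabla2_w2// opprB addrC subrK. Qed.

Lemma g1_bound v : U v -> `|g1 v| <= 2 * B * (1 + `|g v|).
Proof.
move=> Uv; rewrite g1E.
have [aB bB] := horizontal_bounds rad1 W11 F11 (Ur Uv) (fr Uv) KB.
apply: le_trans (ler_normB _ _) _; rewrite normrM.
have : `|g v| * `|horizontal_Ypsi0 psi f v| <= (1 + `|g v|) * B.
  by apply: ler_pM => //; rewrite lerDr.
move: bB; rewrite -/g; set x := `|horizontal_riccati _ _ _|; set y := _ * `|horizontal_Ypsi0 _ _ _|.
set z := 1 + `|g v|; move=> h1 h2.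
have -> : 2 * B * z = B * z + z * B by ring.
exact: lerD.
Qed.

Lemma divergence_bound v : `|v| <= rad -> `|d v| <= B.
Proof.
move=> vr.
have e1n : `|((1, 0) : plane R)| <= 1 by apply: pair_norm_le; rewrite /= ?normr1 ?normr0.
have e2n : `|((0, 1) : plane R)| <= 1 by apply: pair_norm_le; rewrite /= ?normr1 ?normr0.
have [b1 _] := planar_Dfield_bound W11 vr e1n; have [_ b2] := planar_Dfield_bound W11 vr e2n.
apply: le_trans (ler_normD _ _) _; apply: le_trans (lerD b1 b2) _.
by apply: le_trans K2B; rewrite mulr_natl mulr2n.
Qed.

Lemma divergence_lipschitz v w : `|v| <= rad -> `|w| <= rad ->
  `|d v - d w| <= 2 * K * `|v - w|.
Proof.
move=> vr wr.
have e1n : `|((1, 0) : plane R)| <= 1 by apply: pair_norm_le; rewrite /= ?normr1 ?normr0.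
have e2n : `|((0, 1) : plane R)| <= 1 by apply: pair_norm_le; rewrite /= ?normr1 ?normr0.
have e (u : plane R) : `|u| <= 1 ->
    `|planar_Dfield psi v u - planar_Dfield psi w u| <= K * `|v - w|.
  move=> u1; apply: le_trans (C11_Dlip W11 u vr wr) _.
  by rewrite ler_piMr// mulr_ge0.
have := le_trans (norm_fst_le _) (e _ e1n); have := le_trans (norm_snd_le _) (e _ e2n).
rewrite /= -/(dx (Ypsi0 psi) v) -/(dx (Ypsi0 psi) w) -/(dz (psi0 psi) v) -/(dz (psi0 psi) w) => h2 h1.
have -> : d v - d w = (dx (Ypsi0 psi) v - dx (Ypsi0 psi) w) + (dz (psi0 psi) v - dz (psi0 psi) w).
  by rewrite /d /divergence opprD addrACA.
apply: le_trans (ler_normD _ _) _; apply: le_trans (lerD h1 h2) _.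
by rewrite -mulrA mulr_natl mulr2n.
Qed.

Lemma density_expansion v : U v ->
  `|h (phi v) - (g v ^+ 2 + 2 * t * (g v * g1 v))| <= Cd * t ^+ 2 * (1 + g v ^+ 2).
Proof.
move=> Uv; rewrite g1E mulrA.
exact: (energy_density_expansion spsi sf rad1 W11 F11 tK1 Phi_flow phi_flow theta_flow
  ft_graph (Ur Uv) (fr Uv) t1 tB BE DE CdE).
Qed.

Lemma theta_phiK v : U v -> theta (phi v) = v.
Proof.
move=> /Ur vr; apply: (planar_flow_inverse W11 tKw phi_flow theta_flow).
have vr1 : `|v| <= rad - 1 by lra.
by apply: le_trans (planar_flow_norm W11 tKw phi_flow vr1) _; lra.
Qed.

Lemma phi_U_rad w : (phi @` U) w -> `|w| <= rad - 3.
Proof.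
move=> [v /Ur vr <-]; have vr1 : `|v| <= rad - 1 by lra.
by apply: le_trans (planar_flow_norm W11 tKw phi_flow vr1) _; lra.
Qed.

(** On the image the density is dominated by the expansion [k] composed with [theta], and [k] is
    nonnegative on [U] because it dominates a square. The Lipschitz constant of [k] depends on [f]
    but does not survive in [transport_integral_le]. *)
Lemma density_integral_upper :
  (\int[mu_plane]_(w in phi @` U) (h w)%:E <=
   (int_on U (fun v => g v ^+ 2 + 2 * t * S v + Cu * t ^+ 2 * (1 + g v ^+ 2)))%:E)%E.
Proof.
pose k v := g v ^+ 2 + 2 * t * (g v * g1 v) + Cd * t ^+ 2 * (1 + g v ^+ 2).
have sk : smooth k.
  by rewrite /k; smoothness.
have hk v : U v -> h (phi v) <= k v.
  by move=> /density_expansion /abs_bounds[_]; rewrite lerBlDl.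
have Ur3 v : U v -> `|v| <= rad - 3 by move=> /Ur vr; lra.
have [Bk [L [Bk0 L0 kB kL]]] := bounded_lipschitz_smooth sk Ur.
have k0 v : U v -> 0 <= k v by move=> /hk; apply: le_trans; rewrite /h sqr_ge0.
apply: (@le_trans _ _ (\int[mu_plane]_(w in phi @` U) (k (theta w))%:E)%E).
  apply: le_integral_nonneg => [w _|_ [v Uv <-]]; first by rewrite lee_fin /h sqr_ge0.
  by rewrite lee_fin theta_phiK// hk.
apply: (@le_trans _ _ (\int[mu_plane]_(v in U) (k v * (1 + t * d v + C' * t ^+ 2))%:E)%E).
  apply: (transport_integral_le spsi W11 t1 tKw phi_flow theta_flow oU Ur3 D'E C0'E C'E _ _ L0 kL).
    by apply: continuous_measurable_plane => //; exact: smooth_continuous.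
  by move=> v Uv; rewrite k0//=; have := kB v Uv; exact: le_trans (ler_norm _).
rewrite (int_onE oU Ur); last first.
  by apply: smooth_continuous; smoothness.
rewrite lee_fin; apply: (int_on_le oU Ur).
- by apply: smooth_continuous; smoothness.
- by apply: smooth_continuous; smoothness.
move=> v Uv; have vr : `|v| <= rad by move: (Ur Uv); lra.
exact: (upper_integrand t1 B0 (g1_bound Uv) (divergence_bound vr) Cd0 C'0 CuE).
Qed.

(* Change of variables for theta on phi(U); the weight s absorbs the Jacobian of
   theta, so that no a priori bound on the right-hand side is needed. *)
Lemma density_integral_lower :
  ((int_on U (fun v => g v ^+ 2 + 2 * t * S v - Cl * t ^+ 2 * (1 + g v ^+ 2)))%:E <=
   \int[mu_plane]_(w in phi @` U) (h w)%:E)%E.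
Proof.
pose l v := g v ^+ 2 + 2 * t * (g v * g1 v) - Cd * t ^+ 2 * (1 + g v ^+ 2).
pose s v := 1 + t * d v - C4 * t ^+ 2.
have sl : smooth l.
  by rewrite /l; smoothness.
have ss : smooth s.
  by rewrite /s; smoothness.
pose k v := pos_part (l v) * s v.
(* Taking the positive part costs nothing, since the density is a square. *)
have lk v : U v -> pos_part (l v) <= h (phi v).
  move=> Uv; apply: pos_part_le; last by rewrite /h sqr_ge0.
  by have /abs_bounds[+ _] := density_expansion Uv; rewrite lerBrDl.
have jac v : U v -> 0 <= s v /\ s v * (1 - t * d (phi v) + C' * t ^+ 2) <= 1.
  move=> Uv; have vr : `|v| <= rad by move: (Ur Uv); lra.
  have pr : `|phi v| <= rad by have := phi_U_rad (imageP phi Uv); lra.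
  apply: (jacobian_product_le1 t1 tB (divergence_bound vr) (divergence_bound pr) _ C'0 C4E tC4).
  apply: le_trans (divergence_lipschitz vr pr) _.
  have vr1 : `|v| <= rad - 1 by move: (Ur Uv); lra.
  have := flow_map_moves (@mean_value_ineq_plane R) W11 tKw phi_flow vr1.
  rewrite distrC => hm.
  apply: (@le_trans _ _ (2 * K * (`|t| * K))); first by rewrite ler_wpM2l// mulr_ge0.
  have KB1 : K <= B by apply: le_trans K2B; rewrite mulr_natl mulr2n lerDl.
  rewrite mulrCA -mulrA (mulrC `|t|) mulrA ler_wpM2r// -mulrA -expr2 ler_wpM2l//.
  by rewrite ler_pXn2r// nnegrE.
have ck : continuous k.
  move=> v; apply: cvgM; last exact: (smooth_continuous ss).
  apply: cvgM; last exact: cvg_cst.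
  apply: cvgD; first exact: (smooth_continuous sl).
  by apply: cvg_norm; exact: (smooth_continuous sl).
apply: (@le_trans _ _ (\int[mu_plane]_(v in U) (k v)%:E)%E).
  rewrite (int_onE oU Ur ck) lee_fin; apply: (int_on_le oU Ur) => //.
    by apply: smooth_continuous; smoothness.
  move=> v Uv; have vr : `|v| <= rad by move: (Ur Uv); lra.
  apply: le_trans (lower_integrand t1 B0 (g1_bound Uv) (divergence_bound vr) Cd0 C40 ClE) _.
  by rewrite -/(l v) -/(s v) /k ler_wpM2r ?le_pos_part//; case: (jac v Uv).
have UE : theta @` (phi @` U) = U.
  apply/seteqP; split => [_ [_ [v Uv <-] <-]|v Uv]; first by rewrite theta_phiK.
  by exists (phi v); [exact: imageP|rewrite theta_phiK].
have oO : open (phi @` U).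
  by apply: (open_planar_flow_image W11 tKw phi_flow theta_flow oU) => v /Ur vr; lra.
have bk : bounded_lipschitz (phi @` U) (k \o theta).
  apply: (@bounded_lipschitz_comp _ U _ theta k 2) => //.
  - by move=> _ [v Uv <-]; rewrite theta_phiK.
  - move=> u v /phi_U_rad ur /phi_U_rad vr.
    by apply: (planar_flow_lipschitz W11 tKw' theta_flow); lra.
  apply: bounded_lipschitzM; last exact: bounded_lipschitz_smooth ss Ur.
  by apply: bounded_lipschitz_pos_part; exact: bounded_lipschitz_smooth sl Ur.
have [Bk [L [Bk0 L0 kB kL]]] := bk.
have k0 v : U v -> 0 <= k v.
  by move=> Uv; rewrite mulr_ge0 ?pos_part_ge0//; case: (jac v Uv).
(* [U] is rewritten as the image of phi(U) under [theta], so that [transport_integral_le] applies at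
   time [- t] with [phi] as the inverse. *)
have -> : (\int[mu_plane]_(v in U) (k v)%:E)%E =
    (\int[mu_plane]_(v in theta @` (phi @` U)) ((k \o theta) (phi v))%:E)%E.
  by rewrite UE; apply: eq_integral => v; rewrite inE => Uv; rewrite /= theta_phiK.
have t1' : `|- t| <= 1 by rewrite normrN.
apply: (@le_trans _ _ (\int[mu_plane]_(w in phi @` U)
    ((k \o theta) w * (1 + (- t) * d w + C' * (- t) ^+ 2))%:E)%E).
  apply: (transport_integral_le spsi W11 t1' tKw' theta_flow phi_flow' oO phi_U_rad
    D'E C0'E C'E _ _ L0 kL).
    apply: continuous_on_measurable_plane => // w Ow; apply: continuous_comp; last exact: ck.
    apply: differentiable_continuous; apply: (planar_flow_differentiable W11 tKw' theta_flow).
    by have := phi_U_rad Ow; lra.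
  move=> _ [v Uv <-]; rewrite /= theta_phiK// k0//=.
  by have := kB _ (imageP phi Uv); rewrite /= theta_phiK//; exact: le_trans (ler_norm _).
apply: le_integral_nonneg => _ [v Uv <-]; rewrite lee_fin /= theta_phiK// mulNr sqrrN.
  rewrite mulr_ge0 ?k0//.
  have pr : `|phi v| <= rad by have := phi_U_rad (imageP phi Uv); lra.
  have : `|t * d (phi v)| <= 4^-1.
    rewrite normrM; apply: le_trans tB; rewrite ler_wpM2l//; exact: divergence_bound.
  move=> /abs_bounds[_ td]; rewrite addr_ge0 ?(mulr_ge0 C'0) ?sqr_ge0//.
  by rewrite subr_ge0 (le_trans td)//; lra.
apply: le_trans (lk v Uv); rewrite /k -mulrA -[leRHS]mulr1 ler_wpM2l ?pos_part_ge0//.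
by case: (jac v Uv).
Qed.

Lemma energy_int_on : energy U f = (2^-1 * int_on U (fun v => g v ^+ 2))%:E.
Proof.
rewrite /energy EFinM; congr (_ * _)%E.
rewrite -(int_onE oU Ur)//; exact: smooth_continuous.
Qed.

Lemma mu_plane_int_on : mu_plane U = (int_on U (fun=> 1))%:E.
Proof.
rewrite (int_on_cst oU Ur) mul1r fineK//.
by rewrite ge0_fin_numE//; exact: (mu_plane_lty oU Ur).
Qed.

Lemma A1_A2_int_on : (A1 U psi f + A2 U psi f)%E = (int_on U S)%:E.
Proof.
have sw1 : smooth (w1 psi) by rewrite w1E.
have s1 : smooth (fun v => w1 psi v * iter 2 (nabla f) f v * nabla f f v
     + 2^-1 * (nabla f f v) ^+ 2 * (dx (w1 psi) v - dz (fun u => f u * w1 psi u) v)).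
  have sx := smooth_dx sw1; have sz := smooth_dz (smoothM sf sw1).
  by rewrite /=; smoothness.
have s2 : smooth (fun v => - iter 2 (nabla f) (w2 psi f) v * nabla f f v
     + 2^-1 * (nabla f f v) ^+ 2 * dz (w2 psi f) v).
  have sz := smooth_dz sw2.
  have sn : smooth (fun v => - iter 2 (nabla f) (w2 psi f) v).
    by apply: smoothN; rewrite /=; smoothness.
  by smoothness.
rewrite /A1 /A2 (int_onE oU Ur (smooth_continuous s1)) (int_onE oU Ur (smooth_continuous s2)).
rewrite -EFinD -(int_onD oU Ur (smooth_continuous s1) (smooth_continuous s2)).
congr (int_on U _)%:E; apply/funext => v.
by rewrite (variation_integrand spsi sf v) /S g1E.
Qed.

Lemma energy_expansion (C : R) : C = Cu + Cl + 1 ->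
  (`| energy (phi @` U) ft - energy U f - (A1 U psi f + A2 U psi f) * t%:E |
   <= C%:E * (energy U f + mu_plane U) * (t ^+ 2)%:E)%E.
Proof.
move=> CE; set e := int_on U (fun v => g v ^+ 2); set s := int_on U S.
set mu := int_on U (fun=> 1).
have cgg := smooth_continuous sgg; have cS := smooth_continuous sS.
have c1 : continuous (fun _ : plane R => 1 : R) by apply: smooth_continuous; exact: smooth_cst.
have comb (c : R) : int_on U (fun v => g v ^+ 2 + 2 * t * S v + c * (1 + g v ^+ 2)) =
    e + 2 * t * s + c * (mu + e).
  have cG : continuous (fun v => 1 + g v ^+ 2).
    by apply: smooth_continuous; smoothness.
  rewrite (int_onD oU Ur); last 2 first.
    - by apply: smooth_continuous; smoothness.
    - by apply: smooth_continuous; smoothness.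
  rewrite (int_onD oU Ur) //; last by apply: smooth_continuous; smoothness.
  rewrite (int_onZ oU Ur (2 * t) cS) (int_onZ oU Ur c cG) (int_onD oU Ur c1 cgg).
  by [].
have up := density_integral_upper; have low := density_integral_lower.
have lowE : (fun v => g v ^+ 2 + 2 * t * S v - Cl * t ^+ 2 * (1 + g v ^+ 2)) =
    (fun v => g v ^+ 2 + 2 * t * S v + (- (Cl * t ^+ 2)) * (1 + g v ^+ 2)).
  by apply/funext => v; rewrite mulNr.
rewrite comb in up; rewrite lowE comb in low.
rewrite energy_int_on mu_plane_int_on A1_A2_int_on /energy -/e -/s -/mu.
move: up low; set I := (\int[mu_plane]_(w in phi @` U) _)%E => up low.
(* Finiteness of the energy of [ft] comes from its two real bounds; no integrability of its density
   is invoked. *)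
have Ifin : I \is a fin_num.
  rewrite fin_numE; apply/andP; split.
    by apply: contraTneq low => ->.
  by apply: contraTneq up => ->.
rewrite -/I -(fineK Ifin) in up low *.
set i := fine I in up low *; rewrite !lee_fin in up low.
change ((`|2^-1 * i - 2^-1 * e - s * t|)%:E <= (C * (2^-1 * e + mu) * t ^+ 2)%:E)%E.
rewrite lee_fin.
have e0 : 0 <= e.
  apply: (@le_trans _ _ (int_on U (fun=> 0))).
    by rewrite (int_on_cst oU Ur) mul0r.
  apply: (int_on_le oU Ur) => // [v|v _]; [exact: cvg_cst|exact: sqr_ge0].
have mu0 : 0 <= mu by rewrite -lee_fin -mu_plane_int_on.
have T0 : 0 <= t ^+ 2 := sqr_ge0 t.
have Cu0 : 0 <= Cu.
  by rewrite CuE !(mulr_ge0, addr_ge0)// sqr_ge0.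
have Cl0 : 0 <= Cl.
  by rewrite ClE !(mulr_ge0, addr_ge0)// sqr_ge0.
have q0 : 0 <= t ^+ 2 * (mu + e) by rewrite mulr_ge0// addr_ge0.
have q1 : 0 <= t ^+ 2 * mu by rewrite mulr_ge0.
have r0 := mulr_ge0 Cu0 q0; have r1 := mulr_ge0 Cl0 q0.
have r2 := mulr_ge0 Cu0 q1; have r3 := mulr_ge0 Cl0 q1.
(* The errors are halves of multiples of mu + e; the claimed bound is split into these and further
   nonnegative terms, which leaves a linear problem. *)
have -> : C * (2^-1 * e + mu) * t ^+ 2 =
  2^-1 * (Cu * (t ^+ 2 * (mu + e))) + 2^-1 * (Cl * (t ^+ 2 * (mu + e)))
  + 2^-1 * (t ^+ 2 * (mu + e)) + 2^-1 * (Cu * (t ^+ 2 * mu)) + 2^-1 * (Cl * (t ^+ 2 * mu))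
  + 2^-1 * (t ^+ 2 * mu) by rewrite CE; field.
have upE : Cu * t ^+ 2 * (mu + e) = Cu * (t ^+ 2 * (mu + e)) by rewrite mulrA.
have lowE' : - (Cl * t ^+ 2) * (mu + e) = - (Cl * (t ^+ 2 * (mu + e))) by rewrite mulNr mulrA.
rewrite upE in up; rewrite lowE' in low.
have alg (x1 x2 x3 x4 x5 x6 ts : R) : 0 <= x1 -> 0 <= x2 -> 0 <= x3 -> 0 <= x4 -> 0 <= x5 ->
    0 <= x6 -> i <= e + 2 * ts + x1 -> e + 2 * ts - x2 <= i ->
    `|2^-1 * i - 2^-1 * e - ts| <=
      2^-1 * x1 + 2^-1 * x2 + 2^-1 * x3 + 2^-1 * x4 + 2^-1 * x5 + 2^-1 * x6.
  by move=> *; rewrite ler_norml; apply/andP; split; lra.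
have tsE : 2 * t * s = 2 * (s * t) by rewrite (mulrC s) mulrA.
rewrite tsE in up low.
exact: (alg _ _ _ _ _ _ _ r0 r1 q0 r2 r3 q1 up low).
Qed.

End EnergyExpansion.

(** * Compactly supported variations *)

Section VanishingOff.
Context {R : realType}.
Implicit Types (S : set (plane R)) (h k : plane R -> R).

Definition vanishes_off S h := forall v, ~ S v -> h v = 0.

Lemma vanishes_offMl S h k : vanishes_off S h -> vanishes_off S (fun v => h v * k v).
Proof. by move=> h0 v Sv; rewrite h0// mul0r. Qed.

Lemma vanishes_offMr S h k : vanishes_off S k -> vanishes_off S (fun v => h v * k v).
Proof. by move=> k0 v Sv; rewrite k0// mulr0. Qed.

Lemma vanishes_off_derive S h (u : plane R) : closed S -> vanishes_off S h ->
  vanishes_off S ('D_u h).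
Proof.
move=> cS h0 v Sv; rewrite (@near_eq_derive _ _ _ _ (cst 0)) ?derive_cst//.
have : nbhs v (~` S) by apply: open_nbhs_nbhs; split => //; exact: closed_openC.
by apply: filterS => w /h0.
Qed.

Lemma vanishes_off_nabla S f h : closed S -> vanishes_off S h -> vanishes_off S (nabla f h).
Proof.
move=> cS h0 v Sv; rewrite /nabla /dx /dz !(vanishes_off_derive _ cS h0 Sv).
by rewrite mulr0 subrr.
Qed.

End VanishingOff.

Section CompactlySupported.
Context {R : realType}.
Let mR := measurableTypeR R.
Let mplane := (mR * mR)%type.
Let lam : {measure set mR -> \bar R} := @lebesgue_measure R.
Variables (U S : set (plane R)) (r : R).
Hypothesis oU : open U.
Hypothesis Ur : forall v, U v -> `|v| <= r.
Hypothesis SU : S `<=` U.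
Hypothesis cS : closed S.

Lemma integral_derive_segment (F F' : R -> R) (a b : R) : a < b -> F a = 0 -> F b = 0 ->
  (forall x, x \notin `[a, b] -> F' x = 0) -> continuous F' ->
  (forall x : R, is_derive x 1 F (F' x)) -> (\int[lam]_x (F' x)%:E = 0)%E.
Proof.
move=> ab Fa Fb F'0 cF' dF.
transitivity (\int[lam]_(x in `[a, b]) (F' x)%:E)%E.
  rewrite [RHS]integral_mkcond; apply: eq_integral => x _; rewrite patchE.
  by case: ifPn => //; rewrite notin_setE => xab; rewrite F'0//; apply/negP.
rewrite (@continuous_FTC2 R F' F a b ab); first by rewrite Fa Fb subee.
- exact: continuous_subspaceT.
- have cF : continuous F.
    by move=> x; apply: differentiable_continuous; apply/derivable1_diffP; case: (dF x).
  split.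
  + by move=> x _; case: (dF x).
  + by apply: cvg_at_right_filter; exact: cF.
  + by apply: cvg_at_left_filter; exact: cF.
- by move=> x _; rewrite derive1E; case: (dF x).
Qed.

Lemma integral_vanishing_off h : continuous h -> vanishes_off S h ->
  (\int[mu_plane]_(v in U) (h v)%:E = \int[mu_plane]_v (h v)%:E)%E /\
  mu_plane.-integrable [set: mplane] (EFin \o (h : mplane -> R)).
Proof.
move=> ch h0; have mU : measurable (U : set mplane) := open_measurable_plane oU.
have E : (EFin \o (h : mplane -> R)) \_ U = EFin \o (h : mplane -> R).
  apply/funext => v; rewrite patchE; case: ifPn => //; rewrite notin_setE => Uv.
  by rewrite /= h0// => /SU.
split.
  rewrite integral_mkcond; apply: eq_integral => v _.
  exact: (congr1 (@^~ v) E).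
have := integrable_continuous oU Ur ch.
by rewrite (integrable_mkcond _ mU) E.
Qed.

(** The integrand extends by zero to the plane and is integrated first along horizontal lines, where
    it is a derivative. The points at abscissa |r| + 1 or - (|r| + 1) lie outside [U], so the
    boundary terms vanish. *)
Lemma int_on_dx h : smooth h -> vanishes_off S h -> int_on U (dx h) = 0.
Proof.
move=> sh h0; have h'0 : vanishes_off S (dx h) by exact: vanishes_off_derive.
have ch := smooth_continuous (smooth_dx sh).
have [E ih] := integral_vanishing_off ch h'0.
apply: EFin_inj; rewrite -(int_onE oU Ur ch) E.
have := @integral21_prod_meas1 _ _ mR mR R lam lam (EFin \o (dx h : mplane -> R)) ih.
move=> /= <-.
apply: integral0_eq => z _ /=; rewrite /fubini_G /=.
have off (x : R) : `|r| + 1 <= `|x| -> ~ S (x, z).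
  move=> xr /SU /Ur; rewrite leNgt => /negP; apply.
  apply: lt_le_trans (norm_fst_le (x, z)); apply: lt_le_trans xr.
  by rewrite (le_lt_trans (ler_norm r))// ltrDl.
have r0 := normr_ge0 r.
apply: (@integral_derive_segment (fun x => h (x, z)) (fun x => dx h (x, z))
  (- (`|r| + 1)) (`|r| + 1)).
- lra.
- by apply: h0; apply: off; rewrite normrN ler_norm.
- by apply: h0; apply: off; rewrite ler_norm.
- move=> x; rewrite in_itv/= -ler_norml -ltNge => xr.
  by apply: h'0; apply: off; exact: ltW.
- move=> x; apply: (@continuous_comp _ _ _ (fun x => (x, z)) (dx h)); last exact: ch.
  exact: (cvg_pair (@cvg_id _ (nbhs x)) (cvg_cst z)).
move=> x; have := @is_derive_line R _ _ h (0, z) (1, 0) x.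
have lE (y : R) : y *: ((1, 0) : plane R) + (0, z) = (y, z).
  by congr pair; rewrite /= /GRing.scale/= ?mulr1 ?mulr0 ?addr0 ?add0r.
rewrite lE; under eq_fun do rewrite lE.
by apply; exact: smooth_derivable.
Qed.

Lemma int_on_dz h : smooth h -> vanishes_off S h -> int_on U (dz h) = 0.
Proof.
move=> sh h0; have h'0 : vanishes_off S (dz h) by exact: vanishes_off_derive.
have ch := smooth_continuous (smooth_dz sh).
have [E ih] := integral_vanishing_off ch h'0.
apply: EFin_inj; rewrite -(int_onE oU Ur ch) E.
have := @integral12_prod_meas1 _ _ mR mR R lam lam (EFin \o (dz h : mplane -> R)) ih.
move=> /= <-.
apply: integral0_eq => z _ /=; rewrite /fubini_F /=.
have off (x : R) : `|r| + 1 <= `|x| -> ~ S (z, x).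
  move=> xr /SU /Ur; rewrite leNgt => /negP; apply.
  apply: lt_le_trans (norm_snd_le (z, x)); apply: lt_le_trans xr.
  by rewrite (le_lt_trans (ler_norm r))// ltrDl.
have r0 := normr_ge0 r.
apply: (@integral_derive_segment (fun x => h (z, x)) (fun x => dz h (z, x))
  (- (`|r| + 1)) (`|r| + 1)).
- lra.
- by apply: h0; apply: off; rewrite normrN ler_norm.
- by apply: h0; apply: off; rewrite ler_norm.
- move=> x; rewrite in_itv/= -ler_norml -ltNge => xr.
  by apply: h'0; apply: off; exact: ltW.
- move=> x; apply: (@continuous_comp _ _ _ (fun x => (z, x)) (dz h)); last exact: ch.
  exact: (cvg_pair (cvg_cst z) (@cvg_id _ (nbhs x))).
move=> x; have := @is_derive_line R _ _ h (z, 0) (0, 1) x.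
have lE (y : R) : y *: ((0, 1) : plane R) + (z, 0) = (z, y).
  by congr pair; rewrite /= /GRing.scale/= ?mulr1 ?mulr0 ?addr0 ?add0r.
rewrite lE; under eq_fun do rewrite lE.
by apply; exact: smooth_derivable.
Qed.

(** The integrand is dx h - dz (f h), the divergence of h (1, - f). This is integration by parts for
    [nabla f], whose own divergence is - dz f. *)
Lemma int_on_div f h : smooth f -> smooth h -> vanishes_off S h ->
  int_on U (fun v => nabla f h v - dz f v * h v) = 0.
Proof.
move=> sf sh h0; have sfh := smoothM sf sh.
have -> : (fun v => nabla f h v - dz f v * h v) =
    (fun v => dx h v + (-1) * dz (fun u => f u * h u) v).
  apply/funext => v; rewrite dzM// /nabla.
  have alg (F fz hx hz H : R) : hx - F * hz - fz * H = hx + -1 * (F * hz + H * fz) by ring.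
  exact: alg.
have c1 := smooth_continuous (smooth_dx sh); have c2 := smooth_continuous (smooth_dz sfh).
rewrite (int_onD oU Ur) //; last by move=> v; apply: cvgM; [exact: cvg_cst|exact: c2].
rewrite (int_onZ oU Ur)// int_on_dx// int_on_dz//; last exact: vanishes_offMr.
by rewrite mulr0 addr0.
Qed.

End CompactlySupported.

Section CompactVariation.
Context {R : realType}.
Variables (psi : heis R -> R) (f : plane R -> R).
Hypothesis spsi : smooth psi.
Hypothesis sf : smooth f.
Variables (U : set (plane R)) (r : R).
Hypothesis oU : open U.
Hypothesis Ur : forall v, U v -> `|v| <= r.
Hypothesis suppW : compactly_supported_in U (planeW psi).

Let S := closure [set v | planeW psi v != 0].
Let cS : closed S. Proof. exact: closed_closure. Qed.
Let SU : S `<=` U. Proof. by case: suppW. Qed.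

Let sal := smooth_psi0 spsi.
Let sbe := smooth_Ypsi0 spsi.
Let g := nabla f f.
Let sg : smooth g := smooth_nabla sf sf.
Let fz := dz f.
Let sfz : smooth fz := smooth_dz sf.
Let sw1 : smooth (w1 psi). Proof. by rewrite w1E. Qed.
Let sw2 : smooth (w2 psi f).
Proof. by rewrite w2E; smoothness. Qed.

Let planeW0 v : ~ S v -> planeW psi v = 0.
Proof.
move=> Sv; apply: contrapT => /eqP W0; apply: Sv; exact: subset_closure.
Qed.

Lemma w1_vanishes : vanishes_off S (w1 psi).
Proof. by move=> v /planeW0; rewrite /w1 => ->. Qed.

Lemma w2_vanishes : vanishes_off S (w2 psi f).
Proof. by move=> v /planeW0; rewrite /w2 => -> /=; rewrite mul0r addr0. Qed.

Let divergence_zero h : smooth h -> vanishes_off S h ->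
  int_on U (fun v => nabla f h v - dz f v * h v) = 0.
Proof. exact: (int_on_div oU Ur SU cS sf). Qed.

(** The integrand is the divergence of (w1 g^2 / 2) (1, - f). *)
Lemma A1_eq0 : A1 U psi f = 0%E.
Proof.
pose h v := w1 psi v * (2^-1 * g v * g v).
have sh : smooth h by rewrite /h; smoothness.
have h0 : vanishes_off S h by apply: vanishes_offMl; exact: w1_vanishes.
rewrite -[RHS]/(0%:E) -(divergence_zero sh h0) -(int_onE oU Ur); last first.
  have snh := smooth_nabla sf sh.
  by apply: smooth_continuous; smoothness.
apply: eq_integral => v _; congr EFin.
have s1 : smooth (fun v => 2^-1 * g v) by smoothness.
have s2 := smoothM s1 sg; have sc : smooth (fun _ : plane R => 2^-1 : R) by exact: smooth_cst.
rewrite /h (nablaM _ _ sw1 s2) (nablaM _ _ s1 sg) (nablaM _ _ sc sg) dzM//.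
have -> : nabla f (fun=> 2^-1) v = 0.
  by rewrite /nabla /dx /dz !derive_cst mulr0 subrr.
rewrite [nabla f (w1 psi) v]/nabla /= -/g.
have alg (w G H wx wz F f_z : R) :
  w * H * G + 2^-1 * G ^+ 2 * (wx - (F * wz + w * f_z)) =
  w * (2^-1 * G * H + G * (2^-1 * H + G * 0)) + 2^-1 * G * G * (wx - F * wz)
   - f_z * (w * (2^-1 * G * G)) by field.
exact: alg.
Qed.

(** The commutator of [dz] with [nabla f] is - dz f dz; this uses the symmetry of mixed
    derivatives. *)
Let dz_g v : dz g v = nabla f fz v - fz v ^+ 2.
Proof.
have sx := smooth_dx sf; have sffz := smoothM sf sfz.
rewrite /g {1}/nabla dzB// dzM// /nabla /fz dx_dz_comm//.
have alg (a F b z : R) : a - (F * b + z * z) = a - F * b - z ^+ 2 by ring.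
exact: alg.
Qed.

Let variation v := (w2 psi f v * fz v + nabla f (w2 psi f) v) * nabla f g v.

Let svariation : smooth variation.
Proof. by rewrite /variation; smoothness. Qed.

(* With D h := dx h - dz (f h), the integrand of A2 and the variation differ by
   dz (w2 g^2 / 2) - D (g nabla w2) - D (g w2 dz f). *)
Lemma A2_integrated_once : A2 U psi f = (int_on U variation)%:E.
Proof.
pose h1 v := nabla f (w2 psi f) v * g v; pose h2 v := w2 psi f v * (g v * fz v).
pose h3 v := w2 psi f v * (2^-1 * g v * g v).
have sn := smooth_nabla sf sw2; have snn := smooth_nabla sf sn.
have sh1 : smooth h1 by rewrite /h1; smoothness.
have sh2 : smooth h2 by rewrite /h2; smoothness.
have sh3 : smooth h3 by rewrite /h3; smoothness.
have h10 : vanishes_off S h1.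
  by apply: vanishes_offMl; apply: vanishes_off_nabla => //; exact: w2_vanishes.
have h20 : vanishes_off S h2 by apply: vanishes_offMl; exact: w2_vanishes.
have h30 : vanishes_off S h3 by apply: vanishes_offMl; exact: w2_vanishes.
pose D h v := nabla f h v - fz v * h v.
have sD h : smooth h -> smooth (D h).
  by move=> sh; have sz := smooth_nabla sf sh; rewrite /D; smoothness.
have sz2 := smooth_dz sw2; have sz3 := smooth_dz sh3.
have cD h : smooth h -> continuous (D h) by move=> /sD; exact: smooth_continuous.
have E v : - iter 2 (nabla f) (w2 psi f) v * nabla f f v
     + 2^-1 * (nabla f f v) ^+ 2 * dz (w2 psi f) v
  = variation v + (-1 * D h1 v + (-1 * D h2 v + dz h3 v)).
  have sgf := smoothM sg sfz; have s1 : smooth (fun v => 2^-1 * g v) by smoothness.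
  have s2 := smoothM s1 sg; have sc : smooth (fun _ : plane R => 2^-1 : R) by exact: smooth_cst.
  rewrite /D /h1 /h2 /h3 (nablaM _ _ sn sg) (nablaM _ _ sw2 sgf) (nablaM _ _ sg sfz).
  rewrite (dzM _ sw2 s2) (dzM _ s1 sg) (dzM _ sc sg) dz_g /variation -/g /=.
  have -> : dz (fun=> 2^-1) v = 0 by rewrite /dz derive_cst.
  have alg (w nw nnw wz G z nz H : R) :
    - nnw * G + 2^-1 * G ^+ 2 * wz =
    (w * z + nw) * H + (-1 * (nw * H + G * nnw - z * (nw * G)) +
     (-1 * (w * (G * nz + z * H) + G * z * nw - z * (w * (G * z))) +
      (w * (2^-1 * G * (nz - z ^+ 2) + G * (2^-1 * (nz - z ^+ 2) + G * 0)) + 2^-1 * G * G * wz)))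
    by field.
  exact: alg.
have c1 : continuous (fun v => -1 * D h1 v).
  by have sd := sD _ sh1; apply: smooth_continuous; smoothness.
have c2 : continuous (fun v => -1 * D h2 v).
  by have sd := sD _ sh2; apply: smooth_continuous; smoothness.
have c3 : continuous (fun v => -1 * D h2 v + dz h3 v).
  by have sd := sD _ sh2; apply: smooth_continuous; smoothness.
have c4 : continuous (fun v => -1 * D h1 v + (-1 * D h2 v + dz h3 v)).
  by have sd := sD _ sh2; have sd' := sD _ sh1; apply: smooth_continuous; smoothness.
have c5 := smooth_continuous svariation; have c6 := smooth_continuous sz3.
rewrite /A2; under eq_integral do rewrite E.
rewrite (int_onE oU Ur); last by move=> v; apply: cvgD; [exact: c5|exact: c4].
rewrite (int_onD oU Ur c5 c4) (int_onD oU Ur c1 c3) (int_onD oU Ur c2 c6).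
rewrite !(int_onZ oU Ur) //; [|exact: cD|exact: cD].
by rewrite !divergence_zero// (int_on_dz oU Ur SU cS sh3 h30) !mulr0 !addr0.
Qed.

(** One more integration by parts, with h = w2 nabla^2 f, moves the derivative off [w2] and
    contributes the second copy of dz f. *)
Lemma A2_integrated_twice : A2 U psi f =
  (int_on U (fun v => w2 psi f v * (2 * dz f v * nabla f g v - nabla f (nabla f g) v)))%:E.
Proof.
pose h v := w2 psi f v * nabla f g v.
have sn := smooth_nabla sf sg; have snn := smooth_nabla sf sn.
have sh : smooth h by rewrite /h; smoothness.
have h0 : vanishes_off S h by apply: vanishes_offMl; exact: w2_vanishes.
rewrite A2_integrated_once; congr EFin.
have -> : variation = fun v =>
    w2 psi f v * (2 * dz f v * nabla f g v - nabla f (nabla f g) v)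
    + (nabla f h v - dz f v * h v).
  apply/funext => v; rewrite /h (nablaM _ _ sw2 sn) /variation /fz.
  have alg (w z nw H HH : R) : (w * z + nw) * H =
    w * (2 * z * H - HH) + (w * HH + H * nw - z * (w * H)) by ring.
  exact: alg.
have snh := smooth_nabla sf sh.
rewrite (int_onD oU Ur).
- by rewrite divergence_zero// addr0.
- by apply: smooth_continuous; smoothness.
- by apply: smooth_continuous; smoothness.
Qed.

Lemma compact_first_variation : [/\ A1 U psi f = 0%E,
  A2 U psi f = (\int[mu_plane]_(v in U)
    ((w2 psi f v * dz f v + nabla f (w2 psi f) v) * iter 2 (nabla f) f v)%:E)%E &
  A2 U psi f = (\int[mu_plane]_(v in U)
    (w2 psi f v * (2 * dz f v * iter 2 (nabla f) f v - iter 3 (nabla f) f v))%:E)%E].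
Proof.
split; first exact: A1_eq0.
  by rewrite A2_integrated_once -(int_onE oU Ur)//; exact: smooth_continuous.
rewrite A2_integrated_twice -(int_onE oU Ur)//.
have sn := smooth_nabla sf sg; have snn := smooth_nabla sf sn.
by apply: smooth_continuous; smoothness.
Qed.

End CompactVariation.

(** * Uniform constants *)

Section EssentialBound.
Context {R : realType}.
Let mR := measurableTypeR R.
Let mplane := (mR * mR)%type.

Lemma square_sub_open (A : set (plane R)) v : open A -> A v ->
  exists2 r : R, 0 < r & square v r `<=` A.
Proof.
move=> oA Av; have /nbhs_ballP[r /= r0 rA] : nbhs v A by exact: open_nbhs_nbhs.
exists r => // w /squareP vw; apply: rA.
by rewrite -ball_normE /= distrC.
Qed.

(** By continuity, exceeding [m] at one point of the open set means exceeding it on a small square,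
    which has positive measure. *)
Lemma norm_oo_bound (U : set (plane R)) (f : plane R -> R) (m : R) :
  open U -> continuous f -> norm_oo U f = m%:E -> forall v, U v -> `|f v| <= m.
Proof.
move=> oU cf fm v Uv; rewrite leNgt; apply/negP => mv.
pose N := U `&` [set w | m < `|f w|].
have oN : open N.
  apply: openI => //.
  have cn : continuous (fun w : plane R => `|f w|) by move=> w; apply: cvg_norm; exact: cf.
  have := @open_comp _ _ (fun w : plane R => `|f w|) [set x | m < x] (fun w _ => cn w).
  by apply; exact: open_gt.
have [r r0 rN] := square_sub_open oN (conj Uv mv).
have muS := mu_plane_square v r0.
have S0 : (0 < mu_plane (square v r : set mplane))%E.
  by rewrite muS lte_fin exprn_gt0// mulr_gt0.
(* The norm unfolds to an essential supremum only when the whole space has positive measure. *)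
have muT : (0 < mu_plane [set: mplane])%E.
  apply: lt_le_trans S0 _.
  exact: (le_measure mu_plane (mem_set (measurable_square v r)) (mem_set measurableT)).
move: fm; rewrite /norm_oo unlock /= muT => fm.
have := @ess_sup_ge _ mplane R mu_plane (abse \o (EFin \o (f \_ U))).
rewrite fm => -[A [mA muA sub]].
have SA : square v r `<=` A.
  move=> w Sw; apply: sub => /=; have [Uw mw] := rN _ Sw.
  by rewrite patchE mem_set// lee_fin leNgt mw.
have := le_measure mu_plane (mem_set (measurable_square v r)) (mem_set mA) SA.
have A0 : (mu_plane A < mu_plane (square v r : set mplane))%E by rewrite muA.
by move=> /(lt_le_trans A0); rewrite ltxx.
Qed.

End EssentialBound.

Lemma energy_first_variation (R : realType) (psi : heis R -> R) (U : set (plane R)) (m : R) :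
  smooth psi -> (forall p, vf_act fieldY (vf_act fieldY psi) p = 0) ->
  open U -> bounded_set U ->
  exists eps0 C : R, [/\ 0 < eps0, 0 < C &
    forall (f : plane R -> R) (eps : R) (phi : R -> heis R -> heis R)
           (ft : R -> plane R -> R),
      smooth f -> norm_oo U f = m%:E ->
      0 < eps -> is_flow (contact_field psi) eps phi ->
      (forall t, - eps <= t <= eps ->
        intrinsic_graph (ft t) = phi t @` intrinsic_graph f) ->
      forall t, - eps0 <= t <= eps0 -> - eps <= t <= eps ->
         (`| energy (phibar phi t @` U) (ft t) - energy U f
             - (A1 U psi f + A2 U psi f) * t%:E |
          <= C%:E * (energy U f + mu_plane U) * (t ^+ 2)%:E)%E].
Proof.
move=> spsi YYpsi oU [rU [_ /(_ (rU + 1))]]; rewrite ltrDl ltr01 => /(_ isT) UrU.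
(* [U] has norm at most rU + 1 and [f] is at most [m] on it; the estimates give up 4 units of
   radius. *)
pose rad := `|rU| + `|m| + 5.
have [Kp Kp0 Wp] := planar_field_C11 spsi rad.
have [Ka Ka0 Fa] := adapted_field_C11 spsi rad.
pose K := Kp + Ka.
have W11 := C11_on_ballW (ler_wpDr Ka0 (lexx Kp)) Wp.
have F11 := C11_on_ballW (ler_wpDl Kp0 (lexx Ka)) Fa.
rewrite -/K in W11 F11.
have K0 : 0 <= K by rewrite addr_ge0.
have rad5 : 5 <= rad by rewrite lerDr addr_ge0.
have rad1 : 1 <= rad by apply: le_trans rad5; rewrite ler1n.
have rad0 : 0 <= 1 + rad by rewrite addr_ge0// (le_trans ler01).
pose B := (5 * K + 4 * K ^+ 2) * (1 + rad).
pose D := 4 * B + 8 * B ^+ 2.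
pose Cd := 2 * (4 * B ^+ 2 + 2 * (1 + 2 * B) * D + D ^+ 2).
pose D' := 2 * K ^+ 2 + 2 * (4 * K + 4 * K ^+ 2).
pose C0' := K ^+ 2 + 3 * D' + 2 * D' ^+ 2.
pose C' := C0' + 2 * K ^+ 2 * (2 + 2 * C0').
pose C4 := 4 * B ^+ 2 + 2 * C'.
pose Cu := C' + 6 * B ^+ 2 + 6 * (C' * B) + Cd * (1 + B + C').
pose Cl := 6 * B ^+ 2 + C4 + 6 * (C4 * B) + Cd * (1 + B).
have K20 := sqr_ge0 K.
have B0 : 0 <= B by rewrite mulr_ge0// addr_ge0// mulr_ge0.
have B20 := sqr_ge0 B.
have D0 : 0 <= D by rewrite addr_ge0// mulr_ge0.
have D20 := sqr_ge0 D.
have Cd0 : 0 <= Cd by rewrite mulr_ge0// !addr_ge0// mulr_ge0// mulr_ge0// addr_ge0// mulr_ge0.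
have D'0 : 0 <= D' by rewrite addr_ge0// mulr_ge0// addr_ge0// mulr_ge0.
have D'20 := sqr_ge0 D'.
have C0'0 : 0 <= C0' by rewrite !addr_ge0// mulr_ge0.
have C'0 : 0 <= C' by rewrite addr_ge0// mulr_ge0// ?mulr_ge0// addr_ge0// mulr_ge0.
have C40 : 0 <= C4 by rewrite addr_ge0// mulr_ge0.
have B620 : 0 <= 6 * B ^+ 2 by rewrite mulr_ge0.
have C'B0 : 0 <= 6 * (C' * B) by rewrite mulr_ge0// mulr_ge0.
have C4B0 : 0 <= 6 * (C4 * B) by rewrite mulr_ge0// mulr_ge0.
have CdB0 : 0 <= Cd * (1 + B) by rewrite mulr_ge0// addr_ge0.
have CdBC0 : 0 <= Cd * (1 + B + C') by rewrite mulr_ge0// addr_ge0// addr_ge0.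
have Cu0 : 0 <= Cu by rewrite addr_ge0// addr_ge0// addr_ge0.
have Cl0 : 0 <= Cl by rewrite addr_ge0// addr_ge0// addr_ge0.
(* For |t| <= 1 / E the three smallness conditions |t| <= 1, |t| B <= 1/4 and |t| C4 <= 1/2 hold
   together. *)
pose E := 4 * (B + C4 + 1).
have E0 : 0 < E by rewrite mulr_gt0// ltr_wpDl// addr_ge0.
exists E^-1, (Cu + Cl + 1); split.
- by rewrite invr_gt0.
- by rewrite ltr_wpDl// addr_ge0.
move=> f eps phi ft sf fm eps0 phi_flow ft_graph t tE teps.
have tE1 : `|t| * E <= 1 by rewrite -ler_pdivlMr// mul1r ler_norml.
have nt0 := normr_ge0 t.
have tBC : `|t| * B + `|t| * C4 + `|t| <= 4^-1.
  have -> : `|t| * B + `|t| * C4 + `|t| = 4^-1 * (`|t| * E) by rewrite /E; field.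
  by rewrite -[leRHS]mulr1 ler_wpM2l.
have tB0 : 0 <= `|t| * B by rewrite mulr_ge0.
have tC0 : 0 <= `|t| * C4 by rewrite mulr_ge0.
have t1 : `|t| <= 1 by lra.
have tB : `|t| * B <= 4^-1 by lra.
have tC4 : `|t| * C4 <= 2^-1 by lra.
have fU := norm_oo_bound oU (smooth_continuous sf) fm.
pose Phi (s : R) (P : heis R) := adapted (phi s (graph_point P.1 P.2)).
have teps' : - eps <= - t <= eps by rewrite lerN2 lerNl andbC.
have Phi_flow s : - eps <= s <= eps -> flow_map (adapted_field psi) s (Phi s).
  by move=> sE P; exact: (flow_solution spsi YYpsi eps0 phi_flow P sE).
(* [phibar] starts at points with y = 0; as the planar part of the adapted flow is autonomous, these
   curves also carry the projections of the points of the graph. *)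
have pb_flow s : - eps <= s <= eps -> flow_map (planar_field psi) s (phibar phi s).
  move=> sE v; have [c [sc c0 c1]] := Phi_flow s sE (v, 0).
  exists (fst \o c); split; first exact: planar_solution sc.
    by rewrite /= c0.
  by rewrite /= c1 /Phi /= graph_point0.
have graph v : ft t (Phi t (v, f v)).1 = (Phi t (v, f v)).2.
  have : (phi t @` intrinsic_graph f) (phi t (graph_point v (f v))).
    by apply: imageP; exists v.
  rewrite -(ft_graph t teps) => -[v' _ v'E].
  rewrite /Phi /= -v'E -/(graph_point v' (ft t v')) /adapted /= heis_proj_graph_point.
  by rewrite add0r.
have rU4 : rU + 1 <= rad - 4 by have := normr_ge0 m; have := ler_norm rU; rewrite /rad; lra.
have m4 : m <= rad - 4 by have := normr_ge0 rU; have := ler_norm m; rewrite /rad; lra.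
have Ur v : U v -> `|v| <= rad - 4 by move=> Uv; apply: le_trans rU4; exact: UrU.
have fr v : U v -> `|f v| <= rad - 4 by move=> Uv; apply: le_trans m4; exact: fU.
exact: (energy_expansion spsi sf rad1 W11 F11 (Phi_flow t teps) (pb_flow t teps)
  (pb_flow (- t) teps') graph oU Ur fr (erefl B) (erefl D) (erefl Cd) (erefl D') (erefl C0')
  (erefl C') (erefl C4) (erefl Cu) (erefl Cl) t1 tB tC4 erefl).
Qed.

Theorem theorem4p5 (R : realType) (psi : heis R -> R) (U : set (plane R))
    (m : R) :
  smooth psi ->
  (forall p, vf_act fieldY (vf_act fieldY psi) p = 0) ->
  open U -> bounded_set U ->
  exists eps0 C : R, [/\ 0 < eps0, 0 < C &
    forall (f : plane R -> R) (eps : R) (phi : R -> heis R -> heis R)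
           (ft : R -> plane R -> R),
      smooth f -> norm_oo U f = m%:E ->
      0 < eps -> is_flow (contact_field psi) eps phi ->
      (forall t, - eps <= t <= eps -> intrinsic_graph (ft t) = phi t @` intrinsic_graph f) ->
      (forall t, - eps0 <= t <= eps0 -> - eps <= t <= eps ->
         (`| energy (phibar phi t @` U) (ft t) - energy U f
             - (A1 U psi f + A2 U psi f) * t%:E |
          <= C%:E * (energy U f + mu_plane U) * (t ^+ 2)%:E)%E)
      /\
      (compactly_supported_in U (planeW psi) ->
         [/\ A1 U psi f = 0%E,
             A2 U psi f =
               (\int[mu_plane]_(v in U)
                  ((w2 psi f v * dz f v + nabla f (w2 psi f) v)
                   * iter 2 (nabla f) f v)%:E)%E &
             A2 U psi f =
               (\int[mu_plane]_(v in U)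
                  (w2 psi f v * (2 * dz f v * iter 2 (nabla f) f v
                                 - iter 3 (nabla f) f v))%:E)%E])].
Proof.
move=> spsi YYpsi oU bU.
have [eps0 [C [eps0_gt0 C_gt0 expansion]]] := energy_first_variation m spsi YYpsi oU bU.
exists eps0, C; split => // f eps phi ft sf fm eps_gt0 phi_flow ft_graph; split.
  exact: expansion phi_flow ft_graph.
have [r [_ Ur]] := bU.
apply: (@compact_first_variation _ _ _ spsi sf _ (r + 1) oU) => v Uv.
by apply: Ur => //; rewrite ltrDl.
Qed.
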